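(* Let $(M,g,\bullet,e,E)$ be a holomorphic Frobenius structure on a small ball $M\subset\mathbb{C}^N$ centered at $0$, and suppose $0$ is a semi-simple point (the algebra $(T_0M,\bullet_0)$ has no nilpotents) such that: (1) the restriction $E_0\in T_0M$ of the Euler field has a $k$-th root $v\in T_0M$ (i.e. $v^{\bullet k}=E_0$, for some integer $k\ge1$) which is invertible and generates the algebra $T_0M$; (2) if $\overline{\mu}$ and $\mathrm{Diag}(u^1_{(0)},\dots,u^N_{(0)})$ denote the matrices of the Hodge grading operator $\mu$ and of the operator $E_0\bullet_0$ in a basis of $T_0M$ diagonalizing $\bullet_0$, then for every pair $(i,j)$ with $u^i_{(0)}=u^j_{(0)}$ the $(i,j)$-entry of $\overline{\mu}$ vanishes. Then the Frobenius structure on $M$ is uniquely determined by the Frobenius algebra $T_0M$ (with $g_0,\bullet_0,e_0$), the vector $E_0$ and the operator $\mu$. Precisely: if $(M',g',\bullet',e',E')$ is another Frobenius structure satisfying the same hypotheses at $0$ and $L:T_0M\to T_0M'$ is a linear isomorphism preserving the metric, product, unit and Euler vector and intertwining $\mu$ and $\mu'$, then the linear map of flat coordinate systems induced by $L$ is an isomorphism of the Frobenius structures near $0$.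
   Context: A Frobenius structure on a ball $M\subset\mathbb{C}^N$ consists of: a holomorphic non-degenerate symmetric bilinear form $g$ on $TM$; a holomorphically varying commutative multiplication $\bullet_t$ on each $T_tM$; a vector field $e$ restricting to the unit of each $\bullet_t$; and a vector field $E$ (Euler field), satisfying: (1) $g(X\bullet Y_1,Y_2)=g(Y_1,X\bullet Y_2)$; (2) $\mathcal{L}_Eg=Dg$ for a constant $D$; (3) $\nabla^{LC}e=0$, where $\nabla^{LC}$ is the Levi-Civita connection of $g$; (4) the connection $\nabla=\nabla^{LC}-z^{-1}\sum_i(\partial_{t_i}\bullet_t)dt_i+(z^{-2}(E\bullet_t)-z^{-1}\mu)dz$ on the pullback of $TM$ to $M\times\mathbb{C}^*$ is flat, where $\mu:=\nabla^{LC}(E)-(D/2)\mathrm{Id}$ is the Hodge grading operator. (These conditions imply $g$ is flat, so flat coordinates exist, and $\bullet$ is associative.) *)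

(* Defs.v *)
(* Complex numbers are R[i] (mathcomp
   real-closed "complex") over an arbitrary realType R; points of C^N and
   tangent vectors are row vectors 'rV[R[i]]_N (standard coordinates of the
   ambient C^N).  All tensors are written in these standard coordinates. *)
From HB Require Import structures.
From mathcomp Require Import all_boot all_order all_algebra.
From mathcomp Require Import complex.
From mathcomp Require Import all_classical all_reals all_analysis.
Import Order.TTheory GRing.Theory Num.Theory.
Import numFieldNormedType.Exports.

Set Implicit Arguments.
Unset Strict Implicit.
Unset Printing Implicit Defensive.

Local Open Scope ring_scope.
Local Open Scope classical_set_scope.

Section Frobenius.
Variable R : realType.
Local Notation C := (R[i]).
Variable N : nat.
Local Notation pt := ('rV[C]_N).
Local Notation ptN := ('rV[C]_N : normedModType C).

Definition pd (f : pt -> C) (i : 'I_N) (p : pt) : C :=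
  @derive C pt C^o (f : pt -> C^o) p (delta_mx 0 i).

Definition zder (f : C -> C) (z : C) : C := @derive C C^o C^o (f : C^o -> C^o) z 1.

(* holomorphic at p : complex-differentiable (with C-linear differential) *)
Definition holo_at (f : pt -> C) (p : pt) : Prop :=
  differentiable (f : pt -> C^o) (p : ptN).

(* Jacobian matrix of a map C^N -> C^N : entry (i,a) = d f^a / d x_i,
   so that the differential acts on row vectors by X |-> X *m jac f p *)
Definition jac (f : pt -> pt) (p : pt) : 'M[C]_N :=
  \matrix_(i, a) pd (fun q => f q 0 a) i p.

Definition bil (G : 'M[C]_N) (X Y : pt) : C := (X *m G *m Y^T) 0 0.

(* product X .t Y built from structure constants:
   c t i j = d_i .t d_j  (a vector) *)
Definition prod (c : pt -> 'I_N -> 'I_N -> pt) (t X Y : pt) : pt :=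
  \sum_(i < N) \sum_(j < N) (X 0 i * Y 0 j) *: c t i j.

Definition christoffel (g : pt -> 'M[C]_N) (t : pt) (k i l : 'I_N) : C :=
  2^-1 * \sum_(m < N) (invmx (g t)) k m *
     (pd (fun p => g p m l) i t + pd (fun p => g p m i) l t
      - pd (fun p => g p i l) m t).

(* connection matrices (acting on column vectors of components):
   Gam i t k l = Gamma^k_{il},  Cm c i t k l = (d_i . d_l)^k,
   Um E t k l = (E . d_l)^k *)
Definition Gam (g : pt -> 'M[C]_N) (i : 'I_N) t : 'M[C]_N := \matrix_(k, l) christoffel g t k i l.
Definition Cm (c : pt -> 'I_N -> 'I_N -> pt) (i : 'I_N) t : 'M[C]_N :=
  \matrix_(k, l) c t i l 0 k.
Definition Um (c : pt -> 'I_N -> 'I_N -> pt) (E : pt -> pt) t : 'M[C]_N :=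
  \matrix_(k, l) \sum_(i < N) E t 0 i * c t i l 0 k.

(* Hodge grading operator mu = nabla^LC E - (D/2) Id ;
   column l = components of mu(d_l) *)
Definition hodge (g : pt -> 'M[C]_N) (E : pt -> pt) (D : C) t : 'M[C]_N :=
  \matrix_(k, l) (pd (fun p => E p 0 k) l t
                  + \sum_(m < N) christoffel g t k l m * E t 0 m
                  - (D / 2%:R) * (k == l)%:R).

Definition mu_app (g : pt -> 'M[C]_N) (E : pt -> pt) (D : C) t (X : pt) : pt := X *m (hodge g E D t)^T.

(* the connection nabla = nabla^LC - z^-1 sum_i (d_i .) dt_i
                         + (z^-2 E. - z^-1 mu) dz  on M x C^* *)
Definition Ai (g : pt -> 'M[C]_N) (c : pt -> 'I_N -> 'I_N -> pt) (i : 'I_N) t (z : C) : 'M[C]_N := Gam g i t - z^-1 *: Cm c i t.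
Definition Az (g : pt -> 'M[C]_N) (c : pt -> 'I_N -> 'I_N -> pt) (E : pt -> pt) (D : C) t (z : C) : 'M[C]_N :=
  z^-2 *: Um c E t - z^-1 *: hodge g E D t.

Definition flat_at (g : pt -> 'M[C]_N) (c : pt -> 'I_N -> 'I_N -> pt) (E : pt -> pt) (D : C) t (z : C) : Prop :=
  (forall i j k l : 'I_N,
     pd (fun p => Ai g c j p z k l) i t - pd (fun p => Ai g c i p z k l) j t
     + (Ai g c i t z *m Ai g c j t z - Ai g c j t z *m Ai g c i t z) k l = 0)
  /\
  (forall i k l : 'I_N,
     pd (fun p => Az g c E D p z k l) i t - zder (fun w => Ai g c i t w k l) z
     + (Ai g c i t z *m Az g c E D t z - Az g c E D t z *m Ai g c i t z) k l = 0).

Definition frobenius (r : C) (g : pt -> 'M[C]_N)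
    (c : pt -> 'I_N -> 'I_N -> pt) (e E : pt -> pt) (D : C) : Prop :=
  0 < r /\
  forall t, ball (0 : ptN) r t ->
  (
   (forall i j, holo_at (fun p => g p i j) t) /\
   (forall i j k, holo_at (fun p => c p i j 0 k) t) /\
   (forall k, holo_at (fun p => e p 0 k) t) /\
   (forall k, holo_at (fun p => E p 0 k) t) /\
   ((g t)^T = g t /\ g t \in unitmx) /\
   (forall i j, c t i j = c t j i) /\ (forall X, prod c t (e t) X = X) /\
   (forall X Y1 Y2, bil (g t) (prod c t X Y1) Y2 = bil (g t) Y1 (prod c t X Y2)) /\
   (* (2) L_E g = D g *)
   (forall i j,
      \sum_(k < N) E t 0 k * pd (fun p => g p i j) k t
      + \sum_(k < N) g t k j * pd (fun p => E p 0 k) i t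
      + \sum_(k < N) g t i k * pd (fun p => E p 0 k) j t = D * g t i j) /\
   (forall i k, pd (fun p => e p 0 k) i t
                + \sum_(l < N) christoffel g t k i l * e t 0 l = 0) /\
   (forall z : C, z != 0 -> flat_at g c E D t z)).

Fixpoint apow (c : pt -> 'I_N -> 'I_N -> pt) (e : pt -> pt) (X : pt) (n : nat) : pt :=
  if n is n'.+1 then prod c 0 X (apow c e X n') else e 0.

Definition semisimple0 (c : pt -> 'I_N -> 'I_N -> pt) (e : pt -> pt) : Prop :=
  forall (X : pt) (n : nat), apow c e X n.+1 = 0 -> X = 0.

Definition euler_root_hyp (c : pt -> 'I_N -> 'I_N -> pt) (e : pt -> pt) (E : pt -> pt) : Prop :=
  exists (v : pt) (k : nat),
    [/\ (0 < k)%N, apow c e v k = E 0,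
        (exists w, prod c 0 v w = e 0) &
        (forall X : pt, exists (m : nat) (a : 'I_m -> C),
            X = \sum_(n < m) a n *: apow c e v n)].

(* hypothesis (2): a basis (rows of P) diagonalizing ._0, in which
   E_0 ._0 = Diag(u) and mu has matrix mubar ; mubar_{ij} = 0 if u_i = u_j *)
Definition mu_hyp (g : pt -> 'M[C]_N) (c : pt -> 'I_N -> 'I_N -> pt) (E : pt -> pt) (D : C) : Prop :=
  exists (P : 'M[C]_N) (u : 'I_N -> C),
    [/\ P \in unitmx,
        (forall (X : pt) (j : 'I_N), exists lam : C,
            prod c 0 X (row j P) = lam *: row j P),
        (forall j, prod c 0 (E 0) (row j P) = u j *: row j P) &
        (forall i j, u i = u j ->
           (P *m (hodge g E D 0)^T *m invmx P) j i = 0)].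

Definition flat_chart (r : C) (g : pt -> 'M[C]_N) (phi : pt -> pt) : Prop :=
  phi 0 = 0 /\ jac phi 0 \in unitmx /\
  exists (rho : C) (G0 : 'M[C]_N), 0 < rho /\ ball (0 : ptN) rho `<=` ball (0 : ptN) r /\
    forall p, ball (0 : ptN) rho p ->
      (forall a, holo_at (fun q => phi q 0 a) p) /\
      g p = jac phi p *m G0 *m (jac phi p)^T.

End Frobenius.

(* Main.v *)
Require Import Defs.
From HB Require Import structures.
From mathcomp Require Import all_boot all_order all_algebra.
From mathcomp Require Import complex.
From mathcomp Require Import all_classical all_reals all_analysis.
From mathcomp Require Import ring lra.
Import Order.TTheory GRing.Theory Num.Theory.
Import numFieldNormedType.Exports.
Import ComplexField.

(* Let J be the Jacobian of a flat chart.  Conjugating by J^T turns flatness of the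
   connection into a system for the matrices C_b(x) of multiplication by the b-th
   flat coordinate field and U(x) of multiplication by E:
     [C_b, C_c] = [C_b, U] = 0,   d_b U = C_b + [mu, C_b],   mu constant,
   with C_b (1,...,1) = (b-th basis vector) when the unit has coordinates (1,...,1).
   Take the flat coordinates whose axes at 0 are the idempotents of T_0 M, so that
   C_b(0) = E_bb and U(0) = diag u.  Two solutions with these initial values are
   compared along a line s w with pairwise distinct w_a.  Let delta be the first
   nonzero difference of the Taylor coefficients, of order n >= 1, of
   C_w = sum_b w_b C_b.  Order n of [C_w, U] = 0 gives [delta, U(0)] = 0, so
   delta_ab = 0 when u_a <> u_b; if u_a = u_b, the next order together with mu_ab = 0
   gives delta_ab (w_b - w_a) (1 - 1/(n+1)) = 0; the unit relation kills the diagonal.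
   By density of generic lines the structures coincide near 0 in these coordinates,
   and the isomorphism is the identity there. *)

Set Implicit Arguments.
Unset Strict Implicit.
Unset Printing Implicit Defensive.

Local Open Scope ring_scope.
Local Open Scope classical_set_scope.

(** * Complex modulus and integration along segments *)

Section Modulus.
Variable R : realType.
Local Notation C := R[i].
Local Notation cn := (@Normc.normc R).
Local Notation re := (@complex.Re R).
Local Notation im := (@complex.Im R).
Implicit Types z w : C.

(** [holo_at] says only that a function is complex differentiable, whereas the argument compares
    Taylor coefficients and differentiates Jacobians and Christoffel symbols; hence the passage from
    differentiability to power series, by Goursat and Cauchy on a square, precedes the geometry.
    U(0) may have repeated eigenvalues, and [C_w, U] = 0 at a given order leaves the blocks u_a =
    u_b undetermined. Lines with distinct w_a are used because C_w(0) = diag w then has simple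
    spectrum. The entries of a block are reached through the next order, where the difference of U
    is 1/(n+1) times delta + [mu, delta]; as delta is supported on the blocks and mu vanishes on
    them, [mu, delta] contributes nothing there. Comparison line by line yields a full ball because
    the radius of agreement does not depend on w. Conjugation by J^T works because its logarithmic
    derivative is the Christoffel matrix: the Levi-Civita connection becomes the plain derivative,
    and the powers of z in the curvature separate into the equations of the system. *)

Lemma normC_cn z : `|z| = (cn z)%:C%C.
Proof. by []. Qed.

Lemma cn_ge0 z : 0 <= cn z.
Proof. by case: z => a b; rewrite sqrtr_ge0. Qed.

Lemma cnD z w : cn (z + w) <= cn z + cn w.
Proof. exact: le_normcD. Qed.

Lemma cnM z w : cn (z * w) = cn z * cn w.
Proof. exact: Normc.normcM. Qed.

Lemma cnN z : cn (- z) = cn z.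
Proof. exact: normcN. Qed.

Lemma cn0 : cn 0 = 0.
Proof. exact: Normc.normc0. Qed.

Lemma cn1 : cn 1 = 1.
Proof. exact: Normc.normc1. Qed.

Lemma cnV z : cn z^-1 = (cn z)^-1.
Proof. exact: Normc.normcV. Qed.

Lemma cnX z n : cn (z ^+ n) = cn z ^+ n.
Proof. by elim: n => [|n IH]; rewrite ?expr0 ?cn1 // !exprS cnM IH. Qed.

Lemma cn_eq0 z : (cn z == 0) = (z == 0).
Proof. by apply/eqP/eqP => [/Normc.eq0_normc//|->]; rewrite cn0. Qed.

Lemma cn_gt0 z : (0 < cn z) = (z != 0).
Proof. by rewrite lt_neqAle cn_ge0 andbT eq_sym cn_eq0. Qed.

Lemma cnB z w : cn (z - w) <= cn z + cn w.
Proof. by rewrite -(cnN w) cnD. Qed.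

Lemma cnC z w : cn (z - w) = cn (w - z).
Proof. by rewrite -cnN opprB. Qed.

Lemma cn_sub z w : cn z - cn w <= cn (z - w).
Proof. by have := cnD (z - w) w; rewrite subrK => h; lra. Qed.

Lemma cn_R (x : R) : cn (x%:C%C) = `|x|.
Proof. by rewrite /= expr0n addr0 sqrtr_sqr. Qed.

Lemma cn_i : cn ('i)%C = 1.
Proof. by rewrite /= expr0n expr1n add0r sqrtr1. Qed.

Lemma ge_Re_cn z : `|re z| <= cn z.
Proof.
case: z => a b /=; rewrite -sqrtr_sqr ler_wsqrtr// lerDl sqr_ge0 //.
Qed.

Lemma ge_Im_cn z : `|im z| <= cn z.
Proof.
case: z => a b /=; rewrite -sqrtr_sqr ler_wsqrtr// lerDr sqr_ge0 //.
Qed.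

Lemma reZ (a : R) z : re (a%:C%C * z) = a * re z.
Proof. by case: z => x y; rewrite /= mul0r subr0. Qed.

Lemma imZ (a : R) z : im (a%:C%C * z) = a * im z.
Proof. by case: z => x y; rewrite /= mul0r addr0. Qed.

Lemma complexRI z : z = (re z)%:C%C + 'i%C * (im z)%:C%C.
Proof. by case: z => a b; simpc. Qed.

Lemma le_cn_ReIm z : cn z <= `|re z| + `|im z|.
Proof.
by rewrite {1}(complexRI z) (le_trans (cnD _ _))// cnM cn_i mul1r !cn_R.
Qed.

Lemma cn_sum (I : Type) (s : seq I) (P : pred I) (F : I -> C) :
  cn (\sum_(i <- s | P i) F i) <= \sum_(i <- s | P i) cn (F i).
Proof.
elim/big_ind2: _ => [|x a y b ha hb|//]; first by rewrite cn0.
by rewrite (le_trans (cnD _ _))// lerD.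
Qed.

Lemma cnZ (a : R) z : cn (a%:C%C * z) = `|a| * cn z.
Proof. by rewrite cnM cn_R. Qed.

Lemma ltC_cn (r : C) z : 0 < r -> (`|z| < r) = (cn z < re r).
Proof.
case: r => a b; rewrite ltcE /= => /andP[/eqP -> _].
by rewrite normC_cn ltcE /= eqxx.
Qed.

Lemma cn_small_eq0 z (K : R) : (forall e : R, 0 < e -> cn z <= K * e) -> z = 0.
Proof.
move=> h; apply/eqP; rewrite -cn_eq0 eq_le cn_ge0 andbT.
apply/ler_addgt0Pl => e e0; rewrite addr0.
have K0 : 0 < `|K| + 1 by have := normr_ge0 K; lra.
have := h _ (divr_gt0 e0 K0) => /le_trans; apply.
rewrite mulrA ler_pdivrMr// mulrC ler_pM2l//; have := ler_norm K; lra.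
Qed.

End Modulus.

Section RealCalculus.
Variable R : realType.
Local Notation C := R[i].
Local Notation cn := (@Normc.normc R).
Local Notation re := (@complex.Re R).
Local Notation im := (@complex.Im R).

Definition rderiv (g : R -> R) (x l : R) := forall e : R, 0 < e ->
  exists2 d, 0 < d & forall h, `|h| < d -> `|g (x + h) - g x - h * l| <= e * `|h|.

Lemma rderiv_is_derive g x l : rderiv g x l -> is_derive x 1 g l.
Proof.
move=> gl.
have : (h^-1 *: (g (h *: (1 : R) + x) - g x)) @[h --> (0 : R)^'] --> l.
  apply/cvgrPdist_le => /= e e0; have [d d0 hd] := gl _ e0.
  near=> h.
  have h0 : h != 0 by near: h; exact: nbhs_dnbhs_neq.
  have hl : `|h| < d by near: h; apply: dnbhs0_lt.
  have := hd _ hl.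
  have -> : g (h *: (1 : R) + x) = g (x + h) by rewrite [h *: _]mulr1 addrC.
  have -> : l - h^-1 *: (g (x + h) - g x) = - h^-1 * (g (x + h) - g x - h * l).
    by rewrite /GRing.scale /=; field.
  move=> H; rewrite normrM normrN normfV ler_pdivrMl ?normr_gt0//.
  by rewrite [leRHS]mulrC.
move=> cl; have dv : derivable g x 1 by exact: (cvgP _ cl).
by apply: DeriveDef dv _; exact: (cvg_lim _ cl).
Unshelve. all: by end_near.
Qed.

Definition crderiv (G : R -> C) (x : R) (l : C) := forall e : R, 0 < e ->
  exists2 d, 0 < d & forall h : R, `|h| < d ->
    cn (G (x + h) - G x - h%:C%C * l) <= e * `|h|.

Lemma crderivRe G x l : crderiv G x l -> rderiv (re \o G) x (re l).
Proof.
move=> H e /H [d d0 hd]; exists d => // h /hd; apply: le_trans.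
apply: le_trans (ge_Re_cn _).
by rewrite !raddfB/= reZ.
Qed.

Lemma crderivIm G x l : crderiv G x l -> rderiv (im \o G) x (im l).
Proof.
move=> H e /H [d d0 hd]; exists d => // h /hd; apply: le_trans.
apply: le_trans (ge_Im_cn _).
by rewrite !raddfB/= imZ.
Qed.

Lemma rderiv_MVT (g dg : R -> R) a b : a <= b ->
  (forall x, a <= x <= b -> rderiv g x (dg x)) ->
  exists2 c, a <= c <= b & g b - g a = dg c * (b - a).
Proof.
move=> ab H.
have H' x : a <= x <= b -> is_derive x 1 g (dg x).
  by move=> /H /rderiv_is_derive.
have [||c cab E] := @MVT_segment R g dg a b ab.
- move=> x; rewrite in_itv /= => /andP[xa xb]; apply: H'.
  by rewrite !ltW.
- apply: derivable_within_continuous => x; rewrite in_itv /= => /H' [] //.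
- by exists c => //; move: cab; rewrite in_itv.
Qed.

(** A complex curve has no mean value point, so the mean value theorem is applied to its real and
    imaginary parts separately; this costs the factor 2. *)
Lemma crderiv_le (G D : R -> C) (K a b : R) : a <= b ->
  (forall x, a <= x <= b -> crderiv G x (D x)) ->
  (forall x, a <= x <= b -> cn (D x) <= K) ->
  cn (G b - G a) <= 2 * K * (b - a).
Proof.
move=> ab H HK.
have [c1 c1ab E1] := rderiv_MVT ab (fun x hx => crderivRe (H x hx)).
have [c2 c2ab E2] := rderiv_MVT ab (fun x hx => crderivIm (H x hx)).
apply: le_trans (le_cn_ReIm _) _.
rewrite !raddfB/= /comp in E1 E2 *.
have -> : re (G b) - re (G a) = re (D c1) * (b - a) by [].
have -> : im (G b) - im (G a) = im (D c2) * (b - a) by [].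
rewrite !normrM (ger0_norm (_ : 0 <= b - a)) ?subr_ge0//.
rewrite -mulrDl ler_wpM2r ?subr_ge0//.
have := le_trans (ge_Re_cn (D c1)) (HK _ c1ab).
have := le_trans (ge_Im_cn (D c2)) (HK _ c2ab).
by move=> *; lra.
Qed.

End RealCalculus.

(** * Integration of continuous complex functions of a real variable *)

Section Integral.
Variable R : realType.
Local Notation C := R[i].
Local Notation cn := (@Normc.normc R).
Local Notation re := (@complex.Re R).
Local Notation im := (@complex.Im R).
Local Notation mu := (@lebesgue_measure R).

(* The base point -2 lies to the left of every segment that is integrated over. *)
Definition prim (f : R -> R) (x : R) : R := (\int[mu]_(t in `[(-2 : R), x]) f t)%R.

Lemma is_derive_rderiv (g : R -> R) (x l : R) : is_derive x 1 g l -> rderiv g x l.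
Proof.
move=> [dg gl].
have cl : (h^-1 *: (g (h *: (1 : R) + x) - g x)) @[h --> (0 : R)^'] --> l.
  by rewrite -gl; exact: dg.
move=> e e0; move/cvgrPdist_le: cl => /(_ _ e0) /= [d d0 hd].
exists d => // h hl.
have [->|h0] := eqVneq h 0.
  by rewrite addr0 subrr mul0r subr0 normr0 mulr0.
have := hd h; rewrite /ball_ /= sub0r normrN => /(_ hl h0).
have -> : g (h *: (1 : R) + x) = g (x + h) by rewrite [h *: _]mulr1 addrC.
have -> : l - h^-1 *: (g (x + h) - g x) = - h^-1 * (g (x + h) - g x - h * l).
  by rewrite /GRing.scale /=; field.
rewrite normrM normrN normfV ler_pdivrMl ?normr_gt0//.
by rewrite [leRHS]mulrC.
Qed.

Lemma prim_rderiv (f : R -> R) x : continuous f -> -2 < x -> rderiv (prim f) x (f x).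
Proof.
move=> cf x2; apply: is_derive_rderiv.
have x1 : x < x + 1 by lra.
have [|dp pE] := @continuous_FTC1_closed R f (-2) x (x + 1) x1 _ x2 (cf x).
- apply: continuous_compact_integrable; first exact: segment_compact.
  exact: continuous_subspaceT.
by apply: (DeriveDef dp); rewrite -derive1E.
Qed.

Definition ccont (F : R -> C) := forall x e, 0 < e -> exists2 d, 0 < d &
  forall y, `|y - x| < d -> cn (F y - F x) < e.

Lemma gt0_complexE (e : C) : 0 < e -> e = (re e)%:C%C /\ 0 < re e.
Proof. by case: e => a b; rewrite ltcE /= => /andP[/eqP -> ->]. Qed.

Lemma re_cont F : ccont F -> continuous (re \o F).
Proof.
move=> H x; apply/cvgrPdist_lt => /= e e0; have [d d0 hd] := H x _ e0.
near=> y.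
have /hd : `|y - x| < d.
  by rewrite distrC; near: y; exact: (nbhsx_ballx x d d0).
by move=> h; rewrite distrC -raddfB (le_lt_trans (ge_Re_cn _)).
Unshelve. all: by end_near.
Qed.

Lemma im_cont F : ccont F -> continuous (im \o F).
Proof.
move=> H x; apply/cvgrPdist_lt => /= e e0; have [d d0 hd] := H x _ e0.
near=> y.
have /hd : `|y - x| < d.
  by rewrite distrC; near: y; exact: (nbhsx_ballx x d d0).
by move=> h; rewrite distrC -raddfB (le_lt_trans (ge_Im_cn _)).
Unshelve. all: by end_near.
Qed.

Lemma ccont_cst c : ccont (fun=> c).
Proof. by move=> x e e0; exists 1 => // y _; rewrite subrr cn0. Qed.

Lemma ccontD F G : ccont F -> ccont G -> ccont (fun x => F x + G x).
Proof.
move=> cF cG x e e0; have e2 : 0 < e / 2 by lra.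
have [d1 d10 h1] := cF x _ e2; have [d2 d20 h2] := cG x _ e2.
exists (Num.min d1 d2); first by rewrite lt_min d10.
move=> y; rewrite lt_min => /andP[/h1 a /h2 b].
rewrite opprD addrACA (le_lt_trans (cnD _ _))//; lra.
Qed.

Lemma ccontM F G : ccont F -> ccont G -> ccont (fun x => F x * G x).
Proof.
move=> cF cG x e e0.
set A := cn (F x) + 1; set B := cn (G x) + 1.
have A0 : 0 < A by have := cn_ge0 (F x); rewrite /A; lra.
have B0 : 0 < B by have := cn_ge0 (G x); rewrite /B; lra.
have e1 : 0 < e / (2 * B) by rewrite divr_gt0// mulr_gt0.
have e2 : 0 < e / (2 * A) by rewrite divr_gt0// mulr_gt0.
have [d1 d10 h1] := cF x _ e1; have [d2 d20 h2] := cG x _ e2.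
have [d3 d30 h3] := cG x _ ltr01.
exists (Num.min d1 (Num.min d2 d3)); first by rewrite !lt_min d10 d20.
move=> y; rewrite !lt_min => /and3P[/h1 a /h2 b /h3 c].
have -> : F y * G y - F x * G x = (F y - F x) * G y + F x * (G y - G x) by ring.
have cG' : cn (G y) <= B.
  by have := cnD (G y - G x) (G x); rewrite subrK /B; lra.
rewrite (le_lt_trans (cnD _ _))// !cnM.
have -> : e = e / (2 * B) * B + A * (e / (2 * A)) by field; rewrite !gt_eqF.
apply: ltr_leD; last first.
  apply: ler_pM; rewrite ?cn_ge0 ?ltW// /A; lra.
apply: le_lt_trans (_ : cn (F y - F x) * B < _).
  by rewrite ler_wpM2l ?cn_ge0.
by rewrite ltr_pM2r.
Qed.

Lemma ccontZ c F : ccont F -> ccont (fun x => c * F x).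
Proof. by move=> cF; apply: ccontM => //; apply: ccont_cst. Qed.

Lemma ccontX F n : ccont F -> ccont (fun x => F x ^+ n).
Proof.
move=> cF; elim: n => [|n IH]; first exact: ccont_cst.
have -> : (fun x => F x ^+ n.+1) = (fun x => F x * F x ^+ n).
  by apply/funext => x; rewrite exprS.
exact: ccontM.
Qed.

Lemma ccontV F : ccont F -> (forall x, F x != 0) -> ccont (fun x => (F x)^-1).
Proof.
move=> cF F0 x e e0.
set A := cn (F x); have A0 : 0 < A by rewrite cn_gt0.
have e1 : 0 < e * A * A / 2 by rewrite divr_gt0// !mulr_gt0.
have e2 : 0 < A / 2 by lra.
have [d1 d10 h1] := cF x _ e1; have [d2 d20 h2] := cF x _ e2.
exists (Num.min d1 d2); first by rewrite lt_min d10.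
move=> y; rewrite lt_min => /andP[/h1 a /h2 b].
have Ay : A / 2 < cn (F y).
  by have := cn_sub (F x) (F y); rewrite cnC in b; rewrite -/A; lra.
have -> : (F y)^-1 - (F x)^-1 = - (F y - F x) / (F x * F y).
  by field; rewrite !F0.
rewrite cnM cnN cnV cnM ltr_pdivrMr ?mulr_gt0 ?cn_gt0// -/A.
apply: (lt_le_trans a); rewrite -!mulrA ler_pM2l// ler_pM2l//; lra.
Qed.

(** A difference of primitives instead of an integral over the segment: additivity in the end points
    becomes pure algebra, whatever their order. *)
Definition intC (F : R -> C) (a b : R) : C :=
  Complex (prim (re \o F) b - prim (re \o F) a)
          (prim (im \o F) b - prim (im \o F) a).

Lemma intC_chasles F a b c : intC F a b + intC F b c = intC F a c.
Proof. by rewrite /intC; simpc; congr Complex; ring. Qed.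

Lemma prim_mv f a b : continuous f -> -1 <= a -> a <= b ->
  exists2 c, a <= c <= b & prim f b - prim f a = f c * (b - a).
Proof.
move=> cf a1 ab; apply: rderiv_MVT => // x /andP[ax _].
by apply: prim_rderiv => //; lra.
Qed.

Lemma intC_le F a b K : ccont F -> -1 <= a -> a <= b ->
  (forall x, a <= x <= b -> cn (F x) <= K) -> cn (intC F a b) <= 2 * K * (b - a).
Proof.
move=> cF a1 ab HK.
have [c1 h1 E1] := prim_mv (re_cont cF) a1 ab.
have [c2 h2 E2] := prim_mv (im_cont cF) a1 ab.
apply: le_trans (le_cn_ReIm _) _; rewrite [re _]E1 [im _]E2 /=.
rewrite !normrM (ger0_norm (_ : 0 <= b - a)) ?subr_ge0//.
rewrite -mulrDl ler_wpM2r ?subr_ge0//.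
have := le_trans (ge_Re_cn _) (HK _ h1).
have := le_trans (ge_Im_cn _) (HK _ h2).
by move=> *; lra.
Qed.

Lemma rderiv_prim_eq f g a b : continuous f -> -1 <= a -> a <= b ->
  (forall x, a <= x <= b -> rderiv g x (f x)) ->
  prim f b - prim f a = g b - g a.
Proof.
move=> cf a1 ab H.
have [] := @rderiv_MVT R (fun x => prim f x - g x) (fun=> 0) a b ab.
  move=> x hx e e0; have /andP[ax xb] := hx; have e2 : 0 < e / 2 by lra.
  have x2 : -2 < x by lra.
  have [d1 d10 h1] := prim_rderiv cf x2 e2; have [d2 d20 h2] := H x hx _ e2.
  exists (Num.min d1 d2); first by rewrite lt_min d10.
  move=> h; rewrite lt_min => /andP[/h1 A /h2 B].
  have -> : prim f (x + h) - g (x + h) - (prim f x - g x) - h * 0 =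
    (prim f (x + h) - prim f x - h * f x) - (g (x + h) - g x - h * f x) by ring.
  by rewrite (le_trans (ler_normB _ _))//; lra.
by move=> c _; rewrite mul0r => E; lra.
Qed.

Lemma intC_FTC F G a b : ccont F -> -1 <= a -> a <= b ->
  (forall x, a <= x <= b -> crderiv G x (F x)) -> intC F a b = G b - G a.
Proof.
move=> cF a1 ab H.
rewrite /intC (rderiv_prim_eq (re_cont cF) a1 ab (g := re \o G)); last first.
  by move=> x /H /crderivRe.
rewrite (rderiv_prim_eq (im_cont cF) a1 ab (g := im \o G)); last first.
  by move=> x /H /crderivIm.
by rewrite /=; case: (G b) (G a) => ? ? [? ?]; simpc.
Qed.

Lemma intC_crderiv F x : ccont F -> -2 < x -> crderiv (intC F 0) x (F x).
Proof.
move=> cF x2 e e0; have e2 : 0 < e / 2 by lra.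
have [d1 d10 h1] := prim_rderiv (re_cont cF) x2 e2.
have [d2 d20 h2] := prim_rderiv (im_cont cF) x2 e2.
exists (Num.min d1 d2); first by rewrite lt_min d10.
move=> h; rewrite lt_min => /andP[/h1 A /h2 B].
move: A B; rewrite /intC.
set P := prim (re \o F); set Q := prim (im \o F) => A B.
have -> : Complex (P (x + h) - P 0) (Q (x + h) - Q 0) - Complex (P x - P 0) (Q x - Q 0)
    - h%:C%C * F x =
  Complex (P (x + h) - P x - h * re (F x)) (Q (x + h) - Q x - h * im (F x)).
  by case: (F x) => u v; simpc; rewrite /=; congr Complex; ring.
by apply: le_trans (le_cn_ReIm _) _; rewrite /= in A B *; lra.
Qed.

Lemma crderivD (F G : R -> C) x l m : crderiv F x l -> crderiv G x m ->
  crderiv (fun x => F x + G x) x (l + m).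
Proof.
move=> cF cG e e0; have e2 : 0 < e / 2 by lra.
have [d1 d10 h1] := cF _ e2; have [d2 d20 h2] := cG _ e2.
exists (Num.min d1 d2); first by rewrite lt_min d10.
move=> h; rewrite lt_min => /andP[/h1 a /h2 b].
have -> : F (x + h) + G (x + h) - (F x + G x) - h%:C%C * (l + m) =
  (F (x + h) - F x - h%:C%C * l) + (G (x + h) - G x - h%:C%C * m) by ring.
by rewrite (le_trans (cnD _ _))//; lra.
Qed.

Lemma crderivZ c (F : R -> C) x l : crderiv F x l -> crderiv (fun x => c * F x) x (c * l).
Proof.
move=> cF e e0; have k0 : 0 < cn c + 1 by have := cn_ge0 c; lra.
have [d d0 h] := cF _ (divr_gt0 e0 k0); exists d => // y /h H.
have -> : c * F (x + y) - c * F x - y%:C%C * (c * l) =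
  c * (F (x + y) - F x - y%:C%C * l) by ring.
rewrite cnM; apply: le_trans (_ : (cn c + 1) * (e / (cn c + 1) * `|y|) <= _).
  by apply: ler_pM => //; rewrite ?cn_ge0//; lra.
by rewrite mulrA mulrCA mulfV ?gt_eqF// mulr1.
Qed.

(** The sum of two primitives is a primitive of the sum, so additivity follows from [intC_FTC]. *)
Lemma intCD F G a b : ccont F -> ccont G -> -1 <= a -> a <= b ->
  intC (fun x => F x + G x) a b = intC F a b + intC G a b.
Proof.
move=> cF cG a1 ab.
rewrite (@intC_FTC _ (fun x => intC F 0 x + intC G 0 x)) => //; last first.
- by move=> x /andP[ax xb]; apply: crderivD; apply: intC_crderiv => //; lra.
- exact: ccontD.
by rewrite -(intC_chasles F 0 a b) -(intC_chasles G 0 a b); ring.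
Qed.

Lemma intCZ c F a b : ccont F -> -1 <= a -> a <= b ->
  intC (fun x => c * F x) a b = c * intC F a b.
Proof.
move=> cF a1 ab.
rewrite (@intC_FTC _ (fun x => c * intC F 0 x)) => //; last first.
- by move=> x /andP[ax xb]; apply: crderivZ; apply: intC_crderiv => //; lra.
- exact: ccontZ.
by rewrite -(intC_chasles F 0 a b); ring.
Qed.

End Integral.

(** * Goursat's theorem and Taylor expansion in one variable *)

Section Goursat.
Variable R : realType.
Local Notation C := R[i].
Local Notation cn := (@Normc.normc R).
Local Notation re := (@complex.Re R).
Local Notation im := (@complex.Im R).
Implicit Types (f g : C -> C) (z w : C).

(* [cd f z l] says f'(z) = l, and [gcat f z] that f is continuous at z, in terms of the
   real-valued modulus. *)
Definition cd f z (l : C) := forall e, 0 < e -> exists2 d, 0 < d &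
  forall h, cn h < d -> cn (f (z + h) - f z - h * l) <= e * cn h.

Definition gcat f z := forall e, 0 < e -> exists2 d, 0 < d &
  forall w, cn (w - z) < d -> cn (f w - f z) < e.

Lemma cdP f z l : cd f z l <-> is_derive (z : C^o) 1 (f : C^o -> C^o) l.
Proof.
pose F : C^o -> C^o := f; pose Z : C^o := z; pose l' : C^o := l.
have E (h : C) : h != 0 -> l' - h^-1 *: (F (h *: (1 : C^o) + Z) - F Z) =
    (- h^-1 : C) * (f (z + h) - f z - h * l) :> C.
  move=> h0; rewrite [h *: (1 : C^o)]mulr1 (addrC h) /F /Z /l' /GRing.scale /=.
  by field.
split=> [fl|[dg gl]].
  have cl : (h^-1 *: (F (h *: (1 : C^o) + Z) - F Z)) @[h --> (0 : C^o)^'] --> l'.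
    apply/(@cvgrPdist_le C C^o) => /= e /gt0_complexE [-> e0].
    have [d d0 hd] := fl _ e0.
    exists (d%:C%C); first by rewrite /= ltcR.
    move=> h; rewrite /ball_ /= sub0r normrN normC_cn ltcR => hl h0.
    rewrite E// [ `|_| ](@normrM C) (@normrN C C) (@normfV C) ler_pdivrMl ?(@normr_gt0 C C)//.
    by rewrite [leRHS]mulrC !normC_cn -rmorphM lecR; exact: hd.
  have dv : derivable F Z 1 by exact: (cvgP _ cl).
  by apply: DeriveDef dv _; exact: (cvg_lim _ cl).
have cl : (h^-1 *: (F (h *: (1 : C^o) + Z) - F Z)) @[h --> (0 : C^o)^'] --> l'.
  by rewrite /l' -gl; exact: dg.
move=> e e0; have eC : 0 < e%:C%C :> C by rewrite ltcR.
move/(@cvgrPdist_le C C^o): cl => /(_ _ eC) /= [d /gt0_complexE [-> d0] hd].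
exists (re d) => // h hl.
have [->|h0] := eqVneq h 0.
  by rewrite addr0 subrr mul0r subr0 cn0 mulr0.
have := hd h; rewrite /ball_ /= sub0r normrN normC_cn ltcR => /(_ hl h0).
rewrite E// [ `|_| ](@normrM C) (@normrN C C) (@normfV C) ler_pdivrMl ?(@normr_gt0 C C)//.
by rewrite [X in _ <= X -> _]mulrC !normC_cn -rmorphM lecR.
Qed.

Lemma gcatP f z : gcat f z <-> {for (z : C^o), continuous (f : C^o -> C^o)}.
Proof.
split=> [H | H e e0].
  apply/(@cvgrPdist_lt C C^o _ _ (nbhs_filter (z : C^o))) => /= e /gt0_complexE [-> /H [d d0 hd]].
  exists (d%:C%C); first by rewrite /= ltcR.
  move=> w; rewrite /ball_ /= distrC normC_cn ltcR => /hd.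
  by rewrite distrC normC_cn ltcR.
have eC : 0 < e%:C%C :> C by rewrite ltcR.
move/(@cvgrPdist_lt C C^o _ _ (nbhs_filter (z : C^o))): H => /(_ _ eC) /(@nbhs_ballP C C^o) /= [d /gt0_complexE [-> d0] hd].
exists (re d) => // w wz; have := hd w; rewrite /ball /= distrC normC_cn ltcR.
by rewrite distrC normC_cn ltcR; exact.
Qed.

Lemma cd_gcat f z l : cd f z l -> gcat f z.
Proof.
move=> /cdP [/derivable1_diffP df _]; apply/gcatP.
exact: differentiable_continuous df.
Qed.

Lemma cd_near f g z l d : 0 < d -> (forall w, cn (w - z) < d -> f w = g w) ->
  cd f z l -> cd g z l.
Proof.
move=> d0 fg H e /H [d' d'0 hd]; exists (Num.min d d'); first by rewrite lt_min d0.
move=> h; rewrite lt_min => /andP[h1 /hd].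
by rewrite !fg// ?subrr ?cn0// (addrC z) addrK.
Qed.

Lemma cdD f g z l m : cd f z l -> cd g z m -> cd (fun z => f z + g z) z (l + m).
Proof. by move=> /cdP h1 /cdP h2; apply/cdP; exact: is_deriveD. Qed.

Lemma cdM f g z l m : cd f z l -> cd g z m ->
  cd (fun z => f z * g z) z (l * g z + f z * m).
Proof.
move=> /cdP h1 /cdP h2; apply/cdP.
refine (is_derive_eq (@is_deriveM C C^o f g z 1 l m h1 h2) _).
by rewrite /GRing.scale /= addrC; congr (_ + _); rewrite mulrC.
Qed.

Lemma cd_cst c z : cd (fun=> c) z 0.
Proof. by move=> e e0; exists 1 => // h _; rewrite mulr0 !subrr cn0 mulr_ge0// ?cn_ge0 ?ltW. Qed.

Lemma cd_id z : cd id z 1.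
Proof. by move=> e e0; exists 1 => // h _; rewrite mulr1 /= (addrC z) addrK subrr cn0 mulr_ge0// ?cn_ge0 ?ltW. Qed.

Lemma cdV f z l : f z != 0 -> cd f z l -> cd (fun z => (f z)^-1) z (- l / (f z) ^+ 2).
Proof.
move=> f0 /cdP h1; apply/cdP; 
have H := @deriveV C C^o f z 1 f0 (@ex_derive _ _ _ _ _ _ _ h1).
have H' := @derivableV C C^o f z 1 f0 (@ex_derive _ _ _ _ _ _ _ h1).
apply: (DeriveDef H'); rewrite H (@derive_val _ _ _ _ _ _ _ h1).
by rewrite /GRing.scale /= mulNr mulrC mulNr.
Qed.

Lemma cdX f z l n : cd f z l -> cd (fun z => f z ^+ n.+1) z (n.+1%:R * f z ^+ n * l).
Proof.
move=> fl; elim: n => [|n IH].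
  have -> : (fun z => f z ^+ 1) = f by [].
  by rewrite expr0 !mul1r.
have -> : (fun z => f z ^+ n.+2) = (fun z => f z * f z ^+ n.+1).
  by apply/funext => x; rewrite exprS.
have -> : n.+2%:R * f z ^+ n.+1 * l =
  l * f z ^+ n.+1 + f z * (n.+1%:R * f z ^+ n * l).
  by rewrite -(addn1 n.+1) natrD (exprS _ n); ring.
exact: cdM.
Qed.

Lemma cdZ c f z l : cd f z l -> cd (fun z => c * f z) z (c * l).
Proof.
move=> fl; have := cdM (cd_cst c z) fl; by rewrite mul0r add0r.
Qed.

Lemma cd_line f z0 v (t : R) l : cd f (z0 + t%:C%C * v) l ->
  crderiv (fun t : R => f (z0 + t%:C%C * v)) t (v * l).
Proof.
move=> H e e0.
have k0 : 0 < cn v + 1 by have := cn_ge0 v; lra.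
have [d d0 hd] := H _ (divr_gt0 e0 k0).
exists (d / (cn v + 1)); first by rewrite divr_gt0.
move=> h; rewrite ltr_pdivlMr// => hl.
have hv : cn (h%:C%C * v) <= `|h| * (cn v + 1).
  by rewrite cnZ ler_wpM2l//; lra.
have := hd _ (le_lt_trans hv hl).
rewrite (_ : z0 + (t + h)%:C%C * v = z0 + t%:C%C * v + h%:C%C * v); last first.
  by rewrite rmorphD mulrDl addrA.
rewrite mulrA => /le_trans; apply.
apply: le_trans (_ : e / (cn v + 1) * (`|h| * (cn v + 1)) <= _).
  by rewrite ler_wpM2l// divr_ge0// ltW.
by rewrite mulrCA divfK ?gt_eqF// mulrC.
Qed.

(* Restrictions of f to the horizontal line of height y and the vertical line of abscissa x. *)
Definition hl f (y t : R) := f (Complex t y).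
Definition vl f (x t : R) := f (Complex x t).

Lemma cd_hl f x y l : cd f (Complex x y) l -> crderiv (hl f y) x l.
Proof.
have E t : Complex t y = Complex 0 y + t%:C%C * 1 by rewrite mulr1; simpc.
rewrite E => /cd_line; rewrite mul1r.
suff -> : (fun t : R => f (Complex 0 y + t%:C%C * 1)) = hl f y by [].
by apply/funext => t; rewrite /hl -E.
Qed.

Lemma cd_vl f x y l : cd f (Complex x y) l -> crderiv (vl f x) y ('i%C * l).
Proof.
have E t : Complex x t = Complex x 0 + t%:C%C * 'i%C by simpc.
rewrite E => /cd_line.
suff -> : (fun t : R => f (Complex x 0 + t%:C%C * 'i%C)) = vl f x by [].
by apply/funext => t; rewrite /vl -E.
Qed.

(* The integral of f along the counterclockwise boundary of [x1,x2] x [y1,y2]. *)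
Definition rint f (x1 x2 y1 y2 : R) : C :=
  intC (hl f y1) x1 x2 - intC (hl f y2) x1 x2 +
  'i%C * (intC (vl f x2) y1 y2 - intC (vl f x1) y1 y2).

Definition lc f (x1 x2 y1 y2 : R) :=
  [/\ ccont (hl f y1), ccont (hl f y2), ccont (vl f x1) & ccont (vl f x2)].

Definition bdry (x1 x2 y1 y2 : R) z :=
  [/\ x1 <= re z <= x2, y1 <= im z <= y2 &
      [\/ re z = x1, re z = x2, im z = y1 | im z = y2]].

Definition rect (x1 x2 y1 y2 : R) z := x1 <= re z <= x2 /\ y1 <= im z <= y2.

Lemma gc_hl f y : (forall z, gcat f z) -> ccont (hl f y).
Proof.
move=> H x e /(H (Complex x y)) [d d0 hd]; exists d => // t ht.
apply: hd; have -> : Complex t y - Complex x y = (t - x)%:C%C.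
  by apply/eqP; rewrite eq_complex /= subrr !eqxx.
by rewrite cn_R.
Qed.

Lemma gc_vl f x : (forall z, gcat f z) -> ccont (vl f x).
Proof.
move=> H y e /(H (Complex x y)) [d d0 hd]; exists d => // t ht.
apply: hd; have -> : Complex x t - Complex x y = 'i%C * (t - y)%:C%C.
  by apply/eqP; rewrite eq_complex /= ; apply/andP; split; apply/eqP; ring.
by rewrite cnM cn_i cn_R mul1r.
Qed.

Lemma gc_lc f x1 x2 y1 y2 : (forall z, gcat f z) -> lc f x1 x2 y1 y2.
Proof. by move=> H; split; [exact: gc_hl|exact: gc_hl|exact: gc_vl|exact: gc_vl]. Qed.

Lemma rint_xsplit f x x1 x2 y1 y2 :
  rint f x1 x2 y1 y2 = rint f x1 x y1 y2 + rint f x x2 y1 y2.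
Proof.
by rewrite /rint -!(intC_chasles (hl f _) x1 x x2); ring.
Qed.

Lemma rint_ysplit f y x1 x2 y1 y2 :
  rint f x1 x2 y1 y2 = rint f x1 x2 y1 y + rint f x1 x2 y y2.
Proof.
by rewrite /rint -!(intC_chasles (vl f _) y1 y y2); ring.
Qed.

Lemma rint_le f x1 x2 y1 y2 K : lc f x1 x2 y1 y2 ->
  -1 <= x1 <= x2 -> -1 <= y1 <= y2 ->
  (forall z, bdry x1 x2 y1 y2 z -> cn (f z) <= K) ->
  cn (rint f x1 x2 y1 y2) <= 4 * K * ((x2 - x1) + (y2 - y1)).
Proof.
move=> [c1 c2 c3 c4] /andP[x1g x12] /andP[y1g y12] HK.
have l1 : cn (intC (hl f y1) x1 x2) <= 2 * K * (x2 - x1).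
  apply: intC_le => // t tx; apply: HK; split => //=; first by rewrite lexx.
  by apply: Or43.
have l2 : cn (intC (hl f y2) x1 x2) <= 2 * K * (x2 - x1).
  apply: intC_le => // t tx; apply: HK; split => //=; first by rewrite lexx andbT.
  by apply: Or44.
have l3 : cn (intC (vl f x1) y1 y2) <= 2 * K * (y2 - y1).
  apply: intC_le => // t tx; apply: HK; split => //=; first by rewrite lexx.
  by apply: Or41.
have l4 : cn (intC (vl f x2) y1 y2) <= 2 * K * (y2 - y1).
  apply: intC_le => // t tx; apply: HK; split => //=; first by rewrite lexx andbT.
  by apply: Or42.
apply: le_trans (cnD _ _) _; rewrite cnM cn_i mul1r.
apply: le_trans (lerD (cnB _ _) (cnB _ _)) _; lra.
Qed.

Lemma rintD f g x1 x2 y1 y2 : lc f x1 x2 y1 y2 -> lc g x1 x2 y1 y2 ->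
  -1 <= x1 <= x2 -> -1 <= y1 <= y2 ->
  rint (fun z => f z + g z) x1 x2 y1 y2 = rint f x1 x2 y1 y2 + rint g x1 x2 y1 y2.
Proof.
move=> [? ? ? ?] [? ? ? ?] /andP[? ?] /andP[? ?].
rewrite /rint.
rewrite (_ : hl _ y1 = fun t => hl f y1 t + hl g y1 t)// intCD//.
rewrite (_ : hl _ y2 = fun t => hl f y2 t + hl g y2 t)// intCD//.
rewrite (_ : vl _ x1 = fun t => vl f x1 t + vl g x1 t)// intCD//.
rewrite (_ : vl _ x2 = fun t => vl f x2 t + vl g x2 t)// intCD//.
by ring.
Qed.

Lemma rintZ c f x1 x2 y1 y2 : lc f x1 x2 y1 y2 ->
  -1 <= x1 <= x2 -> -1 <= y1 <= y2 ->
  rint (fun z => c * f z) x1 x2 y1 y2 = c * rint f x1 x2 y1 y2.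
Proof.
move=> [? ? ? ?] /andP[? ?] /andP[? ?].
rewrite /rint.
rewrite (_ : hl _ y1 = fun t => c * hl f y1 t)// intCZ//.
rewrite (_ : hl _ y2 = fun t => c * hl f y2 t)// intCZ//.
rewrite (_ : vl _ x1 = fun t => c * vl f x1 t)// intCZ//.
rewrite (_ : vl _ x2 = fun t => c * vl f x2 t)// intCZ//.
by ring.
Qed.

(** The boundary is a closed path and the values of [G] at the corners cancel. Asking for a
    primitive on the boundary only covers z^-k with k >= 2, whose primitive is singular inside. *)
Lemma rint_prim f (G : C -> C) x1 x2 y1 y2 : lc f x1 x2 y1 y2 ->
  -1 <= x1 <= x2 -> -1 <= y1 <= y2 ->
  (forall z, bdry x1 x2 y1 y2 z -> cd G z (f z)) ->
  rint f x1 x2 y1 y2 = 0.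
Proof.
move=> [c1 c2 c3 c4] /andP[x1g x12] /andP[y1g y12] H.
rewrite /rint (@intC_FTC _ _ (hl G y1))//; last first.
  move=> t tx; apply/cd_hl/H; split => //=; first by rewrite lexx.
  by apply: Or43.
rewrite (@intC_FTC _ _ (hl G y2))//; last first.
  move=> t tx; apply/cd_hl/H; split => //=; first by rewrite lexx andbT.
  by apply: Or44.
rewrite mulrBr -!intCZ// (@intC_FTC _ _ (vl G x2))//; last first.
- move=> t tx; apply/cd_vl/H; split => //=; first by rewrite lexx andbT.
  by apply: Or42.
- exact: ccontZ.
rewrite (@intC_FTC _ _ (vl G x1))//; last first.
- move=> t tx; apply/cd_vl/H; split => //=; first by rewrite lexx.
  by apply: Or41.
- exact: ccontZ.
by rewrite /hl /vl; ring.
Qed.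

(** Nested intervals: [u n] is the left end and [l / 2 ^+ n] the length of the n-th one, and the
    supremum of the left ends lies in all of them. *)
Lemma geometric_limit (u : nat -> R) (l : R) :
  (forall n, u n <= u n.+1 <= u n + l / 2 ^+ n.+1) ->
  exists a, forall n, u n <= a <= u n + l / 2 ^+ n.
Proof.
move=> H.
have H2 n : u n.+1 + l / 2 ^+ n.+1 <= u n + l / 2 ^+ n.
  have /andP[_ h] := H n; have : l / 2 ^+ n = l / 2 ^+ n.+1 + l / 2 ^+ n.+1.
    by rewrite exprS; field; rewrite expf_neq0.
  by move=> ->; lra.
have l0 : 0 <= l.
  by have /andP[h1 h2] := H 0%N; rewrite expr1 in h2; lra.
have mono m n : (m <= n)%N -> u m <= u n.
  move=> /subnK <-; elim: (n - m)%N => [|k IH] //.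
  by rewrite addSn (le_trans IH)//; have /andP[] := H (k + m)%N.
have mono2 m n : (m <= n)%N -> u n + l / 2 ^+ n <= u m + l / 2 ^+ m.
  move=> /subnK <-; elim: (n - m)%N => [|k IH] //.
  by rewrite addSn (le_trans (H2 _)).
have B m n : u m <= u n + l / 2 ^+ n.
  have p k : 0 <= l / 2 ^+ k by rewrite divr_ge0// exprn_ge0.
  have [mn|/ltnW nm] := leqP m n.
    by have := mono _ _ mn; have := p n; lra.
  by have := mono2 _ _ nm; have := p m; lra.
have hs : has_sup (range u).
  by split; [exists (u 0%N); exists 0%N|exists (u 0%N + l / 2 ^+ 0) => _ [m _ <-]].
exists (sup (range u)) => n; apply/andP; split.
  by apply: sup_upper_bound => //; exists n.
by apply: sup_le_ub; [exists (u 0%N); exists 0%N|move=> _ [m _ <-]].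
Qed.

Lemma half_small (K d : R) : 0 < d -> exists n, K / 2 ^+ n < d.
Proof.
move=> d0; have [n hn] : exists n : nat, `|K| / d < n%:R.
  by exists (Num.bound (`|K| / d)); apply: archi_boundP; rewrite divr_ge0// ltW.
exists n; rewrite ltr_pdivrMr ?exprn_gt0//.
rewrite ltr_pdivrMr// in hn.
apply: le_lt_trans (ler_norm K) _; apply: lt_le_trans hn _.
rewrite mulrC ler_pM2l// -natrX ler_nat.
exact/ltnW/ltn_expl.
Qed.

Lemma cn_complex_le (a b : R) : cn (Complex a b) <= `|a| + `|b|.
Proof. exact: le_cn_ReIm. Qed.

(** Bisection. If the integral exceeds e times the square of width plus height, the same holds for
    one of the four quarters, since four such bounds at half the scale add up to the bound. The
    nested bad quarters shrink to a point, where differentiability contradicts the excess. *)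
Lemma goursat f x1 x2 y1 y2 : (forall z, gcat f z) ->
  -1 <= x1 <= x2 -> -1 <= y1 <= y2 ->
  (forall z, rect x1 x2 y1 y2 z -> exists l, cd f z l) ->
  rint f x1 x2 y1 y2 = 0.
Proof.
move=> gf /andP[x1g x12] /andP[y1g y12] H.
pose l := x2 - x1; pose m := y2 - y1.
apply: (@cn_small_eq0 R _ ((l + m) ^+ 2)) => e e0; rewrite mulrC.
apply/negPn/negP => bad0.
(* [s] is the lower left corner of a rectangle of generation n, inside the given one, whose integral
   exceeds the bound at its scale. *)
pose Bad n (s : R * R) := [/\ x1 <= s.1 & s.1 + l / 2 ^+ n <= x2] /\
  [/\ y1 <= s.2, s.2 + m / 2 ^+ n <= y2 &
  ~~ (cn (rint f s.1 (s.1 + l / 2 ^+ n) s.2 (s.2 + m / 2 ^+ n)) <=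
     e * ((l + m) / 2 ^+ n) ^+ 2)].
have l0 : 0 <= l by rewrite subr_ge0.
have m0 : 0 <= m by rewrite subr_ge0.
have p k (t : R) : 0 <= t -> 0 <= t / 2 ^+ k by move=> t0; rewrite divr_ge0// exprn_ge0.
have half (t : R) n : t / 2 ^+ n = t / 2 ^+ n.+1 + t / 2 ^+ n.+1.
  by rewrite exprS; field; rewrite expf_neq0.
(* The badness is a premise under the quantifier on [s'], so that [choice] yields a total function
   to iterate. *)
have step n s : exists s', Bad n s -> Bad n.+1 s' /\
    [/\ s.1 <= s'.1 <= s.1 + l / 2 ^+ n.+1 & s.2 <= s'.2 <= s.2 + m / 2 ^+ n.+1].
  have [[[a1 a2] [b1 b2]]|nb] := pselect (Bad n s); last by exists s.
  pose q := l / 2 ^+ n.+1; pose v := m / 2 ^+ n.+1.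
  have q0 : 0 <= q := p n.+1 _ l0; have v0 : 0 <= v := p n.+1 _ m0.
  pose X := s.1 + q; pose Y := s.2 + v.
  have EX : s.1 + l / 2 ^+ n = X + q by rewrite /X half /q addrA.
  have EY : s.2 + m / 2 ^+ n = Y + v by rewrite /Y half /v addrA.
  rewrite EX in a2; rewrite EY in b2.
  have [F1 F2 F3] : [/\ x1 <= X, X <= x2 & s.1 <= X].
    by rewrite /X in a2 *; clear -a1 a2 q0; split; lra.
  have [G1 G2 G3] : [/\ y1 <= Y, Y <= y2 & s.2 <= Y].
    by rewrite /Y in b2 *; clear -b1 b2 v0; split; lra.
  move=> bad.
  have [bb|g1] := boolP (~~ (cn (rint f s.1 X s.2 Y) <= e * ((l + m) / 2 ^+ n.+1) ^+ 2)).
    by exists s => _; split; [split; split|rewrite !lexx /= F3 G3; split].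
  have [bb|g2] := boolP (~~ (cn (rint f X (X + q) s.2 Y)
       <= e * ((l + m) / 2 ^+ n.+1) ^+ 2)).
    by exists (X, s.2) => _; split; [split; split|rewrite /= !lexx F3 G3; split].
  have [bb|g3] := boolP (~~ (cn (rint f s.1 X Y (Y + v))
       <= e * ((l + m) / 2 ^+ n.+1) ^+ 2)).
    by exists (s.1, Y) => _; split; [split; split|rewrite /= !lexx F3 G3; split].
  have [bb|g4] := boolP (~~ (cn (rint f X (X + q) Y (Y + v))
       <= e * ((l + m) / 2 ^+ n.+1) ^+ 2)).
    by exists (X, Y) => _; split; [split; split|rewrite /= !lexx F3 G3; split].
  exfalso; move/negP: bad; apply.
  rewrite EX EY (rint_xsplit f X) (rint_ysplit f Y s.1) (rint_ysplit f Y X).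
  apply: le_trans (cnD _ _) _; apply: le_trans (lerD (cnD _ _) (cnD _ _)) _.
  move: g1 g2 g3 g4; rewrite !negbK => g1 g2 g3 g4.
  apply: le_trans (lerD (lerD g1 g3) (lerD g2 g4)) _.
  have -> : ((l + m) / 2 ^+ n) ^+ 2 = 4 * ((l + m) / 2 ^+ n.+1) ^+ 2.
    by rewrite (half (l + m) n); set q' := _ / _; clear; ring.
  rewrite [leRHS]mulrCA; set T := e * _; clear; lra.
have /choice [nx hnx] : forall ns : nat * (R * R), exists s', Bad ns.1 ns.2 ->
   Bad ns.1.+1 s' /\ [/\ ns.2.1 <= s'.1 <= ns.2.1 + l / 2 ^+ ns.1.+1 &
        ns.2.2 <= s'.2 <= ns.2.2 + m / 2 ^+ ns.1.+1].
  by case=> n s; exact: step.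
pose fix s n := if n is n'.+1 then nx (n', s n') else (x1, y1).
have Ex : x1 + l = x2 by rewrite addrC subrK.
have Ey : y1 + m = y2 by rewrite addrC subrK.
have bs n : Bad n (s n).
  elim: n => [|n IH]; last by have [] := hnx (n, s n) IH.
  by rewrite /Bad /= expr0 !divr1 Ex Ey; split; split.
have [a ha] := @geometric_limit (fun n => (s n).1) l
  (fun n => proj1 (proj2 (hnx (n, s n) (bs n)))).
have [b hb] := @geometric_limit (fun n => (s n).2) m
  (fun n => proj2 (proj2 (hnx (n, s n) (bs n)))).
pose z := Complex a b.
have [D hD] : exists D, cd f z D.
  apply: H; split => /=.
    by have := ha 0%N; rewrite /= expr0 divr1 Ex.
  by have := hb 0%N; rewrite /= expr0 divr1 Ey.
(* The factor 4 of [rint_le] turns [e / 4] back into [e] in the final estimate. *)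
have e4 : 0 < e / 4 by rewrite divr_gt0.
have [d d0 hd] := hD _ e4.
have [n hn] := half_small (l + m) d0.
have [[a1 a2] [b1 b2]] := bs n; move/negP; apply.
set u := (s n).1; set v := (s n).2.
have /andP[ha1 ha2] := ha n; have /andP[hb1 hb2] := hb n.
rewrite -/u -/v in a1 a2 b1 b2 ha1 ha2 hb1 hb2.
(* The affine part of f at the limit point has a polynomial primitive, so only the remainder [E]
   contributes to the integral. *)
pose A w := f z + (w - z) * D; pose E w := f w - A w.
have gA w : gcat A w.
  apply: (@cd_gcat _ _ (0 + ((1 + 0) * D + (w - z) * 0))).
  by apply: cdD; [exact: cd_cst|apply: cdM; [apply: cdD; [exact: cd_id|exact: cd_cst]|exact: cd_cst]].
have gE w : gcat E w.
  by apply/gcatP; apply: continuousB; apply/gcatP.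
have lp := p n _ l0; have mp := p n _ m0.
have ux : -1 <= u <= u + l / 2 ^+ n by clear -x1g a1 lp; lra.
have vy : -1 <= v <= v + m / 2 ^+ n by clear -y1g b1 mp; lra.
have -> : f = (fun w => A w + E w) by apply/funext => w; rewrite /E addrC subrK.
rewrite rintD//; [|exact: gc_lc|exact: gc_lc].
rewrite (@rint_prim A (fun w => f z * w + D * (2^-1 * (w - z) ^+ 2)))//; last first.
- move=> w _.
  have -> : A w = f z * 1 + D * (2^-1 * (2%:R * (w - z) ^+ 1 * (1 + 0))).
    by rewrite /A; field.
  apply: cdD; first by apply: cdZ; exact: cd_id.
  apply/cdZ/cdZ/cdX/cdD; [exact: cd_id|exact: cd_cst].
- exact: gc_lc.
rewrite add0r.
apply: le_trans (@rint_le E _ _ _ _ (e / 4 * ((l + m) / 2 ^+ n)) _ ux vy _) _.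
- exact: gc_lc.
- case=> w1 w2 [/= /andP[q1 q2] /andP[q3 q4] _].
  have wz : cn (Complex w1 w2 - z) <= (l + m) / 2 ^+ n.
    rewrite /z; simpc; apply: le_trans (cn_complex_le _ _) _; rewrite mulrDl.
    apply: lerD; rewrite ler_norml.
      by clear -q1 q2 ha1 ha2; lra.
    by clear -q3 q4 hb1 hb2; lra.
  have := hd _ (le_lt_trans wz hn); rewrite [z + _]addrC subrK => hh.
  have -> : E (Complex w1 w2) = f (Complex w1 w2) - f z - (Complex w1 w2 - z) * D.
    by rewrite /E /A; ring.
  by apply: le_trans hh _; rewrite ler_pM2l.
- rewrite (addrC u) addrK (addrC v) addrK -mulrDl; set T := (l + m) / _.
  by rewrite le_eqVlt; apply/orP; left; apply/eqP; clear; field.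
Qed.

End Goursat.

(** * Cauchy's formula on a square and Taylor remainders *)

Section Cauchy.
Variable R : realType.
Local Notation C := R[i].
Local Notation cn := (@Normc.normc R).
Local Notation re := (@complex.Re R).
Local Notation im := (@complex.Im R).
Implicit Types (f g : C -> C) (z w : C).

(** The square is cut along the sides of a small square around [z0]. The outer pieces vanish by
    [goursat]; the small one is bounded by its size, because f is continuous, hence bounded, at
    [z0]. *)
Lemma goursat_punctured f z0 : (forall z, gcat f z) ->
  -1 < re z0 < 1 -> -1 < im z0 < 1 ->
  (forall z, rect (-1) 1 (-1) 1 z -> z != z0 -> exists l, cd f z l) ->
  rint f (-1) 1 (-1) 1 = 0.
Proof.
move=> gf; case: z0 => a b /= /andP[a1 a2] /andP[b1 b2] H.
have [d d0 hd] := gf (Complex a b) _ ltr01.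
apply: (@cn_small_eq0 R _ (16 * (cn (f (Complex a b)) + 1))) => e e0.
(* [D] is half the side of the small square: at most [e] for the estimate, at most [d / 4] for the
   bound on f, and small enough to stay strictly inside the large square. *)
pose D := Num.min e (Num.min (d / 4) (Num.min (Num.min ((1 - a) / 2) ((a + 1) / 2))
   (Num.min ((1 - b) / 2) ((b + 1) / 2)))).
have D0 : 0 < D by rewrite !lt_min; do !(apply/andP; split); lra.
have : D <= D by [].
rewrite {2}/D !le_min => /and3P[De Dd /andP[/andP[Da1 Da2] /andP[Db1 Db2]]].
have Z x1 x2 y1 y2 : -1 <= x1 <= x2 -> x2 <= 1 -> -1 <= y1 <= y2 -> y2 <= 1 ->
    [\/ x2 < a, a < x1, y2 < b | b < y1] -> rint f x1 x2 y1 y2 = 0.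
  move=> hx x21 hy y21 HH; apply: goursat => // -[u v] [/= /andP[u1 u2] /andP[v1 v2]].
  apply: H; first by split => /=; lra.
  by apply/eqP => -[Eu Ev]; case: HH; lra.
rewrite (rint_xsplit f (a - D)) (rint_xsplit f (a + D) (a - D)).
rewrite (Z (-1)); [|lra|lra|lra|lra|by apply: Or41; lra].
rewrite (Z (a + D)); [|lra|lra|lra|lra|by apply: Or42; lra].
rewrite (rint_ysplit f (b - D)) (rint_ysplit f (b + D) _ _ (b - D)).
rewrite (Z _ _ (-1)); [|lra|lra|lra|lra|by apply: Or43; lra].
rewrite (Z _ _ (b + D)); [|lra|lra|lra|lra|by apply: Or44; lra].
rewrite !add0r !addr0.
apply: le_trans (@rint_le _ f _ _ _ _ (cn (f (Complex a b)) + 1) _ _ _ _) _.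
- exact: gc_lc.
- lra.
- lra.
- case=> u v [/= /andP[u1 u2] /andP[v1 v2] _].
  have /hd : cn (Complex u v - Complex a b) < d.
    apply: le_lt_trans (cn_complex_le _ _) _.
    have : `|u - a| <= D by rewrite ler_norml; lra.
    have : `|v - b| <= D by rewrite ler_norml; lra.
    by lra.
  by have := cn_sub (f (Complex u v)) (f (Complex a b)); lra.
- have := cn_ge0 (f (Complex a b)) => c0.
  have -> : a + D - (a - D) + (b + D - (b - D)) = 4 * D by ring.
  by rewrite mulrA ler_pM; lra.
Qed.

(** The boolean selects one of the two horizontal and one of the two vertical sides of the square
    [-1,1]^2. *)
Definition lcQ g := forall s : bool, let x : R := if s then 1 else -1 in
  ccont (hl g x) /\ ccont (vl g x).

Lemma lcQ_lc g : lcQ g -> lc g (-1) 1 (-1) 1.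
Proof. by move=> H; have [] := H true; have [] := H false. Qed.

Lemma gc_lcQ g : (forall z, gcat g z) -> lcQ g.
Proof. by move=> H s; split; [exact: gc_hl|exact: gc_vl]. Qed.

Lemma lcQM f g : lcQ f -> lcQ g -> lcQ (fun z => f z * g z).
Proof.
move=> cf cg s; have [? ?] := cf s; have [? ?] := cg s.
by split; apply: ccontM.
Qed.

Lemma lcQ_id : lcQ id.
Proof. by apply: gc_lcQ => z; apply: cd_gcat; exact: cd_id. Qed.

Lemma lcQ_cst c : lcQ (fun=> c).
Proof. by apply: gc_lcQ => z; apply: cd_gcat; exact: cd_cst. Qed.

Lemma lcQX f n : lcQ f -> lcQ (fun z => f z ^+ n).
Proof. by move=> cf s; have [? ?] := cf s; split; apply: ccontX. Qed.

Lemma sideQ_ge1 (s : bool) t : let x : R := if s then 1 else -1 in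
  1 <= cn (Complex t x) /\ 1 <= cn (Complex x t).
Proof.
split; [apply: le_trans (ge_Im_cn _)|apply: le_trans (ge_Re_cn _)] => /=.
  by case: s; rewrite ?normrN normr1.
by case: s; rewrite ?normrN normr1.
Qed.

Lemma lcQV w : cn w < 1 -> lcQ (fun z => (z - w)^-1).
Proof.
move=> w1 s; have [c1 c2] := lcQ_id s; split.
  apply: (@ccontV _ (fun t => Complex t (if s then 1 else -1) - w)).
    by apply: ccontD => //; exact: ccont_cst.
  move=> t; have [h _] := sideQ_ge1 s t; rewrite /= in h.
  by rewrite subr_eq0; apply/eqP => E; rewrite -E in w1; move: w1; rewrite /=; lra.
apply: (@ccontV _ (fun t => Complex (if s then 1 else -1) t - w)).
  by apply: ccontD => //; exact: ccont_cst.
move=> t; have [_ h] := sideQ_ge1 s t; rewrite /= in h.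
by rewrite subr_eq0; apply/eqP => E; rewrite -E in w1; move: w1; rewrite /=; lra.
Qed.

Notation Rint g := (rint g (-1) 1 (-1) 1).

(** The lines carrying the sides avoid the open unit disc, so identities that fail at a pole in the
    disc can still be used under the integral. *)
Lemma Rint_ext f g : (forall z, 1 <= cn z -> f z = g z) -> Rint f = Rint g.
Proof.
move=> H; rewrite /rint.
have E s : let x : R := if s then 1 else -1 in hl f x = hl g x /\ vl f x = vl g x.
  by split; apply/funext => t; apply: H; have [] := sideQ_ge1 s t.
have [h1 h2] := E true; have [h3 h4] := E false.
by rewrite h1 h2 h3 h4.
Qed.

Lemma pm1 : ((-1 : R) <= -1) && ((-1 : R) <= 1). Proof. by rewrite lexx; lra. Qed.

Lemma RintD f g : lcQ f -> lcQ g -> Rint (fun z => f z + g z) = Rint f + Rint g.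
Proof. by move=> /lcQ_lc hf /lcQ_lc hg; rewrite rintD ?pm1. Qed.

Lemma RintZ c f : lcQ f -> Rint (fun z => c * f z) = c * Rint f.
Proof. by move=> /lcQ_lc hf; rewrite rintZ ?pm1. Qed.

Lemma Rint_le f K : lcQ f -> (forall z, 1 <= cn z -> cn z <= 2 -> cn (f z) <= K) ->
  cn (Rint f) <= 16 * K.
Proof.
move=> /lcQ_lc hf HK.
have := @rint_le _ f _ _ _ _ K hf pm1 pm1.
have -> : 4 * K * (1 - -1 + (1 - -1)) = 16 * K by ring.
apply=> -[u v] [/= h1 h2 h3]; apply: HK.
  case: h3 => E; [rewrite E; have [_] := sideQ_ge1 false v|
    rewrite E; have [_] := sideQ_ge1 true v|
    rewrite E; have [] := sideQ_ge1 false u|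
    rewrite E; have [] := sideQ_ge1 true u] => //.
apply: le_trans (cn_complex_le _ _) _.
have : `|u| <= 1 by rewrite ler_norml.
have : `|v| <= 1 by rewrite ler_norml.
lra.
Qed.

(* The value is 2 i pi, but only c0 <> 0 is needed; it follows from the sign of the imaginary
   part of the integrand on each side. *)
Definition c0 : C := Rint (fun z => z^-1).

Lemma lcQ_inv : lcQ (fun z => z^-1).
Proof.
have := @lcQV 0; rewrite cn0 => /(_ ltr01).
by rewrite (_ : (fun z : C => (z - 0)^-1) = fun z => z^-1)//; apply/funext => z; rewrite subr0.
Qed.

Lemma im_c0 : 0 < im c0.
Proof.
have [hT vT] := lcQ_inv true; have [hF vF] := lcQ_inv false.
have ab : (-1 : R) <= 1 by lra.
have ge F : ccont F -> (forall t, 0 < im (F t)) -> 0 < im (intC F (-1) 1).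
  move=> cF pF; have [t _ E] := prim_mv (im_cont cF) (lexx (-1)) ab.
  by rewrite [im _]E /= mulr_gt0//; lra.
have ge2 F : ccont F -> (forall t, im (F t) < 0) -> im (intC F (-1) 1) < 0.
  move=> cF pF; have [t _ E] := prim_mv (im_cont cF) (lexx (-1)) ab.
  by rewrite [im _]E /= pmulr_llt0//; lra.
have ge3 F : ccont F -> (forall t, 0 < re (F t)) -> 0 < re (intC F (-1) 1).
  move=> cF pF; have [t _ E] := prim_mv (re_cont cF) (lexx (-1)) ab.
  by rewrite [re _]E /= mulr_gt0//; lra.
have ge4 F : ccont F -> (forall t, re (F t) < 0) -> re (intC F (-1) 1) < 0.
  move=> cF pF; have [t _ E] := prim_mv (re_cont cF) (lexx (-1)) ab.
  by rewrite [re _]E /= pmulr_llt0//; lra.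
have P (t : R) : 0 < t ^+ 2 + 1 by have := sqr_ge0 t; lra.
have := ge _ hF; have := ge2 _ hT; have := ge3 _ vT; have := ge4 _ vF.
rewrite /c0 /rint.
case: (intC (hl _ _) _ _) => a1 a2; case: (intC (hl _ _) _ _) => b1 b2.
case: (intC (vl _ _) _ _) => d1 d2; case: (intC (vl _ _) _ _) => e1 e2.
move=> h1 h2 h3 h4; simpc => /=.
have {}h1 : d1 < 0.
  apply: h1 => t; rewrite /vl /=.
  have -> : (-1) ^+ 2 + t ^+ 2 = t ^+ 2 + 1 by ring.
  by rewrite mulN1r oppr_lt0 invr_gt0.
have {}h2 : 0 < e1.
  apply: h2 => t; rewrite /vl /=.
  have -> : 1 ^+ 2 + t ^+ 2 = t ^+ 2 + 1 by ring.
  by rewrite mul1r invr_gt0.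
have {}h3 : a2 < 0.
  apply: h3 => t; rewrite /hl /=.
  have -> : t ^+ 2 + 1 ^+ 2 = t ^+ 2 + 1 by ring.
  by rewrite mul1r oppr_lt0 invr_gt0.
have {}h4 : 0 < b2.
  apply: h4 => t; rewrite /hl /=.
  have -> : t ^+ 2 + (-1) ^+ 2 = t ^+ 2 + 1 by ring.
  by rewrite mulN1r opprK invr_gt0.
lra.
Qed.

Lemma c0_neq0 : c0 != 0.
Proof. by apply/eqP => E; have := im_c0; rewrite E /= ltxx. Qed.

Lemma cn_ge1_neq0 z : 1 <= cn z -> z != 0.
Proof. by move=> h; rewrite -cn_gt0; lra. Qed.

Lemma cn_sub_neq0 z w : 1 <= cn z -> cn w <= 2^-1 -> z - w != 0.
Proof. by move=> h1 h2; rewrite -cn_gt0; have := cn_sub z w; lra. Qed.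

(** Finite geometric expansion of the Cauchy kernel: 1/(z-w) is the sum of w^k / z^(k+1) for k < n
    plus w^n / (z^n (z-w)). The finite form avoids exchanging an integral and a series. *)
Lemma Rint_expand g w n : lcQ g -> cn w <= 2^-1 ->
  Rint (fun z => g z * (z - w)^-1) =
  \sum_(k < n) w ^+ k * Rint (fun z => g z * z^-1 ^+ k.+1) +
  w ^+ n * Rint (fun z => g z * z^-1 ^+ n * (z - w)^-1).
Proof.
move=> cg w1; have w2 : cn w < 1 by lra.
have cz k : lcQ (fun z => g z * z^-1 ^+ k) by apply: lcQM cg (lcQX _ lcQ_inv).
elim: n => [|n IH].
  rewrite big_ord0 add0r expr0 mul1r; apply: Rint_ext => z _.
  by rewrite expr0 mulr1.
rewrite {}IH big_ord_recr /= -addrA; congr (_ + _).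
rewrite exprSr -mulrA -mulrDr; congr (_ * _).
rewrite -RintZ; last by apply: lcQM (cz _) (lcQV w2).
rewrite -RintD//; last by apply: lcQM; [exact: lcQ_cst|apply: lcQM (cz _) (lcQV w2)].
apply: Rint_ext => z z1; rewrite exprSr.
have zw := cn_sub_neq0 z1 w1; have z0 := cn_ge1_neq0 z1.
by field; rewrite zw z0.
Qed.

(** On the sides |1/z| <= 1 and |1/(z-w)| <= 2; with the factor 16 of [Rint_le] this gives 32. *)
Lemma remainder_le g w n K : lcQ g -> cn w <= 2^-1 -> 0 <= K ->
  (forall z, 1 <= cn z -> cn z <= 2 -> cn (g z) <= K) ->
  cn (w ^+ n * Rint (fun z => g z * z^-1 ^+ n * (z - w)^-1)) <= cn w ^+ n * (32 * K).
Proof.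
move=> cg w1 K0 HK; have w2 : cn w < 1 by lra.
rewrite cnM cnX ler_wpM2l ?exprn_ge0 ?cn_ge0//.
have -> : 32 * K = 16 * (K * 2) by ring.
apply: Rint_le => [|z z1 z2].
  by apply: lcQM (lcQV w2); apply: lcQM cg (lcQX _ lcQ_inv).
rewrite !cnM cnX !cnV -[K * 2]/(K * 2) -(mulr1 K).
apply: ler_pM; rewrite ?mulr_ge0 ?exprn_ge0 ?invr_ge0 ?cn_ge0//.
  apply: ler_pM; rewrite ?exprn_ge0 ?invr_ge0 ?cn_ge0//; first exact: HK.
  by rewrite exprn_ile1 ?invr_ge0 ?cn_ge0// invf_le1//; lra.
have h : 2^-1 <= cn (z - w) by have := cn_sub z w; lra.
by rewrite -[leRHS]invrK lef_pV2// posrE; lra.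
Qed.

(** Expanding the kernel with g = 1, the term k = 0 is [c0], the others vanish because z^-(k+1) has
    a primitive on the sides, and the remainder tends to 0. *)
Lemma Rint_pole w : cn w <= 2^-1 -> Rint (fun z => (z - w)^-1) = c0.
Proof.
move=> w1.
have E n : Rint (fun z => (z - w)^-1) =
   c0 + w ^+ n.+1 * Rint (fun z => 1 * z^-1 ^+ n.+1 * (z - w)^-1).
  rewrite -[LHS](@Rint_ext (fun z => 1 * (z - w)^-1)); last by move=> z _; rewrite mul1r.
  rewrite (Rint_expand n.+1 (lcQ_cst 1) w1); congr (_ + _).
  rewrite big_ord_recl /= expr0 mul1r big1 ?addr0.
    by apply: Rint_ext => z _; rewrite mul1r expr1.
  move=> i _; rewrite (@rint_prim _ _ (fun z => - (i.+1%:R)^-1 * z^-1 ^+ i.+1)) ?mulr0 ?pm1//.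
    by apply: lcQ_lc; apply: lcQM (lcQ_cst _) (lcQX _ lcQ_inv).
  move=> z [_ _ hb].
  have z1 : 1 <= cn z.
    case: z hb => u v /= [] ->; [have [_] := sideQ_ge1 false v|
    have [_] := sideQ_ge1 true v| have [] := sideQ_ge1 false u|
    have [] := sideQ_ge1 true u] => //.
  have z0 := cn_ge1_neq0 z1.
  have := cdZ (- (i.+1%:R)^-1) (cdX i (cdV z0 (@cd_id R z))).
  rewrite (_ : _ * _ = 1 * z^-1 ^+ (lift ord0 i).+1)//.
  have n0 : i.+1%:R != 0 :> C by rewrite pnatr_eq0.
  rewrite /= /bump /= add1n !exprS; move: (i.+1%:R) n0 => c n0.
  by field; rewrite z0 n0.
apply/eqP; rewrite -subr_eq0; apply/eqP.
apply: (@cn_small_eq0 R _ 1) => e e0; rewrite mul1r.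
have [n hn] := half_small 32 e0.
rewrite (E n) addrAC subrr add0r.
apply: le_trans (@remainder_le _ _ n.+1 1 (lcQ_cst 1) w1 ler01 _) _.
  by move=> z _ _; rewrite cn1.
apply: le_trans (ltW hn); rewrite mulr1 mulrC ler_pM2l//.
rewrite exprS -[leRHS]mul1r -exprVn; apply: ler_pM; rewrite ?exprn_ge0 ?cn_ge0//; first lra.
by apply: lerXn2r; rewrite ?nnegrE ?cn_ge0 ?invr_ge0.
Qed.

(* Composing with [pr] extends a function given near the square [-1,1]^2 to a continuous
   function on the whole plane, as [gcat] is demanded everywhere. *)
Definition clamp (x : R) : R := Num.max (- (5 / 4)) (Num.min (5 / 4) x).
Definition pr z := Complex (clamp (re z)) (clamp (im z)).

Lemma clamp_le x : `|clamp x| <= 5 / 4.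
Proof.
by rewrite /clamp ler_norml le_max lexx /= ge_max ge_min lexx /=; lra.
Qed.

Lemma clamp_id x : `|x| <= 5 / 4 -> clamp x = x.
Proof.
rewrite ler_norml => /andP[h1 h2]; rewrite /clamp.
by rewrite min_r// max_r.
Qed.

Lemma clamp_lip x y : `|clamp x - clamp y| <= `|x - y|.
Proof.
have mx (c a b : R) : `|Num.max c a - Num.max c b| <= `|a - b|.
  by case: (leP c a) => ?; case: (leP c b) => ?; rewrite ler_norml;
    case: (lerP 0 (a - b)) => h5; rewrite ?(ger0_norm h5) ?(ltr0_norm h5); lra.
have mn (c a b : R) : `|Num.min c a - Num.min c b| <= `|a - b|.
  by case: (leP c a) => ?; case: (leP c b) => ?; rewrite ler_norml;
    case: (lerP 0 (a - b)) => h5; rewrite ?(ger0_norm h5) ?(ltr0_norm h5); lra.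
exact: le_trans (mx _ _ _) (mn _ _ _).
Qed.

Lemma pr_lt3 z : cn (pr z) < 3.
Proof.
apply: le_lt_trans (cn_complex_le _ _) _.
by have := clamp_le (re z); have := clamp_le (im z); lra.
Qed.

Lemma pr_lip z w : cn (pr z - pr w) <= 2 * cn (z - w).
Proof.
rewrite /pr; apply: le_trans (cn_complex_le _ _) _.
have := clamp_lip (re z) (re w); have := clamp_lip (im z) (im w).
have := ge_Re_cn (z - w); have := ge_Im_cn (z - w); rewrite !raddfB /=.
lra.
Qed.

Lemma pr_id z : `|re z| <= 5 / 4 -> `|im z| <= 5 / 4 -> pr z = z.
Proof. by case: z => a b /= h1 h2; rewrite /pr /= !clamp_id. Qed.

(** Cauchy's formula for [F], followed by [Rint_expand]; [K0] is the 32 of [remainder_le] divided by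
    |c0|. The radius 3 is chosen so that the disc contains the image of [pr], where f must be
    differentiable and bounded. *)
Theorem taylor_unit : exists K0, 0 < K0 /\ forall f M,
  (forall z, cn z < 3 -> exists l, cd f z l) ->
  (forall z, cn z < 3 -> cn (f z) <= M) ->
  exists a : nat -> C, forall n z, cn z <= 2^-1 ->
    cn (f z - \sum_(k < n) a k * z ^+ k) <= K0 * M * cn z ^+ n.
Proof.
have c0p : 0 < cn c0 by rewrite cn_gt0 c0_neq0.
exists (32 / cn c0); split; first by rewrite divr_gt0.
move=> f M df HM.
have M0 : 0 <= M by apply: le_trans (HM 0 _); rewrite ?cn_ge0// cn0.
pose F z := f (pr z).
have gF z : gcat F z.
  have [l /cd_gcat gl] := df _ (pr_lt3 z).
  move=> e /gl [d d0 hd]; exists (d / 2); first by lra.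
  by move=> w hw; apply: hd; have := pr_lip w z; lra.
have Ff z : `|re z| <= 1 -> `|im z| <= 1 -> forall w, cn (w - z) < 4^-1 -> F w = f w.
  move=> z1 z2 w hw; rewrite /F pr_id//.
    have := ge_Re_cn (w - z); have := ler_normD (re w - re z) (re z).
    by rewrite subrK raddfB /=; lra.
  have := ge_Im_cn (w - z); have := ler_normD (im w - im z) (im z).
  by rewrite subrK raddfB /=; lra.
have dF z : `|re z| <= 1 -> `|im z| <= 1 -> exists l, cd F z l.
  move=> z1 z2; have z3 : cn z < 3 by have := le_cn_ReIm z; lra.
  have [l hl] := df _ z3; exists l.
  have q0 : 0 < 4^-1 :> R by rewrite invr_gt0.
  exact: (cd_near q0 (fun w hw => esym (Ff z z1 z2 w hw)) hl).
have cauchy w : cn w <= 2^-1 -> F w * c0 = Rint (fun z => F z * (z - w)^-1).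
  move=> w1.
  have rw : `|re w| <= 1 by have := ge_Re_cn w; lra.
  have iw : `|im w| <= 1 by have := ge_Im_cn w; lra.
  have [l hl] := dF w rw iw.
  (* The difference quotient, completed by the derivative at [w]: continuous everywhere and
     differentiable on the square off [w], so its integral vanishes by [goursat_punctured]. *)
  pose k z := if z == w then l else (F z - F w) * (z - w)^-1.
  have kc z : z != w -> gcat (fun z => (F z - F w) * (z - w)^-1) z.
    move=> zw; apply/gcatP.
    have h : {for (z : R[i]^o), continuous (fun z : R[i]^o => F z - F w : R[i]^o)}.
      apply: continuousB; first exact/gcatP/gF.
      exact: cst_continuous.
    have h2 : gcat (fun z => (z - w)^-1) z.
      apply: cd_gcat; apply: cdV; first by rewrite subr_eq0.
      by apply: cdD; [exact: cd_id|exact: cd_cst].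
    move/gcatP: h2 => h2.
    exact: (@continuousM R[i] R[i]^o _ _ _ h h2).
  have kE z : z != w -> exists2 d, 0 < d &
     forall v, cn (v - z) < d -> (F v - F w) * (v - w)^-1 = k v.
    move=> zw; exists (cn (z - w)); first by rewrite cn_gt0 subr_eq0.
    move=> v hv; rewrite /k ifN//; apply/eqP => E.
    by rewrite E cnC ltxx in hv.
  have gk z : gcat k z.
    have [->|zw] := eqVneq z w.
      move=> e e0; have e2 : 0 < e / 2 by lra.
      have [d d0 hd] := hl _ e2; exists d => // v hv.
      rewrite /k eqxx; case: eqP => [_|/eqP vw]; first by rewrite subrr cn0.
      have := hd _ hv; rewrite (addrC w) subrK => h.
      have vp : 0 < cn (v - w) by rewrite cn_gt0 subr_eq0.
      have -> : (F v - F w) / (v - w) - l = (F v - F w - (v - w) * l) / (v - w).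
        by field; rewrite subr_eq0.
      rewrite cnM cnV; apply: le_lt_trans (_ : e / 2 < _); last lra.
      by rewrite ler_pdivrMr.
    move=> e e0; have [d d0 hd] := kc z zw e e0.
    have [d' d'0 hE] := kE z zw.
    exists (Num.min d d'); first by rewrite lt_min d0.
    move=> v; rewrite lt_min => /andP[/hd h1 h2].
    by rewrite -!hE// subrr cn0.
  have Rk : Rint k = 0.
    apply: (@goursat_punctured _ w) => //.
    - by have := ge_Re_cn w; rewrite -ltr_norml; lra.
    - by have := ge_Im_cn w; rewrite -ltr_norml; lra.
    move=> z [hz1 hz2] zw; have [d d0 hd] := kE z zw.
    have [||m hm] := dF z; [by rewrite ler_norml|by rewrite ler_norml|].
    have hv : z - w != 0 by rewrite subr_eq0.
    have h1 := cdD hm (cd_cst (- F w) z).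
    have h2 : cd (fun z => z - w) z (1 + 0) := cdD (@cd_id R z) (cd_cst (- w) z).
    have h3 := @cdV R (fun z => z - w) z _ hv h2.
    by eexists; exact: (cd_near d0 hd (cdM h1 h3)).
  have cw : cn w < 1 by lra.
  (* The equality is only needed on the sides, where [z] differs from [w]. *)
  have <- : Rint (fun z => k z + F w * (z - w)^-1) = Rint (fun z => F z * (z - w)^-1).
    apply: Rint_ext => z z1.
    have zw : z - w != 0 := cn_sub_neq0 z1 w1.
    by rewrite /k -subr_eq0 (negPf zw); field.
  rewrite RintD; [|exact: gc_lcQ|by apply: lcQM (lcQ_cst _) (lcQV cw)].
  by rewrite Rk add0r RintZ ?Rint_pole//; exact: lcQV.
have cF : lcQ F := gc_lcQ gF.
exists (fun k => c0^-1 * Rint (fun z => F z * z^-1 ^+ k.+1)) => n z z1.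
have -> : f z = F z.
  rewrite (Ff z) ?subrr ?cn0 ?invr_gt0//; first by have := ge_Re_cn z; lra.
  by have := ge_Im_cn z; lra.
have -> : F z - \sum_(k < n) c0^-1 * Rint (fun z0 => F z0 * z0^-1 ^+ k.+1) * z ^+ k =
   c0^-1 * (z ^+ n * Rint (fun v => F v * v^-1 ^+ n * (v - z)^-1)).
  apply: (mulIf c0_neq0); rewrite mulrBl cauchy// (Rint_expand n cF z1) mulr_suml.
  rewrite [X in X + _ - _](eq_bigr (fun k : 'I_n =>
     c0^-1 * Rint (fun z0 : C => F z0 * z0^-1 ^+ k.+1) * z ^+ k * c0)); last first.
    by move=> k _; field; rewrite c0_neq0.
  by rewrite addrAC subrr add0r mulrAC mulVf ?c0_neq0// mul1r.
rewrite cnM cnV.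
have := @remainder_le F z n M cF z1 M0 (fun v _ _ => HM _ (pr_lt3 v)).
set X := cn (_ * _) => hX.
have -> : 32 / cn c0 * M * cn z ^+ n = (cn c0)^-1 * (cn z ^+ n * (32 * M)) by field; rewrite gt_eqF.
by rewrite ler_pM2l ?invr_gt0.
Qed.

End Cauchy.

(** * Holomorphic functions of several variables *)

Section Frechet.
Variable R : realType.
Local Notation C := R[i].
Local Notation cn := (@Normc.normc R).
Local Notation re := (@complex.Re R).
Variable N : nat.
Local Notation pt := ('rV[C]_N).
Local Notation ptN := ('rV[C]_N : normedModType C).
Implicit Types (f g : pt -> C) (p q h : pt) (a b : 'I_N -> C).

(* The l1 norm; the library's norm on row vectors is the complex-valued sup norm. *)
Definition vn p : R := \sum_(i < N) cn (p 0 i).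

Lemma vn_ge0 p : 0 <= vn p.
Proof. by apply: sumr_ge0 => i _; exact: cn_ge0. Qed.

Lemma vn0 : vn 0 = 0.
Proof. by rewrite /vn big1// => i _; rewrite mxE cn0. Qed.

Lemma vnD p q : vn (p + q) <= vn p + vn q.
Proof. by rewrite /vn -big_split ler_sum// => i _; rewrite mxE cnD. Qed.

Lemma vnN p : vn (- p) = vn p.
Proof. by apply: eq_bigr => i _; rewrite mxE cnN. Qed.

Lemma vnC p q : vn (p - q) = vn (q - p).
Proof. by rewrite -vnN opprB. Qed.

Lemma vnZ (c : C) p : vn (c *: p) = cn c * vn p.
Proof. by rewrite /vn mulr_sumr; apply: eq_bigr => i _; rewrite mxE cnM. Qed.

Lemma cn_le_vn p i : cn (p 0 i) <= vn p.
Proof. by rewrite /vn (bigD1 i)//= lerDl sumr_ge0// => j _; exact: cn_ge0. Qed.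

Lemma vn_delta i : vn (delta_mx 0 i) = 1.
Proof.
rewrite /vn (bigD1 i)//= mxE !eqxx cn1 big1 ?addr0// => j ji.
by rewrite mxE eqxx (negPf ji) cn0.
Qed.

Lemma vn_eq0 p : vn p = 0 -> p = 0.
Proof.
move=> h; apply/rowP => i; rewrite mxE; apply/eqP; rewrite -cn_eq0 eq_le cn_ge0.
by rewrite -h cn_le_vn.
Qed.

Lemma ball0P (r : C) p : 0 < r ->
  ball (0 : ptN) r p <-> forall i, cn (p 0 i) < re r.
Proof.
move=> r0; split=> [[_ H] i | H].
  by have := H 0 i; rewrite /ball /= mxE sub0r normrN ltC_cn.
split=> // i j; rewrite ord1 /ball /= mxE sub0r normrN ltC_cn//.
Qed.

Lemma vn_ball (r : C) p : 0 < r -> vn p < re r -> ball (0 : ptN) r p.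
Proof. by move=> r0 h; apply/ball0P => // i; apply: le_lt_trans h; exact: cn_le_vn. Qed.

(** The ball is one of the sup norm, and summing the coordinates costs at most N; [N.+1] keeps the
    quotient meaningful for N = 0. *)
Lemma ball_vn (d : R) p : 0 < d -> ball (0 : ptN) (d / N.+1%:R)%:C%C p -> vn p < d.
Proof.
move=> d0 /ball0P H; have dN : 0 < d / N.+1%:R by rewrite divr_gt0.
have {}H i : cn (p 0 i) <= d / N.+1%:R.
  by apply/ltW/H; rewrite ltcR.
apply: le_lt_trans (ler_sum _ (fun i _ => H i)) _.
rewrite sumr_const card_ord -[ltLHS]mulr_natr -mulrA gtr_pMr// mulrC ltr_pdivrMr// mul1r.
by rewrite ltr_nat.
Qed.

Lemma norm_ball (h : pt) (e : C) : 0 < e -> `|h : ptN| < e -> ball (0 : ptN) e h.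
Proof. by move=> e0 he; rewrite mx_norm_ball /ball_ /= sub0r normrN. Qed.

Lemma norm_le_vn (h : pt) : `|h : ptN| <= (vn h)%:C%C.
Proof.
rewrite /Num.norm /=; have [->|/mx_norm_neq0 [[i j] ->]] := eqVneq (mx_norm h) 0.
  by rewrite lecR vn_ge0.
by rewrite /= ord1 normC_cn lecR cn_le_vn.
Qed.

Lemma vn_le_norm (h : pt) : (vn h)%:C%C <= N%:R * `|h : ptN|.
Proof.
have E : `|h : ptN| = (re `|h : ptN|)%:C%C.
  have : 0 <= `|h : ptN| by exact: normr_ge0.
  by case: (`|h : ptN|) => u v; rewrite lecE /= => /andP[/eqP -> _].
rewrite E -(rmorph_nat (real_complex R)) -rmorphM lecR.
have H i : cn (h 0 i) <= re `|h : ptN|.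
  apply/ler_addgt0Pr => e e0.
  have r0 : 0 <= re `|h : ptN| by rewrite -lecR -E; exact: normr_ge0.
  have p0 : 0 < ((re `|h : ptN| + e)%:C%C : C) by rewrite ltcR ltr_wpDl.
  have : ball (0 : ptN) ((re `|h : ptN| + e)%:C%C) h.
    by apply: norm_ball => //; rewrite E /= ltcR ltrDl.
  by move/ball0P => /(_ p0 i) /ltW.
apply: le_trans (ler_sum _ (fun i _ => H i)) _.
by rewrite sumr_const card_ord mulr_natl.
Qed.

Definition lin a (h : pt) : C^o := \sum_(i < N) h 0 i * a i.

Lemma lin_is_linear a : linear (lin a).
Proof.
move=> c h k; rewrite /lin scaler_sumr -big_split; apply: eq_bigr => i _.
by rewrite !mxE mulrDl /GRing.scale /= mulrA.
Qed.

HB.instance Definition _ a := GRing.isLinear.Build C pt C^o _ (lin a) (lin_is_linear a).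

Lemma lin_le a h : cn (lin a h) <= (\sum_i cn (a i)) * vn h.
Proof.
apply: le_trans (cn_sum _ _ _) _; rewrite mulr_suml ler_sum// => i _.
by rewrite cnM mulrC ler_wpM2l ?cn_ge0// cn_le_vn.
Qed.

Lemma lin_delta a i : lin a (delta_mx 0 i) = a i.
Proof.
rewrite /lin (bigD1 i)//= mxE !eqxx mul1r big1 ?addr0// => j ji.
by rewrite mxE eqxx (negPf ji) mul0r.
Qed.

(* Complex Frechet differentiability with partial derivatives a. *)
Definition fd f p a := forall e, 0 < e -> exists2 d, 0 < d &
  forall h, vn h < d -> cn (f (p + h) - f p - lin a h) <= e * vn h.

(** With its converse [holo_fd], this replaces the filter-based differential by estimates between
    real numbers. *)
Lemma fd_holo f p a : fd f p a -> holo_at f p /\ forall i, pd f i p = a i.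
Proof.
move=> H.
pose L : {linear pt -> C^o} := lin a.
have cL : continuous (L : ptN -> C^o).
  move=> x; apply/(@cvgrPdist_lt C C^o _ _ (nbhs_filter (x : ptN))) => /= e /gt0_complexE [-> e0].
  set A := \sum_i cn (a i) + 1.
  have A0 : 0 < A by rewrite /A ltr_wpDl// sumr_ge0// => i _; exact: cn_ge0.
  have d0 : 0 < ((re e / A / N.+1%:R)%:C%C : C) by rewrite ltcR !divr_gt0.
  apply: filterS (nbhsx_ballx (x : ptN) _ d0) => y [y0 hy].
   rewrite -[`|_|]/(`|lin a x - lin a y|) -linearB /= normC_cn ltcR.
  apply: le_lt_trans (lin_le _ _) _.
  have h : vn (x - y) < re e / A.
    apply: ball_vn; first exact: divr_gt0.
    by split => // i j; have := hy i j; rewrite /ball /= !mxE sub0r normrN.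
  apply: le_lt_trans (_ : A * vn (x - y) < _).
    by rewrite ler_wpM2r ?vn_ge0// /A lerDl.
  by rewrite mulrC -ltr_pdivlMr.
have oL : (f : pt -> C^o) \o shift p = cst (f p) + L +o_ (0 : ptN) id.
  apply/eqaddoP => /= e /gt0_complexE [-> e0].
  have e1 : 0 < re e / N.+1%:R by rewrite divr_gt0.
  have [d d0 hd] := H _ e1.
  have d1 : 0 < ((d / N.+1%:R)%:C%C : C) by rewrite ltcR divr_gt0.
  apply: filterS (nbhsx_ballx (0 : ptN) _ d1) => h /(ball_vn d0) /hd H1.
  rewrite /= -[`|_|]/(`|f (h + p) - (f p + lin a h)|) normC_cn.
  rewrite (addrC h) opprD addrA.
  apply: le_trans (_ : (re e / N.+1%:R * vn h)%:C%C <= _); first by rewrite lecR.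
  rewrite rmorphM rmorphM -mulrA; apply: ler_wpM2l; first by rewrite lecR ltW.
  apply: le_trans (ler_wpM2l _ (vn_le_norm h)) _; first by rewrite lecR invr_ge0.
  rewrite mulrA -[leRHS]mul1r; apply: ler_wpM2r; first exact: normr_ge0.
  rewrite -(rmorph_nat (real_complex R)) -rmorphM lecR mulrC ler_pdivrMr// mul1r ler_nat//.
have dE := diff_unique cL oL.
have df : holo_at f p by apply/diff_locallyP; rewrite dE.
split=> // i; rewrite /pd deriveE// dE; exact: lin_delta.
Qed.

Lemma holo_fd f p : holo_at f p -> fd f p (fun i => pd f i p).
Proof.
move=> df; have /diff_locallyP [_ /eqaddoP oL] := df.
move=> e e0; have eC : 0 < (e%:C%C : C) by rewrite ltcR.
have /nbhs_ballP [d /= /gt0_complexE [-> d0] hd] := oL _ eC.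
exists (re d) => // h hh.
have dC : 0 < ((re d)%:C%C : C) by rewrite ltcR.
have := hd h (vn_ball dC hh).
rewrite /= -[`|_| in X in X -> _]/(`|f (h + p) - (f p + 'd (f : ptN -> C^o) (p : ptN) h)|).
have -> : 'd (f : ptN -> C^o) (p : ptN) h = lin (fun i => pd f i p) h.
  rewrite {1}(row_sum_delta h) linear_sum /lin; apply: eq_bigr => i _.
  by rewrite linearZ /= /pd deriveE.
rewrite (addrC h) opprD addrA normC_cn => H.
have : ((cn (f (p + h) - f p - lin (fun i => pd f i p) h))%:C%C : C) <= (e * vn h)%:C%C.
  apply: le_trans H _; rewrite rmorphM; apply: ler_wpM2l; first by rewrite ltW.
  exact: norm_le_vn.
by rewrite lecR.
Qed.

Lemma fdE f p a : fd f p a -> a = fun i => pd f i p.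
Proof. by move=> /fd_holo [_ h]; apply/funext => i. Qed.

Lemma fd_unique f p a b : fd f p a -> fd f p b -> a = b.
Proof. by move=> /fdE -> /fdE ->. Qed.

End Frechet.

Section Disc.
Variable R : realType.
Local Notation C := R[i].
Local Notation cn := (@Normc.normc R).

Lemma cnRp (x : R) : 0 <= x -> cn (x%:C%C) = x.
Proof. by move=> x0; rewrite cn_R ger0_norm. Qed.

Lemma le_limit (x y c : R) : (forall n, x <= y + c / 2 ^+ n) -> x <= y.
Proof.
move=> H; apply/ler_addgt0Pr => e e0; have [n hn] := half_small c e0.
by have := H n; lra.
Qed.

(** The constant 4 is a factor 2 for the tail of the geometric series times a factor 2 for splitting
    into real and imaginary parts. *)
Lemma c_limit (u : nat -> C) (K : R) : (forall n, cn (u n.+1 - u n) <= K / 2 ^+ n) ->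
  exists l, forall n, cn (u n - l) <= 4 * K / 2 ^+ n.
Proof.
move=> H.
have G (v : nat -> R) : (forall n, `|v n.+1 - v n| <= K / 2 ^+ n) ->
    exists a, forall n, `|v n - a| <= 2 * K / 2 ^+ n.
  move=> Hv; have E n : K / 2 ^+ n = 2 * (K / 2 ^+ n.+1).
    by rewrite exprS; field; rewrite expf_neq0.
  (* Subtracting twice the bound on the increment makes the sequence nondecreasing, as
     [geometric_limit] requires. *)
  have [|a ha] := @geometric_limit _ (fun n => v n - 2 * (K / 2 ^+ n)) (4 * K).
    move=> n; have := Hv n; rewrite ler_norml -mulrA E; clear.
    by set t := K / _ => /andP[h1 h2]; lra.
  exists a => n; have := ha n; rewrite -!mulrA ler_norml; clear.
  by set t := K / _ => /andP[h1 h2]; lra.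
have [|a ha] := G (fun n => complex.Re (u n)).
  by move=> n; apply: le_trans (H n); rewrite -raddfB ge_Re_cn.
have [|b hb] := G (fun n => complex.Im (u n)).
  by move=> n; apply: le_trans (H n); rewrite -raddfB ge_Im_cn.
exists (Complex a b) => n; apply: le_trans (le_cn_ReIm _) _.
rewrite !raddfB /=; have := ha n; have := hb n; rewrite -!mulrA; clear.
by set t := K / _; lra.
Qed.

(** Rescaling by r/3 carries the radius 3 of [taylor_unit] to r and its range 1/2 to r/6. The
    constant [K0] is independent of r and f. *)
Lemma taylor_disc : exists K0 : R, 0 < K0 /\ forall (r : R) f M, 0 < r ->
  (forall z, cn z < r -> exists l, cd f z l) ->
  (forall z, cn z < r -> cn (f z) <= M) ->
  exists a : nat -> C, forall n z, cn z <= r / 6 ->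
    cn (f z - \sum_(k < n) a k * z ^+ k) <= K0 * M * (3 * cn z / r) ^+ n.
Proof.
have [K0 [K00 H]] := taylor_unit R; exists K0; split=> // r f M r0 df HM.
pose s : C := (r / 3)%:C%C.
have cs : cn s = r / 3 by rewrite cnRp// ltW// divr_gt0.
have s0 : s != 0 by rewrite -cn_gt0 cs divr_gt0.
have sc z : cn z < 3 -> cn (s * z) < r.
  by move=> h; rewrite cnM cs mulrAC ltr_pdivrMr// ltr_pM2l.
have [||a ha] := H (fun z => f (s * z)) M.
- move=> z /sc /df [l hl]; exists (s * l).
  move=> e e0; have c0 : 0 < cn s by rewrite cn_gt0.
  have [d d0 hd] := hl _ (divr_gt0 e0 c0).
  exists (d / cn s); first by rewrite divr_gt0.
  move=> h; rewrite ltr_pdivlMr// => hh.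
  have := hd (s * h); rewrite cnM mulrC => /(_ hh).
  have -> : e / cn s * (cn h * cn s) = e * cn h by field; rewrite gt_eqF.
  have -> : s * h * l = h * (s * l) by ring.
  by rewrite (mulrDr s z h).
- by move=> z /sc /HM.
exists (fun k => a k / s ^+ k) => n z hz.
have := ha n (z / s); rewrite mulrCA mulfV// mulr1 cnM cnV cs.
have -> : cn z * (r / 3)^-1 = 3 * cn z / r by field; rewrite gt_eqF.
rewrite (eq_bigr (fun k : 'I_n => a k / s ^+ k * z ^+ k)); last first.
  by move=> k _; rewrite expr_div_n; field; rewrite expf_neq0.
apply; rewrite ler_pdivrMr//; lra.
Qed.

Lemma cd_coef (f : C -> C) l b (s B : R) : 0 < s -> 0 <= B -> cd f 0 l ->
  (forall z, cn z <= s -> cn (f z - f 0 - b * z) <= B * cn z ^+ 2) -> l = b.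
Proof.
move=> s0 B0 fl H; apply/eqP; rewrite -subr_eq0; apply/eqP.
apply: (@cn_small_eq0 R _ 2) => e e0; have [d d0 hd] := fl _ e0.
pose t := Num.min (d / 2) (Num.min s (e / (B + 1))).
have t0 : 0 < t by rewrite !lt_min s0 !divr_gt0//; lra.
have : t <= t by [].
rewrite {2}/t !le_min => /and3P[t1 t2 t3].
have ct : cn (t%:C%C) = t by rewrite cnRp// ltW.
have h1 : cn (f t%:C%C - f 0 - t%:C%C * l) <= e * t.
  have := hd (t%:C%C); rewrite ct add0r; apply; clear -t1 d0; lra.
have h2 : cn (f t%:C%C - f 0 - b * t%:C%C) <= e * t.
  apply: le_trans (H _ _) _; rewrite ct// expr2 mulrA ler_pM2r//.
  apply: le_trans (_ : (B + 1) * (e / (B + 1)) <= _).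
    by apply: ler_pM => //; lra.
  by rewrite mulrCA mulfV ?mulr1// gt_eqF//; lra.
have : cn ((l - b) * t%:C%C) <= 2 * e * t.
  have -> : (l - b) * t%:C%C = (f t%:C%C - f 0 - b * t%:C%C) - (f t%:C%C - f 0 - t%:C%C * l).
    by ring.
  by apply: le_trans (cnB _ _) _; clear -h1 h2; lra.
by rewrite cnM ct ler_pM2r.
Qed.

End Disc.

(** * Cauchy estimates and holomorphy of partial derivatives *)

Section Several.
Variable R : realType.
Local Notation C := R[i].
Local Notation cn := (@Normc.normc R).
Variable N : nat.
Local Notation pt := ('rV[C]_N).
Local Notation ptN := ('rV[C]_N : normedModType C).
Implicit Types (f g : pt -> C) (p q h : pt) (a b : 'I_N -> C).

Lemma fd_line f p h z a : fd f (p + z *: h) a ->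
  cd (fun t => f (p + t *: h)) z (lin a h).
Proof.
move=> H e e0; have k0 : 0 < vn h + 1 by have := vn_ge0 h; lra.
have [d d0 hd] := H _ (divr_gt0 e0 k0).
exists (d / (vn h + 1)); first by rewrite divr_gt0.
move=> t; rewrite ltr_pdivlMr// => ht.
have hv : vn (t *: h) <= cn t * (vn h + 1).
  by rewrite vnZ ler_wpM2l ?cn_ge0//; lra.
have := hd _ (le_lt_trans hv ht).
have -> : p + (z + t) *: h = p + z *: h + t *: h by rewrite scalerDl addrA.
have -> : lin a (t *: h) = t * lin a h by rewrite linearZ.
move=> /le_trans; apply.
apply: le_trans (_ : e / (vn h + 1) * (cn t * (vn h + 1)) <= _).
  by rewrite ler_wpM2l// divr_ge0// ltW.
by rewrite mulrCA divfK ?gt_eqF// mulrC.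
Qed.

Definition hol p (r : R) f := forall q, vn (q - p) < r -> holo_at f q.

Lemma hol_holo p r f : 0 < r -> hol p r f -> holo_at f p.
Proof. by move=> r0; apply; rewrite subrr vn0. Qed.

Lemma hol_sub p r q s f : hol p r f -> vn (q - p) + s <= r -> hol q s f.
Proof.
move=> H hs x hx; apply: H; rewrite -(subrK q x) -addrA.
by apply: le_lt_trans (vnD _ _) _; lra.
Qed.

Lemma quad_fd f p a (K d : R) : 0 < d ->
  (forall h, vn h < d -> cn (f (p + h) - f p - lin a h) <= K * vn h ^+ 2) -> fd f p a.
Proof.
move=> d0 H e e0; have K0 : 0 < `|K| + 1 by have := normr_ge0 K; lra.
exists (Num.min d (e / (`|K| + 1))); first by rewrite lt_min d0 divr_gt0.
move=> h; rewrite lt_min => /andP[/H h1]; rewrite ltr_pdivlMr// => h2.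
apply: le_trans h1 _; rewrite expr2 mulrA ler_wpM2r ?vn_ge0//.
apply: le_trans (ltW h2); rewrite mulrC ler_wpM2l ?vn_ge0//.
by have := ler_norm K; lra.
Qed.

Lemma fd_bounded f p a : fd f p a ->
  exists2 d, 0 < d & exists2 M, 0 <= M & forall q, vn (q - p) < d -> cn (f q) <= M.
Proof.
move=> /(_ _ ltr01) [d d0 hd]; exists (Num.min 1 d); first by rewrite lt_min ltr01.
exists (cn (f p) + 1 + \sum_i cn (a i)).
  by rewrite !addr_ge0 ?cn_ge0// sumr_ge0// => i _; exact: cn_ge0.
move=> q; rewrite lt_min => /andP[q1 /hd]; rewrite (addrC p) subrK mul1r => h.
have := lin_le a (q - p) => h2.
have -> : f q = (f q - f p - lin a (q - p)) + lin a (q - p) + f p by ring.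
have h3 : cn (lin a (q - p)) <= \sum_i cn (a i).
  apply: le_trans h2 _; rewrite -[leRHS]mulr1; apply: ler_wpM2l; last exact: ltW.
  by rewrite sumr_ge0// => i _; exact: cn_ge0.
apply: le_trans (cnD _ _) _.
apply: le_trans (lerD (cnD _ _) (lexx _)) _.
by move: h h3 q1; clear; set x := cn _; set y := cn _; set S := \sum_(i < N) _; lra.
Qed.

Definition cauchy_est (K : R) f p (r M : R) :=
  [/\ forall h, vn h <= r / 6 ->
        cn (f (p + h) - f p - lin (fun i => pd f i p) h) <= K * M * (vn h / r) ^+ 2,
      forall h, vn h <= r / 6 -> cn (f (p + h) - f p) <= K * M * (vn h / r) &
      forall i, cn (pd f i p) <= K * M / r].

(** The function is restricted to the complex line through [p] in the direction [h], on a disc of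
    radius r / |h|, and [taylor_disc] is read at parameter 1. The 9 is the square of the 3 in its
    remainder. One [K] for all functions is what allows passing to limits in [pd_holo]. *)
Lemma cauchy_estimates : exists K : R, 0 < K /\ forall f p (r M : R), 0 < r -> hol p r f ->
  (forall q, vn (q - p) < r -> cn (f q) <= M) -> cauchy_est K f p r M.
Proof.
have [K0 [K00 H]] := taylor_disc R; exists (9 * K0); split; first lra.
move=> f p r M r0 df HM.
have M0 : 0 <= M by apply: le_trans (HM p _); rewrite ?cn_ge0// subrr vn0.
have E h : vn h <= r / 6 ->
   cn (f (p + h) - f p - lin (fun i => pd f i p) h) <= 9 * K0 * M * (vn h / r) ^+ 2 /\
   cn (f (p + h) - f p) <= 3 * K0 * M * (vn h / r).
  move=> hr; have [h0|hn0] := eqVneq (vn h) 0.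
    by rewrite (vn_eq0 h0) addr0 subrr linear0 subr0 cn0 vn0 mul0r expr0n !mulr0.
  have hp : 0 < vn h by rewrite lt_neqAle eq_sym hn0 vn_ge0.
  pose s := r / vn h; have s0 : 0 < s by rewrite divr_gt0.
  have ball z : cn z < s -> vn (p + z *: h - p) < r.
    by rewrite addrC addKr vnZ ltr_pdivlMr.
  have [||a ha] := H s (fun t => f (p + t *: h)) M s0.
  - by move=> z /ball /df /holo_fd /fd_line h1; eexists; exact: h1.
  - by move=> z /ball /HM.
  have s6 : 1 <= s / 6.
    rewrite /s mulrAC ler_pdivlMr// mul1r //.
  have a0 : a 0%N = f p.
    have := ha 1%N 0; rewrite cn0 big_ord1 expr0 mulr1 scale0r addr0 mulr0 mul0r expr1 mulr0.
    move=> /(_ _) h1; apply/eqP; rewrite eq_sym -subr_eq0 -cn_eq0 eq_le cn_ge0 andbT.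
    by apply: h1; rewrite divr_ge0// ltW.
  have B0 : 0 <= K0 * M * (9 / s ^+ 2).
    by rewrite !mulr_ge0// ?invr_ge0 ?exprn_ge0// ltW.
  (* The second order remainder identifies the first coefficient with the directional derivative. *)
  have a1 : lin (fun i => pd f i p) h = a 1%N.
    have := @cd_coef R (fun t => f (p + t *: h)) (lin (fun i => pd f i p) h) (a 1%N)
      (s / 6) _ _ B0 _ _; apply.
    - by rewrite divr_gt0.
    - apply: fd_line; rewrite scale0r addr0; apply: holo_fd.
      exact: hol_holo df.
    move=> z hz; have := ha 2%N z hz.
    rewrite big_ord_recr big_ord1 /= expr0 expr1 mulr1 scale0r addr0 a0.
    rewrite opprD addrA => /le_trans; apply.
    rewrite le_eqVlt; apply/orP; left; apply/eqP; field; rewrite ?(gt_eqF r0) ?(gt_eqF hp) ?(gt_eqF s0) //.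
  have ns : cn 1 <= s / 6 by rewrite cn1.
  have h1 := ha 1%N 1 ns; have h2 := ha 2%N 1 ns.
  rewrite big_ord1 expr0 mulr1 scale1r a0 cn1 mulr1 expr1 in h1.
  rewrite cn1 big_ord_recr big_ord1 /= expr0 expr1 !mulr1 scale1r a0 -a1 opprD addrA in h2.
  have Es : 3 / s = 3 * (vn h / r) by rewrite /s; field; rewrite !gt_eqF.
  rewrite Es in h1 h2; split.
    by apply: le_trans h2 _; rewrite exprMn le_eqVlt; apply/orP; left; apply/eqP; clear; ring.
  by apply: le_trans h1 _; rewrite le_eqVlt; apply/orP; left; apply/eqP; clear; ring.
have KM : 0 <= K0 * M by rewrite mulr_ge0// ltW.
split.
- by move=> h /E [].
- move=> h hr; have [_ /le_trans] := E h hr; apply.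
  apply: ler_wpM2r; first by rewrite divr_ge0 ?vn_ge0// ltW.
  by rewrite -!(mulrA _ K0 M); clear -KM; lra.
(* At |h| = r/6 both estimates together bound r/6 times the partial derivative by (9/36 + 3/6) K0 M,
   whence 9/2 K0 M / r for the derivative itself. *)
- move=> i; pose h : pt := (r / 6)%:C%C *: delta_mx 0 i.
  have r6 : 0 <= r / 6 by rewrite divr_ge0// ltW.
  have vh : vn h = r / 6 by rewrite vnZ vn_delta mulr1 cnRp.
  have [] := E h; first by rewrite vh.
  have -> : lin (fun i => pd f i p) h = (r / 6)%:C%C * pd f i p.
    by rewrite linearZ /= lin_delta.
  set x := f (p + h) - f p; set y := (r / 6)%:C%C * _ => h1 h2.
  have : cn y <= 9 * K0 * M * (vn h / r) ^+ 2 + 3 * K0 * M * (vn h / r).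
    have -> : y = x - (x - y) by ring.
    by apply: le_trans (cnB _ _) _; clear -h1 h2; lra.
  have -> : vn h / r = 6^-1 by rewrite vh; field; rewrite gt_eqF.
  rewrite cnM cnRp// => h3; rewrite ler_pdivlMr//.
  move: h3; set u := cn (pd f i p) => h3.
  have -> : u * r = 6 * (r / 6 * u) by field.
  apply: le_trans (ler_wpM2l _ h3) _ => //.
  have -> : 9 * K0 * M = 9 * (K0 * M) by ring.
  have -> : 3 * K0 * M = 3 * (K0 * M) by ring.
  by clear -KM; move: (K0 * M) KM => t KM; rewrite expr2; lra.
Qed.

Lemma fd_cst c p : fd (fun=> c) p (fun=> 0).
Proof.
apply: (@quad_fd _ _ _ 0 1) => // h _.
by rewrite /lin big1 ?mul0r ?subrr ?subr0 ?cn0// => i _; rewrite mulr0.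
Qed.

Lemma fdD f g p a b : fd f p a -> fd g p b -> fd (fun q => f q + g q) p (fun i => a i + b i).
Proof.
move=> H1 H2 e e0; have e2 : 0 < e / 2 by lra.
have [d1 d10 h1] := H1 _ e2; have [d2 d20 h2] := H2 _ e2.
exists (Num.min d1 d2); first by rewrite lt_min d10.
move=> h; rewrite lt_min => /andP[/h1 A /h2 B].
have -> : f (p + h) + g (p + h) - (f p + g p) - lin (fun i => a i + b i) h =
  (f (p + h) - f p - lin a h) + (g (p + h) - g p - lin b h).
  rewrite (_ : lin (fun i => a i + b i) h = lin a h + lin b h); first by ring.
  by rewrite /lin -big_split; apply: eq_bigr => i _; rewrite mulrDr.
by apply: le_trans (cnD _ _) _; clear -A B; lra.
Qed.

Lemma fdM f g p a b : fd f p a -> fd g p b ->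
  fd (fun q => f q * g q) p (fun i => a i * g p + f p * b i).
Proof.
move=> H1 H2; have [hf pf] := fd_holo H1; have [hg pg] := fd_holo H2.
have hfg : holo_at (fun q => f q * g q) p := @differentiableM C ptN f g p hf hg.
suff -> : (fun i => a i * g p + f p * b i) = fun i => pd (fun q => f q * g q) i p.
  exact: holo_fd.
apply/funext => i; rewrite -pf -pg.
have hf' : derivable (f : ptN -> C^o) (p : ptN) (delta_mx 0 i) by exact: diff_derivable.
have hg' : derivable (g : ptN -> C^o) (p : ptN) (delta_mx 0 i) by exact: diff_derivable.
have E := @deriveM C ptN f g p _ hf' hg'.
by apply: etrans (esym E); rewrite addrC [X in _ + X = _]mulrC.
Qed.

Lemma fd_coord i p : fd (fun q => q 0 i) p (fun j => (i == j)%:R).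
Proof.
apply: (@quad_fd _ _ _ 0 1) => // h _.
rewrite /lin (bigD1 i)//= eqxx mulr1 big1 ?addr0; last first.
  by move=> j ji; rewrite eq_sym (negPf ji) mulr0.
by rewrite mxE (addrC (p 0 i)) addrK subrr cn0 mul0r.
Qed.

Lemma fdZ c f p a : fd f p a -> fd (fun q => c * f q) p (fun i => c * a i).
Proof.
move=> H; have := fdM (fd_cst c p) H.
by rewrite (_ : (fun i => 0 * f p + c * a i) = fun i => c * a i)//; apply/funext => i; rewrite mul0r add0r.
Qed.

Lemma fd_sum (I : Type) (s : seq I) (F : I -> pt -> C) (A : I -> 'I_N -> C) p :
  (forall k, fd (F k) p (A k)) ->
  fd (fun q => \sum_(k <- s) F k q) p (fun i => \sum_(k <- s) A k i).
Proof.
move=> H; elim: s => [|k s IH].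
  rewrite (_ : (fun q => _) = fun=> 0); last by apply/funext => q; rewrite big_nil.
  by rewrite (_ : (fun i => _) = fun=> 0); [exact: fd_cst|apply/funext => q; rewrite big_nil].
rewrite (_ : (fun q => _) = fun q => F k q + \sum_(k <- s) F k q); last first.
  by apply/funext => q; rewrite big_cons.
rewrite (_ : (fun i => _) = fun i => A k i + \sum_(k <- s) A k i); last first.
  by apply/funext => q; rewrite big_cons.
exact: fdD.
Qed.

Lemma fd_trans f v p a : fd f (p + v) a -> fd (fun q => f (q + v)) p a.
Proof. by move=> H e /H [d d0 hd]; exists d => // h /hd; rewrite (addrAC p). Qed.

Lemma fd_near f g p a (d : R) : 0 < d -> (forall q, vn (q - p) < d -> f q = g q) ->
  fd f p a -> fd g p a.
Proof.
move=> d0 fg H e /H [d' d'0 hd]; exists (Num.min d d'); first by rewrite lt_min d0.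
move=> h; rewrite lt_min => /andP[h1 /hd].
by rewrite !fg// ?subrr ?vn0// (addrC p) addrK.
Qed.

Lemma vn_incr (psi : pt -> pt) p (b : 'I_N -> 'I_N -> C) :
  (forall k, fd (fun q => psi q 0 k) p (b k)) ->
  exists2 d, 0 < d & exists2 B, 0 < B &
    forall h, vn h < d -> vn (psi (p + h) - psi p) <= B * vn h.
Proof.
move=> H.
have H' k := H k 1 ltr01.
have {}H' k : exists d, 0 < d /\ forall h, vn h < d ->
   cn (psi (p + h) 0 k - psi p 0 k - lin (b k) h) <= 1 * vn h.
  by have [d d0 hd] := H' k; exists d.
have /choice [d hd] := H'.
have [e e0 he] : exists2 e, 0 < e & forall k, e <= d k.
  exists (\big[Num.min/1]_k d k); first by rewrite lt_bigmin// => k _; have [] := hd k.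
  by move=> k; exact: bigmin_le_cond.
exists e => //; exists (1 + \sum_k (1 + \sum_i cn (b k i))).
  rewrite ltr_wpDr// sumr_ge0// => k _; rewrite addr_ge0// sumr_ge0// => i _.
  exact: cn_ge0.
move=> h hh; apply: le_trans (_ : (\sum_k (1 + \sum_i cn (b k i))) * vn h <= _); last first.
  by rewrite ler_wpM2r ?vn_ge0// lerDr.
rewrite mulr_suml /vn ler_sum// => k _; rewrite !mxE.
have [_ /(_ h (lt_le_trans hh (he k)))] := hd k; rewrite mul1r => h1.
have := lin_le (b k) h; rewrite mulrDl mul1r => h2.
rewrite -(subrK (lin (b k) h) (_ - _)).
by apply: le_trans (cnD _ _) _; apply: lerD.
Qed.

Lemma fd_comp f (psi : pt -> pt) p a (b : 'I_N -> 'I_N -> C) :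
  fd f (psi p) a -> (forall k, fd (fun q => psi q 0 k) p (b k)) ->
  fd (fun q => f (psi q)) p (fun i => \sum_k b k i * a k).
Proof.
move=> Hf Hp.
have [d1 d10 [B B0 hB]] := vn_incr Hp.
have Hl : fd (fun q => \sum_k psi q 0 k * a k) p (fun i => \sum_k b k i * a k).
  apply: fd_sum => k; have := fdM (Hp k) (fd_cst (a k) p).
  rewrite (_ : (fun i => _ + _) = fun i => b k i * a k)//.
  by apply/funext => i; rewrite mulr0 addr0.
move=> e e0; have e2 : 0 < e / 2 by lra.
have [d2 d20 h2] := Hl _ e2.
have e3 : 0 < e / 2 / B by rewrite divr_gt0.
have [d3 d30 h3] := Hf _ e3.
exists (Num.min d1 (Num.min d2 (d3 / B))); first by rewrite !lt_min d10 d20 divr_gt0.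
move=> h; rewrite !lt_min => /and3P[/hB A1 /h2 A2]; rewrite ltr_pdivlMr// mulrC => A3.
have := h3 _ (le_lt_trans A1 A3); rewrite (addrC (psi p)) subrK => A4.
have -> : f (psi (p + h)) - f (psi p) - lin (fun i => \sum_k b k i * a k) h =
  (f (psi (p + h)) - f (psi p) - lin a (psi (p + h) - psi p)) +
  (\sum_k psi (p + h) 0 k * a k - \sum_k psi p 0 k * a k - lin (fun i => \sum_k b k i * a k) h).
  have -> : lin a (psi (p + h) - psi p) = lin a (psi (p + h)) - lin a (psi p) by rewrite linearB.
  rewrite -[\sum_k psi (p + h) 0 k * a k]/(lin a (psi (p + h))) -[\sum_k psi p 0 k * a k]/(lin a (psi p)).
  by ring.
apply: le_trans (cnD _ _) _.
have : e / 2 / B * vn (psi (p + h) - psi p) <= e / 2 * vn h.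
  by apply: le_trans (ler_wpM2l (ltW e3) A1) _; rewrite mulrA divfK ?gt_eqF.
by move=> A5; have := le_trans A4 A5; clear -A2; lra.
Qed.

(** The difference quotients [F t] converge to the partial derivative uniformly near [p], with error
    of order t. Cauchy estimates applied to [F (t n.+1) - F (t n)] make their differentials at [p]
    converge to some [l], and their quadratic remainders, bounded uniformly in n, pass to the limit;
    so [l] is the differential of the partial derivative. *)
Lemma pd_holo f p (r0 : R) i : 0 < r0 -> hol p r0 f -> holo_at (pd f i) p.
Proof.
move=> r0' df'.
have [d d0 [M M0 HM]] := fd_bounded (holo_fd (hol_holo r0' df')).
have [r [rp df {}HM]] : exists r : R, [/\ 0 < r, hol p r f &
    forall q, vn (q - p) < r -> cn (f q) <= M].
  exists (Num.min d r0); split; first by rewrite lt_min d0.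
    by move=> q; rewrite lt_min => /andP[_ /df'].
  by move=> q; rewrite lt_min => /andP[/HM].
have [K [K0 HK]] := cauchy_estimates.
have r2 : 0 < r / 2 by rewrite divr_gt0.
have est q : vn (q - p) < r / 2 -> cauchy_est K f q (r / 2) M.
  move=> hq; apply: HK => //; first by apply: hol_sub df _; lra.
  by move=> x hx; apply: HM; rewrite -(subrK q x) -addrA; apply: le_lt_trans (vnD _ _) _; lra.
pose D : pt := delta_mx 0 i.
pose F (t : C) q := t^-1 * (f (q + t *: D) - f q).
pose b (t : C) j := t^-1 * (pd f j (p + t *: D) - pd f j p).
have inb (t : C) q : cn t <= r / 12 -> vn (q - p) < r / 2 -> vn (q + t *: D - p) < r.
  move=> ht hq; rewrite addrAC; apply: le_lt_trans (vnD _ _) _.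
  by rewrite vnZ vn_delta mulr1; clear -ht hq rp; lra.
have fdF t q : cn t <= r / 12 -> vn (q - p) < r / 2 ->
   fd (F t) q (fun j => t^-1 * (pd f j (q + t *: D) + -1 * pd f j q)).
  move=> ht hq; rewrite /F.
  rewrite (_ : (fun q => _) = (fun q => t^-1 * (f (q + t *: D) + -1 * f q))).
    apply/fdZ/fdD; last apply/fdZ; first apply: fd_trans; apply: holo_fd; apply: df.
      exact: inb.
    by clear -hq rp; lra.
  by apply/funext => x; rewrite mulN1r.
have HF t : cn t <= r / 12 -> hol p (r / 2) (F t).
  by move=> ht q hq; have [] := fd_holo (fdF t q ht hq).
have pdF t j : cn t <= r / 12 -> pd (F t) j p = b t j.
  move=> ht; have [|_ ->] := fd_holo (fdF t p ht _); first by rewrite subrr vn0.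
  by rewrite mulN1r.
(* The second order Cauchy estimate at radius r/2, divided by t. *)
pose E := K * M * 4 / r ^+ 2.
have E0 : 0 <= E by rewrite /E divr_ge0 ?mulr_ge0 ?exprn_ge0// ltW.
have FE t q : t != 0 -> cn t <= r / 12 -> vn (q - p) < r / 2 ->
    cn (F t q - pd f i q) <= E * cn t.
  move=> t0 ht hq; have [h1 _ _] := est q hq.
  have vt : vn (t *: D) = cn t by rewrite vnZ vn_delta mulr1.
  have := h1 (t *: D); rewrite vt linearZ /= lin_delta.
  have t6 : cn t <= r / 2 / 6 by clear -ht; lra.
  move=> /(_ t6) H.
  have -> : F t q - pd f i q = t^-1 * (f (q + t *: D) - f q - t * pd f i q).
    by rewrite /F; field.
  rewrite cnM cnV mulrC ler_pdivrMr ?cn_gt0//; apply: le_trans H _.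
  rewrite /E le_eqVlt; apply/orP; left; apply/eqP; field; rewrite ?(gt_eqF rp) //.
have FM t q : t != 0 -> cn t <= r / 12 -> vn (q - p) < r / 2 ->
    cn (F t q) <= 2 * K * M / r.
  move=> t0 ht hq; have [_ h1 _] := est q hq.
  have vt : vn (t *: D) = cn t by rewrite vnZ vn_delta mulr1.
  have := h1 (t *: D); rewrite vt.
  have t6 : cn t <= r / 2 / 6 by clear -ht; lra.
  move=> /(_ t6) H.
  rewrite cnM cnV mulrC ler_pdivrMr ?cn_gt0//; apply: le_trans H _.
  rewrite le_eqVlt; apply/orP; left; apply/eqP; field; rewrite ?(gt_eqF rp) //.
(* Every step stays below r/12, a sixth of the radius r/2, which is the range of the Cauchy
   estimates. *)
pose t n : C := (r / 12 / 2 ^+ n)%:C%C.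
have ct n : cn (t n) = r / 12 / 2 ^+ n.
  by rewrite cnRp// !divr_ge0 ?exprn_ge0// ltW.
have t0 n : t n != 0 by rewrite -cn_gt0 ct !divr_gt0 ?exprn_gt0.
have tr n : cn (t n) <= r / 12.
  rewrite ct ler_pdivrMr ?exprn_gt0//; apply: ler_peMr; first by rewrite divr_ge0// ltW.
  by rewrite exprn_ege1// ler1n.
pose K2 := K * (E * (r / 6)) / (r / 2).
have bC j n : cn (b (t n.+1) j - b (t n) j) <= K2 / 2 ^+ n.
  pose G q := F (t n.+1) q + -1 * F (t n) q.
  have fG q : vn (q - p) < r / 2 -> holo_at G q.
    by move=> hq; have [] := fd_holo (fdD (fdF _ q (tr n.+1) hq) (fdZ (-1) (fdF _ q (tr n) hq))).
  have [_ _ h3] : cauchy_est K G p (r / 2) (E * (r / 6) / 2 ^+ n).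
    apply: HK; [exact: r2|exact: fG|move=> q hq].
    have -> : G q = (F (t n.+1) q - pd f i q) - (F (t n) q - pd f i q).
      by rewrite /G mulN1r; move: (F _ _) (F _ _) (pd f i q) => u v w; clear; ring.
    apply: le_trans (cnB _ _) _.
    apply: le_trans (lerD (FE _ _ (t0 n.+1) (tr n.+1) hq) (FE _ _ (t0 n) (tr n) hq)) _.
    have w0 : 0 <= r / 12 / 2 ^+ n by rewrite -ct cn_ge0.
    rewrite !ct; move: w0; set w := r / 12 / 2 ^+ n => w0.
    have -> : r / 12 / 2 ^+ n.+1 = w / 2.
      by rewrite exprS /w; field; rewrite expf_neq0.
    have -> : E * (r / 6) / 2 ^+ n = E * (2 * w) by rewrite /w; field; rewrite expf_neq0.
    by rewrite -mulrDr; apply: ler_wpM2l => //; clear -w0; lra.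
  have pp : vn (p - p) < r / 2 by rewrite subrr vn0.
  have := h3 j.
  have [_ ->] := fd_holo (fdD (fdF _ p (tr n.+1) pp) (fdZ (-1) (fdF _ p (tr n) pp))).
  have -> : (t n.+1)^-1 * (pd f j (p + t n.+1 *: D) + -1 * pd f j p) +
     -1 * ((t n)^-1 * (pd f j (p + t n *: D) + -1 * pd f j p)) = b (t n.+1) j - b (t n) j.
    rewrite /b; move: (pd f j (p + t n.+1 *: D)) (pd f j (p + t n *: D)) (pd f j p).
    by move: ((t n.+1)^-1) ((t n)^-1) => u v x y z; clear; ring.
  by rewrite /K2 mulrA mulrAC.
have /choice [l hl] : forall j, exists l, forall n, cn (b (t n) j - l) <= 4 * K2 / 2 ^+ n.
  by move=> j; apply: c_limit => n; exact: bC.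
suff H : fd (pd f i) p l by have [] := fd_holo H.
(* The constant is the second order estimate for [F (t n)] at radius r/2, with the bound of [FM]; it
   does not involve n. *)
apply: (@quad_fd _ _ _ (K * (2 * K * M / r) / (r / 2) ^+ 2) (r / 12)); first by rewrite divr_gt0.
move=> h hh.
apply: (@le_limit _ _ _ (2 * E * (r / 12) + (\sum_(j < N) 4 * K2) * vn h)) => n.
have [h1 _ _] : cauchy_est K (F (t n)) p (r / 2) (2 * K * M / r).
  by apply: HK; [exact: r2|exact: HF|move=> q; exact: FM].
have := h1 h; rewrite (_ : (fun i => pd (F (t n)) i p) = b (t n)); last first.
  by apply/funext => j; exact: pdF.
have hq1 : vn (p + h - p) < r / 2 by rewrite addrC addKr; clear -hh rp; lra.
have hq2 : vn (p - p) < r / 2 by rewrite subrr vn0.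
have h6 : vn h <= r / 2 / 6 by clear -hh; lra.
move=> /(_ h6) A1.
have A2 := FE _ _ (t0 n) (tr n) hq1; have A3 := FE _ _ (t0 n) (tr n) hq2.
have A4 : cn (lin (b (t n)) h - lin l h) <= (\sum_(j < N) 4 * K2) * vn h / 2 ^+ n.
  rewrite /lin -sumrB; apply: le_trans (cn_sum _ _ _) _.
  rewrite -mulrA mulr_suml ler_sum// => j _.
  rewrite -mulrBr cnM [leRHS]mulrCA.
  by apply: ler_pM; [exact: cn_ge0|exact: cn_ge0|exact: cn_le_vn|exact: hl].
have -> : pd f i (p + h) - pd f i p - lin l h =
  (F (t n) (p + h) - F (t n) p - lin (b (t n)) h) - (F (t n) (p + h) - pd f i (p + h))
   + (F (t n) p - pd f i p) + (lin (b (t n)) h - lin l h).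
  move: (F (t n) (p + h)) (F (t n) p) (pd f i (p + h)) (pd f i p) (lin (b (t n)) h) (lin l h).
  by clear => x1 x2 x3 x4 x5 x6; ring.
apply: le_trans (cnD _ _) _; apply: le_trans (lerD (cnD _ _) (lexx _)) _.
apply: le_trans (lerD (lerD (cnB _ _) (lexx _)) (lexx _)) _.
rewrite ct in A2 A3; have comb (x1 x2 x3 x4 x y z : R) :
    x1 <= x -> x2 <= y -> x3 <= y -> x4 <= z -> x1 + x2 + x3 + x4 <= x + (2 * y + z).
  by clear; lra.
apply: le_trans (comb _ _ _ _ _ _ _ A1 A2 A3 A4) _.
rewrite le_eqVlt; apply/orP; left; apply/eqP.
congr (_ + _).
  by rewrite (expr_div_n (vn h)) [LHS]mulrA [RHS]mulrAC.
by rewrite [RHS]mulrDl; congr (_ + _); rewrite !mulrA.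
Qed.

Lemma hol_pd f p (r : R) i : hol p r f -> hol p r (pd f i).
Proof.
move=> df q hq; apply: (@pd_holo _ _ (r - vn (q - p))); first by rewrite subr_gt0.
by apply: hol_sub df _; rewrite addrC subrK.
Qed.

End Several.

(** * Symmetry of second derivatives and the inverse function theorem *)

Section Inverse.
Variable R : realType.
Local Notation C := R[i].
Local Notation cn := (@Normc.normc R).
Variable N : nat.
Local Notation pt := ('rV[C]_N).
Implicit Types (f g : pt -> C) (p q h : pt) (a b : 'I_N -> C).

Lemma add1K (V : zmodType) (x y : V) : x + y - x = y.
Proof. by rewrite addrC addKr. Qed.

Lemma add2K (V : zmodType) (x y z : V) : x + y + z - x = y + z.
Proof. by rewrite -(addrA x) add1K. Qed.

Lemma fd_curve f q h (s : R) a : fd f (q + s%:C%C *: h) a ->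
  crderiv (fun s : R => f (q + s%:C%C *: h)) s (lin a h).
Proof.
move=> H; have h1 := fd_line H.
have := @cd_line R (fun z => f (q + z *: h)) 0 1 s (lin a h).
have E : (fun t : R => f (q + (0 + t%:C%C * 1) *: h)) = fun s : R => f (q + s%:C%C *: h).
  by apply/funext => u; rewrite mulr1 add0r.
by rewrite E mul1r mulr1 add0r; apply.
Qed.

(** The second difference [S] is symmetric in its two increments and, for increments t along two
    axes, equals t^2 times the mixed derivative up to o(t^2), in either order of differentiation. *)
Lemma schwarz f p (r : R) i j : 0 < r -> hol p r f ->
  pd (pd f j) i p = pd (pd f i) j p.
Proof.
move=> r0 df.
pose S (x y : pt) := f (p + x + y) - f (p + x) - (f (p + y) - f p).
have SC x y : S x y = S y x.
  rewrite /S (addrAC p x y); have E (a b c d : C) : a - b - (c - d) = a - c - (b - d) by ring.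
  exact: E.
pose Sf (k l : 'I_N) (t : R) := S (t%:C%C *: delta_mx 0 k) (t%:C%C *: delta_mx 0 l).
have SCf k l t : Sf k l t = Sf l k t by exact: SC.
pose Pd (k l : 'I_N) := pd (pd f k) l p.
have key (k l : 'I_N) e : 0 < e -> exists2 d, 0 < d & forall t : R, 0 < t < d ->
   cn (Sf k l t - t%:C%C * (t%:C%C * Pd k l)) <= 6 * e * t * t.
  move=> e0; have [d d0 hd] := holo_fd (pd_holo k r0 df) e0.
  exists (Num.min (d / 2) (r / 2)); first by rewrite lt_min !divr_gt0.
  move=> t /andP[t0]; rewrite lt_min => /andP[td tr].
  pose K : pt := delta_mx 0 k; pose L : pt := delta_mx 0 l.
  set c := pd (pd f k) l p.
  (* The increment of [G] over [0, t] is the second difference minus t^2 c. Its derivative [D] is a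
     first difference of [pd f k] minus its linear part, hence small by differentiability of
     [pd f k]. *)
  pose G (s : R) := f (p + t%:C%C *: L + s%:C%C *: K) +
      (- 1 * f (p + s%:C%C *: K) + (- (t%:C%C * c)) * s%:C%C).
  pose D (s : R) := pd f k (p + t%:C%C *: L + s%:C%C *: K) +
      (- 1 * pd f k (p + s%:C%C *: K) + (- (t%:C%C * c)) * 1).
  have vs (s : R) : 0 <= s <= t -> vn (s%:C%C *: K) <= t.
    by move=> /andP[s0 st]; rewrite vnZ vn_delta mulr1 cnRp.
  have vst (s : R) : 0 <= s <= t -> vn (t%:C%C *: L + s%:C%C *: K) <= 2 * t.
    move=> hs; apply: le_trans (vnD _ _) _; rewrite vnZ vn_delta mulr1 (cnRp (ltW t0)).
    by have := vs s hs; clear; lra.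
  have line q (s : R) : vn (q + s%:C%C *: K - p) < r ->
      crderiv (fun s : R => f (q + s%:C%C *: K)) s (pd f k (q + s%:C%C *: K)).
    move=> hq.
    by have := fd_curve (holo_fd (df _ hq)); rewrite lin_delta.
  (* The remainders at the two points contribute 2 e t and e t, as the first lies within 2 t of [p]
     and the second within t. *)
  have := @crderiv_le R G D (3 * e * t) 0 t (ltW t0).
  rewrite /G /D !scale0r !addr0 mulr0 addr0.
  have -> : f (p + t%:C%C *: L + t%:C%C *: K) + (-1 * f (p + t%:C%C *: K) + - (t%:C%C * c) * t%:C%C)
     - (f (p + t%:C%C *: L) + -1 * f p) =
    Sf k l t - t%:C%C * (t%:C%C * c).
    rewrite SCf /Sf /S.
    have E (x y z w u v : C) : x + (-1 * y + - (u * v) * u) - (z + -1 * w) =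
      x - z - (y - w) - u * (u * v) by ring.
    exact: E.
  rewrite subr0 (_ : 2 * (3 * e * t) * t = 6 * e * t * t); last by ring.
  apply=> s hs.
    have b1 : vn (p + t%:C%C *: L + s%:C%C *: K - p) < r.
      rewrite add2K.
      by apply: le_lt_trans (vst s hs) _; clear -tr; lra.
    have b2 : vn (p + s%:C%C *: K - p) < r.
      rewrite add1K.
      by apply: le_lt_trans (vs s hs) _; clear -tr r0; lra.
    apply: (crderivD (line _ _ b1)).
    apply: (crderivD (crderivZ (-1) (line _ _ b2))).
    apply: crderivZ => e' e'0; exists 1 => // h _.
    rewrite mulr1 (_ : (s + h)%:C%C - s%:C%C - h%:C%C = 0).
      by rewrite cn0 mulr_ge0// ltW.
    by rewrite rmorphD (addrC (s%:C%C)) addrK subrr.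
  have h1 := hd (t%:C%C *: L + s%:C%C *: K).
  have h2 := hd (s%:C%C *: K).
  have := vst s hs; have := vs s hs => v2 v1.
  have {}h1 := h1 (le_lt_trans v1 (_ : 2 * t < d)).
  have {}h2 := h2 (le_lt_trans v2 (_ : t < d)).
  have {}h1 : cn (pd f k (p + (t%:C%C *: L + s%:C%C *: K)) - pd f k p -
     lin (fun i => pd (pd f k) i p) (t%:C%C *: L + s%:C%C *: K)) <= e * (2 * t).
    apply: le_trans (h1 _) _; first by clear -td; lra.
    by rewrite ler_pM2l.
  have {}h2 : cn (pd f k (p + s%:C%C *: K) - pd f k p -
     lin (fun i => pd (pd f k) i p) (s%:C%C *: K)) <= e * t.
    apply: le_trans (h2 _) _; first by clear -td t0; lra.
    by rewrite ler_pM2l.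
  have E : lin (fun i => pd (pd f k) i p) (t%:C%C *: L + s%:C%C *: K) =
     t%:C%C * c + lin (fun i => pd (pd f k) i p) (s%:C%C *: K).
    by rewrite linearD linearZ /= lin_delta.
  rewrite E addrA in h1.
  have -> : pd f k (p + t%:C%C *: L + s%:C%C *: K) + (-1 * pd f k (p + s%:C%C *: K) + - (t%:C%C * c) * 1)
    = (pd f k (p + t%:C%C *: L + s%:C%C *: K) - pd f k p -
      (t%:C%C * c + lin (fun i => pd (pd f k) i p) (s%:C%C *: K))) -
      (pd f k (p + s%:C%C *: K) - pd f k p - lin (fun i => pd (pd f k) i p) (s%:C%C *: K)).
    have E2 (x y z w v : C) : x + (-1 * y + - v * 1) = (x - z - (v + w)) - (y - z - w) by ring.
    exact: E2.
  apply: le_trans (cnB _ _) _; apply: le_trans (lerD h1 h2) _.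
  by rewrite le_eqVlt; apply/orP; left; apply/eqP; ring.
change (Pd j i = Pd i j); clearbody Sf Pd.
apply/eqP; rewrite -subr_eq0; apply/eqP.
apply: (@cn_small_eq0 R _ 12) => e e0.
have [d1 d10 h1] := key j i e e0; have [d2 d20 h2] := key i j e e0.
pose t := Num.min d1 d2 / 2.
have m0 : 0 < Num.min d1 d2 by rewrite lt_min d10.
have t0 : 0 < t by rewrite divr_gt0.
have /andP[t1 t2] : (t < d1) && (t < d2) by rewrite -lt_min /t; clear -m0; lra.
have {}h1 := h1 t; have {}h2 := h2 t; rewrite t0 in h1 h2.
have {}h1 := h1 t1; have {}h2 := h2 t2.
have : cn (t%:C%C * (t%:C%C * (Pd j i - Pd i j))) <= 12 * e * t * t.
  move: h1 h2; rewrite (SCf j); move: (Sf _ _ _) (Pd j i) (Pd i j) => x u v h1 h2.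
  have -> : t%:C%C * (t%:C%C * (u - v)) =
    (x - t%:C%C * (t%:C%C * v)) - (x - t%:C%C * (t%:C%C * u)) by ring.
  by apply: le_trans (cnB _ _) _; apply: le_trans (lerD h2 h1) _; clear; lra.
by rewrite !cnZ (ger0_norm (ltW t0)) mulrA mulrC mulrA ler_pM2r// ler_pM2r.
Qed.

Definition mn (A : 'M[C]_N) : R := \sum_i \sum_j cn (A i j).

Lemma mn_ge0 A : 0 <= mn A.
Proof. by apply: sumr_ge0 => i _; apply: sumr_ge0 => j _; exact: cn_ge0. Qed.

Lemma vn_mul (h : pt) (A : 'M[C]_N) : vn (h *m A) <= mn A * vn h.
Proof.
rewrite /vn (eq_bigr (fun k => cn (\sum_i h 0 i * A i k))); last by move=> k _; rewrite mxE.
apply: le_trans (_ : \sum_k \sum_i cn (A i k) * vn h <= _).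
  apply: ler_sum => k _; apply: le_trans (cn_sum _ _ _) _; apply: ler_sum => i _.
  by rewrite cnM mulrC ler_wpM2l ?cn_ge0// cn_le_vn.
by rewrite exchange_big /mn mulr_suml ler_sum// => i _; rewrite mulr_suml.
Qed.

Lemma fd_cont f p a e : fd f p a -> 0 < e ->
  exists2 d, 0 < d & forall q, vn (q - p) < d -> cn (f q - f p) < e.
Proof.
move=> /(_ _ ltr01) [d d0 hd] e0; pose A := 1 + \sum_i cn (a i).
have A0 : 0 < A by rewrite ltr_wpDr// sumr_ge0// => i _; exact: cn_ge0.
exists (Num.min d (e / A)); first by rewrite lt_min d0 divr_gt0.
move=> q; rewrite lt_min => /andP[/hd]; rewrite (addrC p) subrK => h1.
rewrite ltr_pdivlMr// mulrC => h2; apply: le_lt_trans h2.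
rewrite -(subrK (lin a (q - p)) (f q - f p)); apply: le_trans (cnD _ _) _.
by rewrite mulrDl; apply: lerD => //; exact: lin_le.
Qed.

Lemma ler_big_const (F : 'I_N -> R) (c : R) : (forall i, F i <= c) ->
  \sum_i F i <= N%:R * c.
Proof.
move=> H; apply: le_trans (ler_sum _ (fun i _ => H i)) _.
by rewrite sumr_const card_ord mulr_natl.
Qed.

Lemma small_lip (W : pt -> pt) (r : R) : 0 < r ->
  (forall k, hol 0 r (fun q => W q 0 k)) ->
  (forall i k, pd (fun q => W q 0 k) i 0 = 0) ->
  exists2 s, 0 < s < r & forall p q, vn p <= s -> vn q <= s ->
    vn (W p - W q) <= 2^-1 * vn (p - q).
Proof.
move=> r0 hW W0.
(* The mean value inequality costs 2 and the sums over [i] and over [k] cost N each, so 2 N^2 e must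
   be at most 1/2. *)
pose e : R := (4 * N.+1%:R ^+ 2)^-1.
have e0 : 0 < e by rewrite invr_gt0 mulr_gt0// exprn_gt0// ltr0n.
have : forall ik : 'I_N * 'I_N, exists d, 0 < d /\ forall q, vn q < d ->
    cn (pd (fun q => W q 0 ik.2) ik.1 q) < e.
  move=> [i k]; have [d d0 hd] := fd_cont (holo_fd (pd_holo i r0 (hW k))) e0.
  by exists d; split=> // q hq; have := hd q; rewrite subr0 W0 subr0; apply.
move=> /choice [d hd].
have [m m0 hm] : exists2 m, 0 < m & forall ik, m <= d ik.
  exists (\big[Num.min/1]_ik d ik); first by rewrite lt_bigmin// => k _; have [] := hd k.
  by move=> k; exact: bigmin_le_cond.
pose s := Num.min m r / 2.
have mr : 0 < Num.min m r by rewrite lt_min m0.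
have s0 : 0 < s by rewrite divr_gt0.
have /andP[sm sr] : (s < m) && (s < r) by rewrite -lt_min /s; clear -mr; lra.
exists s; first by rewrite s0.
move=> p q hp hq.
have seg (t : R) : 0 <= t <= 1 -> vn (q + t%:C%C *: (p - q)) <= s.
  move=> /andP[t0 t1].
  have -> : q + t%:C%C *: (p - q) = (1 - t)%:C%C *: q + t%:C%C *: p.
    by rewrite rmorphB scalerBl scalerBr rmorph1 scale1r addrA addrAC.
  apply: le_trans (vnD _ _) _; rewrite !vnZ !cnRp ?subr_ge0//.
  have t1' : 0 <= 1 - t by rewrite subr_ge0.
  have := ler_wpM2l t0 hp; have := ler_wpM2l t1' hq.
  by clear; set x := _ * vn q; set y := _ * vn p; lra.
have Wk k : cn (W p 0 k - W q 0 k) <= 2 * (N%:R * e * vn (p - q)).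
  have := @crderiv_le R (fun t : R => W (q + t%:C%C *: (p - q)) 0 k)
    (fun t => lin (fun i => pd (fun q => W q 0 k) i (q + t%:C%C *: (p - q))) (p - q))
    (N%:R * e * vn (p - q)) 0 1 ler01.
  rewrite scale1r scale0r addr0 (addrC q) subrK subr0 mulr1; apply=> t /seg ht.
    have hq' : vn (q + t%:C%C *: (p - q) - 0) < r by rewrite subr0; apply: le_lt_trans sr.
    exact: fd_curve (holo_fd (hW k _ hq')).
  apply: le_trans (lin_le _ _) _; rewrite ler_wpM2r ?vn_ge0//.
  apply: ler_big_const => i; have [_ /(_ (q + t%:C%C *: (p - q)))] := hd (i, k).
  by move=> h; apply/ltW/h; apply: le_lt_trans ht _; apply: lt_le_trans sm (hm _).
apply: le_trans (_ : N%:R * (2 * (N%:R * e * vn (p - q))) <= _).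
  by apply: ler_big_const => k; rewrite !mxE.
rewrite !mulrA ler_wpM2r ?vn_ge0//.
rewrite /e ler_pdivrMr ?mulr_gt0// ?exprn_gt0// ?ltr0n//.
have : (N%:R : R) * N%:R <= N.+1%:R * N.+1%:R by apply: ler_pM; rewrite ?ler0n// ler_nat.
rewrite expr2; move: (N.+1%:R : R) (N%:R : R); clear => x y h.
have -> : y * 2 * y = 2 * (y * y) by ring.
by move: (x * x) (y * y) h => u v h; lra.
Qed.

(** Picard iteration x := y - W x for a contraction of ratio 1/2; [vn y <= s / 2] keeps the iterates
    in the ball of radius s. *)
Lemma solve_perturbed (W : pt -> pt) (s : R) : 0 < s -> W 0 = 0 ->
  (forall p q, vn p <= s -> vn q <= s -> vn (W p - W q) <= 2^-1 * vn (p - q)) ->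
  forall y, vn y <= s / 2 -> exists x, vn x <= s /\ x + W x = y.
Proof.
move=> s0 W0 HW y hy.
pose fix x n : pt := if n is n'.+1 then y - W (x n') else 0.
have xs n : vn (x n) <= s.
  elim: n => [|n IH]; first by rewrite vn0 ltW.
  rewrite /=; apply: le_trans (vnD _ _) _; rewrite vnN.
  have := HW (x n) 0 IH; rewrite vn0 W0 !subr0 => /(_ (ltW s0)).
  by move: IH hy; clear; lra.
have dx n : vn (x n.+1 - x n) <= s / 2 ^+ n.
  elim: n => [|n IH].
    by rewrite /= W0 !subr0 expr0 divr1; clear -hy s0; lra.
  have -> : x n.+2 - x n.+1 = W (x n) - W (x n.+1).
    by rewrite /= opprD opprK addrACA subrr add0r addrC.
  apply: le_trans (HW _ _ (xs n) (xs n.+1)) _; rewrite vnC exprS invfM mulrCA.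
  by rewrite ler_wpM2l.
have /choice [l hl] : forall k, exists l, forall n, cn (x n 0 k - l) <= 4 * s / 2 ^+ n.
  move=> k; apply: c_limit => n; apply: le_trans (dx n); rewrite -[x n.+1]/(x n.+1).
  by have := cn_le_vn (x n.+1 - x n) k; rewrite !mxE.
pose X : pt := \row_k l k.
have xX n : vn (x n - X) <= N%:R * (4 * s) / 2 ^+ n.
  by rewrite -mulrA; apply: ler_big_const => k; rewrite !mxE; exact: hl.
have vX : vn X <= s.
  apply: (@le_limit _ _ _ (N%:R * (4 * s))) => n.
  rewrite -[X](subrK (x n)) addrC; apply: le_trans (vnD _ _) _.
  by apply: lerD => //; rewrite vnC.
exists X; split=> //; apply/eqP; rewrite -subr_eq0; apply/eqP; apply: vn_eq0.
apply/eqP; rewrite eq_le vn_ge0 andbT.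
apply: (@le_limit _ _ _ (2 * (N%:R * (4 * s)))) => n; rewrite add0r.
have -> : X + W X - y = (X - x n.+1) + (W X - W (x n)).
  rewrite /= opprB; apply/rowP => k; rewrite !mxE; ring.
apply: le_trans (vnD _ _) _.
have h1 := HW _ _ vX (xs n); have h2 := xX n; have h3 := xX n.+1.
rewrite vnC in h2; rewrite vnC in h3.
have E : N%:R * (4 * s) / 2 ^+ n.+1 = N%:R * (4 * s) / 2 ^+ n / 2.
  by rewrite exprS; field; rewrite expf_neq0.
rewrite E in h3; rewrite -[2 * _ / _]mulrA; move: h1 h2 h3; clear.
set A := _ / 2 ^+ n; set u := vn _; set v := vn _; set w := vn _ => h1 h2 h3.
have : 0 <= v by exact: vn_ge0.
by lra.
Qed.

Lemma jacE (F : pt -> pt) p i k : jac F p i k = pd (fun q => F q 0 k) i p.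
Proof. by rewrite mxE. Qed.

Lemma fd_mulmx (F : pt -> pt) (A : 'M[C]_N) p (b : 'I_N -> 'I_N -> C) k :
  (forall k, fd (fun q => F q 0 k) p (b k)) ->
  fd (fun q => (F q *m A) 0 k) p (fun i => \sum_m b m i * A m k).
Proof.
move=> H; rewrite (_ : (fun q => _) = fun q => \sum_m F q 0 m * A m k); last first.
  by apply/funext => q; rewrite mxE.
apply: fd_sum => m; have := fdM (H m) (fd_cst (A m k) p).
by rewrite (_ : (fun i => _ + _) = fun i => b m i * A m k)//; apply/funext => i; rewrite mulr0 addr0.
Qed.

(** Normalized by the inverse Jacobian at 0, [F] is the identity plus a contraction [W], so
    [solve_perturbed] gives a local inverse. It is Lipschitz, and with the first order expansion of
    [F] this yields its differential. The last clause gives a ball on which [psi] is also a left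
    inverse. *)
Theorem holo_inverse (F : pt -> pt) (r : R) : 0 < r -> F 0 = 0 ->
  (forall k, hol 0 r (fun q => F q 0 k)) ->
  (forall p, vn p < r -> jac F p \in unitmx) ->
  exists (psi : pt -> pt) (rho sigma : R), [/\ 0 < rho, 0 < sigma, psi 0 = 0,
    (forall x, vn x < rho -> [/\ vn (psi x) < r, F (psi x) = x &
       forall k, fd (fun y => psi y 0 k) x (fun i => invmx (jac F (psi x)) i k)]) &
    (forall p, vn p < sigma -> [/\ vn p < r, vn (F p) < rho & psi (F p) = p])].
Proof.
move=> r0 F0 hF Ju.
have J0u : jac F 0 \in unitmx by apply: Ju; rewrite vn0.
pose J0 := jac F 0; pose K := invmx J0.
pose W p := F p *m K - p.
have fF p k : vn p < r -> fd (fun q => F q 0 k) p (fun i => jac F p i k).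
  move=> hp; have := holo_fd (hF k p _); rewrite subr0 => /(_ hp).
  by rewrite (_ : (fun i => pd _ i p) = fun i => jac F p i k)//; apply/funext => i; rewrite jacE.
have fW p k : vn p < r -> fd (fun q => W q 0 k) p
    (fun i => \sum_m jac F p i m * K m k + -1 * (k == i)%:R).
  move=> hp; rewrite /W (_ : (fun q => _) = fun q => (F q *m K) 0 k + -1 * q 0 k); last first.
    by apply/funext => q; rewrite !mxE mulN1r.
  apply: fdD; first exact: (fd_mulmx K k (fun k => fF p k hp)).
  exact: fdZ (fd_coord k p).
have [||s /andP[s0 sr] HW] := @small_lip W r r0.
- by move=> k q; rewrite subr0 => hq; have [] := fd_holo (fW q k hq).
- move=> i k; have v0 : vn (0 : pt) < r by rewrite vn0.
  have [_ ->] := fd_holo (fW 0 k v0).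
  have := mulmxV J0u => /matrixP /(_ i k); rewrite !mxE => ->.
  by rewrite eq_sym mulN1r subrr.
have W0 : W 0 = 0 by rewrite /W F0 mul0mx subr0.
have sol := solve_perturbed s0 W0 HW.
have inj p q : vn p <= s -> vn q <= s -> p + W p = q + W q -> p = q.
  move=> hp hq E; apply/eqP; rewrite -subr_eq0; apply/eqP/vn_eq0.
  have := HW p q hp hq; have -> : W p - W q = - (p - q).
    have -> : W p = q + W q - p by rewrite -E add1K.
    by rewrite (opprB p q) addrAC addrK.
  by rewrite vnN; have := vn_ge0 (p - q); clear; lra.
(* Outside the ball the value 0 is arbitrary; it makes the choice total. *)
have /choice [ph hph] : forall y, exists x, vn y <= s / 2 -> vn x <= s /\ x + W x = y.
  move=> y; have [/sol [x hx]|_] := leP (vn y) (s / 2); last by exists 0.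
  by exists x.
pose mK := mn K + 1; have mK0 : 0 < mK by have := mn_ge0 K; rewrite /mK; clear; lra.
pose rho := s / 2 / mK.
have rho0 : 0 < rho by rewrite !divr_gt0.
have inK x : vn x < rho -> vn (x *m K) <= s / 2.
  rewrite ltr_pdivlMr// => hx; apply: le_trans (vn_mul _ _) _; apply: le_trans (ltW hx).
  by rewrite mulrC ler_wpM2l ?vn_ge0// /mK lerDl.
pose psi x := ph (x *m K).
have psiP x : vn x < rho -> vn (psi x) <= s /\ F (psi x) = x.
  move=> /inK /hph [h1 h2]; split=> //.
  by move: h2; rewrite /W addrC subrK => /(congr1 (mulmx^~ J0)); rewrite !mulmxKV.
have FW p q : F p = F q -> p + W p = q + W q by rewrite /W !(addrC _ (_ - _)) !subrK => ->.
have FW' p : p + W p = F p *m K by rewrite /W addrC subrK.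
have psi0 : psi 0 = 0.
  have [|h1 h2] := psiP 0; first by rewrite vn0.
  by apply: inj => //; [rewrite vn0 ltW|apply: FW; rewrite h2 F0].
have lip x y : vn x < rho -> vn y < rho -> vn (psi y - psi x) <= 2 * (mK * vn (y - x)).
  move=> hx hy; have [h1 h2] := psiP x hx; have [h3 h4] := psiP y hy.
  have h5 := HW _ _ h3 h1.
  have h6 : vn ((y - x) *m K) <= mK * vn (y - x).
    apply: le_trans (vn_mul _ _) _; rewrite ler_wpM2r ?vn_ge0// /mK lerDl//.
  have E : psi y - psi x = (y - x) *m K - (W (psi y) - W (psi x)).
    have E1 : y *m K = psi y + W (psi y) by rewrite FW' h4.
    have E2 : x *m K = psi x + W (psi x) by rewrite FW' h2.
    rewrite mulmxBl E1 E2; move: (psi y) (psi x) (W (psi y)) (W (psi x)) => u1 u2 u3 u4.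
    by rewrite opprD addrACA addrK.
  have : vn (psi y - psi x) <= mK * vn (y - x) + 2^-1 * vn (psi y - psi x).
    rewrite {1}E; apply: le_trans (vnD _ _) _; rewrite vnN; exact: lerD.
  by clear; lra.
have mK2 : 0 < 2 * mK by rewrite mulr_gt0.
clear inK; clearbody psi rho mK; clear hph ph sol.
have v0r : vn (0 : pt) < r by rewrite vn0.
have [d d0 [B B0 hB]] := @vn_incr R N F 0 _ (fun k => fF 0 k v0r).
pose sg := Num.min s (Num.min d (rho / B)).
exists psi, rho, sg; split=> //; first by rewrite !lt_min s0 d0 divr_gt0.
  move=> x hx; have [h1 h2] := psiP x hx.
  have h3 : vn (psi x) < r by apply: le_lt_trans h1 sr.
  split=> // k; set X := psi x in h1 h2 h3 *.
  pose V := invmx (jac F X).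
  (* Collects the Lipschitz constant of [psi], the norm of [V] and the sum over the coordinates. *)
  pose M := 2 * mK * (mn V + 1) * N.+1%:R.
  have mV := mn_ge0 V.
  have V0 : 0 < mn V + 1 by clear -mV; lra.
  have M0 : 0 < M.
    apply: mulr_gt0; last by rewrite ltr0n.
    exact: mulr_gt0 mK2 V0.
  move=> e e0.
  have e1 : 0 < e / M by rewrite divr_gt0.
  have : forall k, exists d, 0 < d /\ forall h, vn h < d ->
     cn (F (X + h) 0 k - F X 0 k - lin (fun i => jac F X i k) h) <= e / M * vn h.
    by move=> m; have [d1 d10 hd1] := fF X m h3 _ e1; exists d1.
  move=> /choice [dd hdd].
  have [m m0 hm] : exists2 m, 0 < m & forall ik, m <= dd ik.
    exists (\big[Num.min/1]_ik dd ik); first by rewrite lt_bigmin// => l _; have [] := hdd l.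
    by move=> l; exact: bigmin_le_cond.
  exists (Num.min (rho - vn x) (m / (2 * mK))).
    by rewrite lt_min subr_gt0 hx; apply: divr_gt0 m0 mK2.
  move=> h; rewrite lt_min => /andP[hh1]; rewrite (ltr_pdivlMr _ _ mK2) => hh2.
  have hxh : vn (x + h) < rho by apply: le_lt_trans (vnD _ _) _; clear -hh1; lra.
  have := lip x (x + h) hx hxh; rewrite (addrC x) addrK => hl.
  have [h4 h5] := psiP _ hxh; rewrite (addrC x) in h4 h5.
  set Dl := psi (h + x) - X in hl.
  have Dm : vn Dl < m by apply: le_lt_trans hl _; rewrite mulrA mulrC.
  have EF : F (X + Dl) = h + x by rewrite /Dl (addrC X) subrK.
  have hk l : cn ((h - Dl *m jac F X) 0 l) <= e / M * vn Dl.
    have [_ /(_ Dl (lt_le_trans Dm (hm l)))] := hdd l.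
    rewrite EF h2 !mxE /lin => hh; apply: le_trans hh; rewrite addrK.
    by rewrite lexx.
  (* The remainder of [psi] is minus the image under [V] of the first order remainder of [F]. *)
  have E : Dl - h *m V = - ((h - Dl *m jac F X) *m V).
    by rewrite mulmxBl mulmxK ?Ju// opprB.
  have -> : psi (h + x) 0 k - X 0 k - lin (fun i => V i k) h = (Dl - h *m V) 0 k.
    by rewrite !mxE.
  rewrite E mxE cnN; apply: le_trans (cn_le_vn _ _) _; apply: le_trans (vn_mul _ _) _.
  have : vn (h - Dl *m jac F X) <= N.+1%:R * (e / M * vn Dl).
    apply: le_trans (ler_big_const hk) _; rewrite ler_wpM2r ?ler_nat//.
    by rewrite mulr_ge0 ?vn_ge0// ltW.
  move=> hs; apply: le_trans (ler_wpM2l mV hs) _.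
  have h6 : e / M * vn Dl <= e / M * (2 * (mK * vn h)) by rewrite ler_pM2l.
  have N0 : 0 <= N.+1%:R :> R by rewrite ler0n.
  apply: le_trans (ler_wpM2l mV (ler_wpM2l N0 h6)) _.
  apply: le_trans (_ : (mn V + 1) * (N.+1%:R * (e / M * (2 * (mK * vn h)))) <= _).
    apply: ler_wpM2r; last by rewrite lerDl.
    apply: (mulr_ge0 N0); apply: (mulr_ge0 (ltW e1)); apply: mulr_ge0; first exact: ler0n.
    exact: (mulr_ge0 (ltW mK0) (vn_ge0 h)).
  rewrite le_eqVlt; apply/orP; left; apply/eqP.
  rewrite (_ : (mn V + 1) * _ = e / M * M * vn h); last by rewrite /M; ring.
  by rewrite divfK ?gt_eqF.
move=> p; rewrite !lt_min => /and3P[p1 p2 p3].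
have Fp : vn (F p) < rho.
  have := hB p p2; rewrite add0r F0 subr0 => /le_lt_trans; apply.
  by rewrite mulrC -ltr_pdivlMr.
split=> //; first exact: lt_trans p1 sr.
have [h1 h2] := psiP _ Fp.
by apply: inj => //; [exact: ltW|exact: FW].
Qed.

End Inverse.

(** * Uniqueness of the flat system *)

Section Taylor.
Variable R : realType.
Local Notation C := R[i].
Local Notation cn := (@Normc.normc R).
Implicit Types (f g : C -> C) (a b : nat -> C).

Definition bigO n f := exists K d : R, [/\ 0 <= K, 0 < d & forall s, cn s < d -> cn (f s) <= K * cn s ^+ n].

(* Asymptotic expansion at 0; on the germs used it is the convergent Taylor series. *)
Definition tay f a := forall n, bigO n (fun s => f s - \sum_(k < n) a k * s ^+ k).

Lemma bigO_ext n f g : f =1 g -> bigO n f -> bigO n g.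
Proof. by move=> /funext ->. Qed.

Lemma bigOD n f g : bigO n f -> bigO n g -> bigO n (fun s => f s + g s).
Proof.
move=> [K [d [K0 d0 H]]] [K' [d' [K0' d0' H']]].
exists (K + K'), (Num.min d d'); split; [exact: addr_ge0|by rewrite lt_min d0|].
move=> s; rewrite lt_min => /andP[/H h1 /H' h2].
by apply: le_trans (cnD _ _) _; rewrite mulrDl lerD.
Qed.

Lemma bigOM n m f g : bigO n f -> bigO m g -> bigO (n + m) (fun s => f s * g s).
Proof.
move=> [K [d [K0 d0 H]]] [K' [d' [K0' d0' H']]].
exists (K * K'), (Num.min d d'); split; [exact: mulr_ge0|by rewrite lt_min d0|].
move=> s; rewrite lt_min => /andP[/H h1 /H' h2].
by rewrite cnM exprD mulrACA; apply: ler_pM => //; exact: cn_ge0.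
Qed.

Lemma bigOX n : bigO n (fun s => s ^+ n).
Proof. by exists 1, 1; split=> // s _; rewrite cnX mul1r. Qed.

Lemma bigO_cst c : bigO 0 (fun=> c).
Proof. by exists (cn c), 1; split=> //; [exact: cn_ge0|move=> s _; rewrite expr0 mulr1]. Qed.

Lemma bigO_le n m f : (m <= n)%N -> bigO n f -> bigO m f.
Proof.
move=> mn [K [d [K0 d0 H]]]; exists K, (Num.min d 1); split=> //.
  by rewrite lt_min d0 /=.
move=> s; rewrite lt_min => /andP[/H h1 s1]; apply: le_trans h1 _.
apply: ler_wpM2l => //; apply: ler_wiXn2l => //; first exact: cn_ge0.
exact: ltW.
Qed.

Lemma bigO_horner (p : {poly C}) : bigO 0 (fun s => p.[s]).
Proof.
elim/poly_ind: p => [|p c IH].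
  by apply: bigO_ext (bigO_cst 0) => s; rewrite horner0.
apply: bigO_ext (bigOD (bigOM IH (bigO_le (leq0n 1) (bigOX 1))) (bigO_cst c)) => s.
by rewrite hornerMXaddC.
Qed.

Lemma tayP f a n : tay f a ->
  bigO n (fun s => f s - (\poly_(k < n) a k).[s]).
Proof.
move=> /(_ n); apply: bigO_ext => s; congr (_ - _).
by rewrite horner_poly.
Qed.

Lemma bigO_poly0 (c : C) n : bigO n.+1 (fun s => c * s ^+ n) -> c = 0.
Proof.
move=> [K [d [K0 d0 H]]]; apply: (@cn_small_eq0 R _ K) => e e0.
pose t := Num.min (d / 2) e.
have t0 : 0 < t by rewrite lt_min divr_gt0.
have ct : cn (t%:C%C) = t by rewrite cnRp// ltW.
have := H (t%:C%C); rewrite cnM cnX ct exprS mulrA ler_pM2r ?exprn_gt0// => h.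
have td : t < d by rewrite /t gt_min; apply/orP; left; clear -d0; lra.
by apply: le_trans (h td) _; apply: ler_wpM2l => //; rewrite /t ge_min lexx orbT.
Qed.

Lemma tay_unique f a b : tay f a -> tay f b -> forall k, a k = b k.
Proof.
move=> ta tb n; elim/ltn_ind: n => n IH.
apply/eqP; rewrite -subr_eq0; apply/eqP; apply: (@bigO_poly0 _ n).
have h := bigOD (tb n.+1) (bigOM (bigO_cst (-1)) (ta n.+1)).
apply: bigO_ext h => s; rewrite !big_ord_recr /=.
rewrite (eq_bigr (fun k : 'I_n => a k * s ^+ k)); last by move=> k _; rewrite IH.
ring.
Qed.

Lemma tayD f g a b : tay f a -> tay g b -> tay (fun s => f s + g s) (fun k => a k + b k).
Proof.
move=> ta tb n; apply: bigO_ext (bigOD (ta n) (tb n)) => s.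
have -> : \sum_(k < n) (a k + b k) * s ^+ k =
    \sum_(k < n) a k * s ^+ k + \sum_(k < n) b k * s ^+ k.
  by rewrite -big_split; apply: eq_bigr => k _; rewrite mulrDl.
by rewrite opprD addrACA.
Qed.

Lemma tayZ c f a : tay f a -> tay (fun s => c * f s) (fun k => c * a k).
Proof.
move=> ta n; apply: bigO_ext (bigOM (bigO_cst c) (ta n)) => s.
by rewrite mulrBr mulr_sumr; congr (_ - _); apply: eq_bigr => k _; rewrite mulrA.
Qed.

Lemma tay0 : tay (fun=> 0) (fun=> 0).
Proof.
move=> n; exists 0, 1; split=> // s _.
by rewrite big1 ?subrr ?cn0 ?mul0r// => k _; rewrite mul0r.
Qed.

Lemma tay_sum (I : Type) (r : seq I) (F : I -> C -> C) (A : I -> nat -> C) :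
  (forall i, tay (F i) (A i)) ->
  tay (fun s => \sum_(i <- r) F i s) (fun k => \sum_(i <- r) A i k).
Proof.
move=> H; elim: r => [|i r IH].
  rewrite (_ : (fun s => _) = fun=> 0); last by apply/funext => s; rewrite big_nil.
  by rewrite (_ : (fun k => _) = fun=> 0); [exact: tay0|apply/funext => s; rewrite big_nil].
rewrite (_ : (fun s => _) = fun s => F i s + \sum_(i <- r) F i s); last first.
  by apply/funext => s; rewrite big_cons.
rewrite (_ : (fun k => _) = fun k => A i k + \sum_(i <- r) A i k); last first.
  by apply/funext => s; rewrite big_cons.
exact: tayD.
Qed.

(** Both factors are replaced by truncated polynomials: [take_poly] of the product carries the
    Cauchy coefficients and [drop_poly] is a multiple of s^n. *)
Lemma tayM f g a b : tay f a -> tay g b ->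
  tay (fun s => f s * g s) (fun n => \sum_(k < n.+1) a k * b (n - k)%N).
Proof.
move=> ta tb n.
pose p := \poly_(k < n) a k; pose q := \poly_(k < n) b k.
pose c m := \sum_(k < m.+1) a k * b (m - k)%N.
have E : take_poly n (p * q) = \poly_(k < n) c k.
  apply/polyP => i; rewrite coef_take_poly coef_poly; case: ltnP => // ni.
  rewrite coefM; apply: eq_bigr => k _; rewrite !coef_poly.
  rewrite (leq_ltn_trans _ ni); last by rewrite -ltnS ltn_ord.
  by rewrite (leq_ltn_trans _ ni)// leq_subr.
have tap := tayP n ta; have tbq := tayP n tb; rewrite -/p -/q in tap tbq.
have hg : bigO 0 g.
  have := tb 0%N; apply: bigO_ext => s; by rewrite big_ord0 subr0.
have h1 : bigO n (fun s => (f s - p.[s]) * g s).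
  by rewrite -[n]addn0; exact: bigOM.
have h2 : bigO n (fun s => p.[s] * (g s - q.[s])).
  by rewrite -[n]add0n; apply: bigOM => //; exact: bigO_horner.
have h3 : bigO n (fun s => (drop_poly n (p * q)).[s] * s ^+ n).
  by rewrite -[n in bigO n]add0n; apply: bigOM (bigO_horner _) (bigOX n).
apply: bigO_ext (bigOD (bigOD h1 h2) h3) => s.
have E2 : p.[s] * q.[s] = (\poly_(k < n) c k).[s] + (drop_poly n (p * q)).[s] * s ^+ n.
  by rewrite -hornerM -[in LHS](poly_take_drop n (p * q)) E hornerD hornerM hornerXn.
have -> : \sum_(k < n) c k * s ^+ k = (\poly_(k < n) c k).[s] by rewrite horner_poly.
have -> : (\poly_(k < n) c k).[s] = p.[s] * q.[s] - (drop_poly n (p * q)).[s] * s ^+ n.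
  by rewrite E2 addrK.
ring.
Qed.

Lemma cd_sum (I : Type) (r : seq I) (F : I -> C -> C) (A : I -> C) z :
  (forall i, cd (F i) z (A i)) ->
  cd (fun s => \sum_(i <- r) F i s) z (\sum_(i <- r) A i).
Proof.
move=> H; elim: r => [|i r IH].
  rewrite (_ : (fun s => _) = fun=> 0); last by apply/funext => s; rewrite big_nil.
  by rewrite big_nil; exact: cd_cst.
rewrite (_ : (fun s => _) = fun s => F i s + \sum_(i <- r) F i s); last first.
  by apply/funext => s; rewrite big_cons.
by rewrite big_cons; exact: cdD.
Qed.

(** By its definition an asymptotic expansion can be integrated but not directly differentiated, so
    the expansion of a function is obtained from that of its derivative. *)
Lemma tay_int f v b (r : R) : 0 < r -> (forall s, cn s < r -> cd f s (v s)) -> tay v b ->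
  tay f (fun k => if k is k'.+1 then b k' / k'.+1%:R else f 0).
Proof.
move=> r0 df tv.
set a := fun k => _.
suff H n : bigO n.+1 (fun s => f s - \sum_(k < n.+1) a k * s ^+ k).
  case=> [|n] //.
  have := bigOD (bigO_le (leq0n 1) (H 0%N)) (bigO_cst (f 0)); apply: bigO_ext => s.
  by rewrite big_ord1 big_ord0 /a expr0 mulr1 subrK subr0.
have [K [d [K0 d0 HK]]] := tv n.
exists (2 * K), (Num.min r d); split; [exact: mulr_ge0|by rewrite lt_min r0|].
move=> s; rewrite lt_min => /andP[sr sd].
pose h z := f z + (- f 0 + -1 * \sum_(k < n) (b k / k.+1%:R) * z ^+ k.+1).
have hE z : f z - \sum_(k < n.+1) a k * z ^+ k = h z.
  rewrite /h big_ord_recl /a /= expr0 mulr1 opprD mulN1r; congr (_ + (_ - _)).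
have dh z : cn z < r -> cd h z (v z - \sum_(k < n) b k * z ^+ k).
  move=> zr; rewrite -mulN1r -[X in _ + X]add0r; apply: cdD; first exact: df.
  apply: cdD; first exact: cd_cst.
  apply: cdZ; apply: cd_sum => k.
  have := cdZ (b k / k.+1%:R) (cdX k (@cd_id R z)).
  suff -> : b k / k.+1%:R * (k.+1%:R * z ^+ k * 1) = b k * z ^+ k by [].
  by rewrite mulr1 mulrA divfK// pnatr_eq0.
have sz (t : R) : 0 <= t <= 1 -> cn (t%:C%C * s) <= cn s.
  by move=> /andP[t0 t1]; rewrite cnM cnRp// ler_piMl ?cn_ge0.
rewrite hE.
have h0 : h 0 = 0.
  by rewrite /h big1 ?mulr0 ?addr0 ?subrr// => k _; rewrite expr0n mulr0.
have := @crderiv_le R (fun t : R => h (0 + t%:C%C * s))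
  (fun t => s * (v (0 + t%:C%C * s) - \sum_(k < n) b k * (0 + t%:C%C * s) ^+ k))
  (K * cn s ^+ n.+1) 0 1 ler01.
have e0 : (0 : R)%:C%C * s = 0 by rewrite rmorph0 mul0r.
have e1 : (1 : R)%:C%C * s = s by rewrite rmorph1 mul1r.
rewrite e0 e1 !add0r h0 !subr0 mulr1 mulrA; apply=> t ht; have sz' := sz t ht.
  by apply: cd_line; apply: dh; rewrite add0r; exact: le_lt_trans sr.
rewrite add0r cnM exprS mulrCA; apply: ler_wpM2l; first exact: cn_ge0.
apply: le_trans (HK _ (le_lt_trans sz' sd)) _; apply: ler_wpM2l => //.
by apply: lerXn2r; rewrite ?nnegrE ?cn_ge0.
Qed.

End Taylor.

Section LineTaylor.
Variable R : realType.
Local Notation C := R[i].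
Local Notation cn := (@Normc.normc R).
Variable N : nat.
Local Notation pt := ('rV[C]_N).
Implicit Types (f : pt -> C).

(** The radius [t] is chosen before the direction [w]. Vanishing coefficients force f to vanish
    because the remainder bounds hold for all n with a common constant and ratio at most 1/2, which
    is stronger than [tay]. *)
Lemma line_taylor f (r : R) : 0 < r -> hol 0 r f ->
  exists2 t : R, 0 < t & forall w, vn w <= 1 ->
    exists2 a, tay (fun s => f (s *: w)) a &
      ((forall k, a k = 0) -> forall s, cn s < t -> f (s *: w) = 0).
Proof.
move=> r0 hf.
have [K0 [K00 HK]] := taylor_disc R.
have [d d0 [M M0 HM]] := fd_bounded (holo_fd (hol_holo r0 hf)).
pose t := Num.min r d.
have t0 : 0 < t by rewrite lt_min r0.
exists (t / 6); first by rewrite divr_gt0.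
move=> w w1.
have sw s : cn s < t -> vn (s *: w) < t.
  by move=> hs; rewrite vnZ; apply: le_lt_trans hs; rewrite ler_piMr ?cn_ge0.
have [||a ha] := HK t (fun s => f (s *: w)) M t0.
- move=> z /sw; rewrite lt_min => /andP[h _].
  have hz : vn (z *: w - 0) < r by rewrite subr0.
  have h1 := holo_fd (hf _ hz); have := @fd_line R N f 0 w z _; rewrite add0r.
  move=> /(_ _ h1) h2; exists (lin (fun i => pd f i (z *: w)) w).
  suff -> : (fun s => f (s *: w)) = (fun t : C => f (0 + t *: w)) by [].
  by apply/funext => u; rewrite add0r.
- by move=> z /sw; rewrite lt_min => /andP[_ h]; apply: HM; rewrite subr0.
exists a.
  move=> n; exists (K0 * M * (3 / t) ^+ n), (t / 6); split.
  - by rewrite !mulr_ge0// ?exprn_ge0 ?divr_ge0// ltW.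
  - by rewrite divr_gt0.
  move=> s /ltW /(ha n) /le_trans; apply.
  by rewrite -[leRHS]mulrA -exprMn (mulrAC 3).
move=> a0 s hs; apply: (@cn_small_eq0 R _ 1) => e e0; rewrite mul1r.
have [n hn] := half_small (K0 * M) e0.
have := ha n s (ltW hs); rewrite big1; last by move=> k _; rewrite a0 mul0r.
rewrite subr0 => /le_trans; apply; apply: le_trans (ltW hn).
apply: ler_wpM2l; first by rewrite mulr_ge0// ltW.
rewrite -exprVn; apply: lerXn2r; rewrite ?nnegrE ?invr_ge0 ?divr_ge0 ?mulr_ge0 ?cn_ge0 ?(ltW t0)//.
by rewrite ler_pdivrMr//; clear -hs; lra.
Qed.

End LineTaylor.

(** * Uniqueness of the Taylor coefficients along a generic line *)

Section SeqUnique.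
Variable F : numFieldType.
Variable N : nat.
Local Notation mx := 'M[F]_N.
Implicit Types (c u : nat -> mx).

Definition cmt (A B : mx) : mx := A *m B - B *m A.

Lemma cmtBl A A' B : cmt (A - A') B = cmt A B - cmt A' B.
Proof.
rewrite /cmt mulmxBl mulmxBr !opprB -!addrA; congr (_ + _).
by rewrite [LHS]addrC [RHS]addrCA -addrA.
Qed.

Lemma cmtBr A B B' : cmt A (B - B') = cmt A B - cmt A B'.
Proof.
rewrite /cmt mulmxBl mulmxBr !opprB -!addrA; congr (_ + _).
by rewrite [LHS]addrC [RHS]addrCA -addrA.
Qed.

Lemma cmtN A B : cmt A B = - cmt B A.
Proof. by rewrite /cmt opprB. Qed.

Lemma cmtDr A B B' : cmt A (B + B') = cmt A B + cmt A B'.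
Proof. by rewrite /cmt mulmxDl mulmxDr opprD addrACA. Qed.

Lemma cmt_diagr A (d : 'I_N -> F) a b :
  cmt A (diag_mx (\row_i d i)) a b = A a b * (d b - d a).
Proof.
rewrite /cmt mxE mul_mx_diag mxE mxE mul_diag_mx !mxE.
by rewrite mulrBr; congr (_ - _); rewrite mulrC.
Qed.

Variables (mu : mx) (w u0 : 'I_N -> F).
Hypothesis w_inj : injective w.
Hypothesis mu0 : forall a b, u0 a = u0 b -> mu a b = 0.

(** Coefficientwise form, along the line s w, of dU/ds = C_w + [mu, C_w], [C_w, U] = 0 and
    [C_b, C_w] = 0, where [c], [u] and [cb b] are the coefficients of C_w, U and C_b. *)
Record taylor_system (c u : nat -> mx) (cb : 'I_N -> nat -> mx) : Prop := TaylorSystem {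
  ts_der : forall k, k.+1%:R *: u k.+1 = c k + cmt mu (c k);
  ts_cu : forall m, \sum_(k < m.+1) cmt (c k) (u (m - k)%N) = 0;
  ts_cc : forall m b, \sum_(k < m.+1) cmt (cb b k) (c (m - k)%N) = 0 }.

Lemma row_sum_diag0 (A : mx) : (forall a b, a != b -> A a b = 0) ->
  (forall a, \sum_b A a b = 0) -> A = 0.
Proof.
move=> off s0; apply/matrixP => a b; rewrite mxE.
have [<-|ab] := eqVneq a b; last exact: off.
have := s0 a; rewrite (bigD1 a)//= big1 ?addr0// => k ka.
by apply: off; rewrite eq_sym.
Qed.

(** Induction settles [c] first; [u] follows from [ts_der]. Each [cb b] comes last: a difference
    commuting with diag w, whose entries are distinct, is diagonal, and zero row sums kill it. *)
Lemma taylor_system_unique c u cb c' u' cb' :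
  taylor_system c u cb -> taylor_system c' u' cb' ->
  c 0%N = diag_mx (\row_i w i) -> c' 0%N = c 0%N ->
  u 0%N = diag_mx (\row_i u0 i) -> u' 0%N = u 0%N ->
  (forall b, cb b 0%N = cb' b 0%N) ->
  (forall k a, \sum_b (c k - c' k) a b = 0) ->
  (forall e k a, \sum_b (cb e k - cb' e k) a b = 0) ->
  forall k, [/\ c k = c' k, u k = u' k & forall b, cb b k = cb' b k].
Proof.
move=> [H1 H2 H3] [H1' H2' H3'] c0 c0' uu0 uu0' cb0 rc rcb.
have inv k : k.+1%:R != 0 :> F by rewrite pnatr_eq0.
have uS k : c k = c' k -> u k.+1 = u' k.+1.
  by move=> E; apply: (scalerI (inv k)); rewrite H1 H1' E.
have main : forall n, c n = c' n.
  move=> n; elim/ltn_ind: n => -[_|n IH]; first by rewrite c0'.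
  have uE k : (k <= n.+1)%N -> u k = u' k.
    by case: k => [_|k kn]; [rewrite uu0'|apply/uS/IH].
  apply/eqP; rewrite -subr_eq0; apply/eqP; set D := c n.+1 - c' n.+1.
  (* At order n+1 the coefficients of [u] up to n+1 already agree, so the two relations differ only
     in the last term. *)
  have D0 : cmt D (u 0%N) = 0.
    have := etrans (H2 n.+1) (esym (H2' n.+1)); rewrite big_ord_recr [in RHS]big_ord_recr /= subnn.
    rewrite (eq_bigr (fun k : 'I_n.+1 => cmt (c' k) (u' (n.+1 - k)%N))); last first.
      by move=> k _; rewrite IH// uE// leq_subr.
    by move=> /addrI E; rewrite cmtBl -uu0' -E uu0' subrr.
  have Dd a b : u0 a != u0 b -> D a b = 0.
    move=> ab; have /matrixP /(_ a b) := D0.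
    rewrite uu0 cmt_diagr [RHS]mxE => /eqP; rewrite mulf_eq0 subr_eq0 (eq_sym (u0 b)) (negPf ab) orbF.
    by move/eqP.
  have Dod a b : a != b -> D a b = 0.
    move=> ab; have [uab|] := eqVneq (u0 a) (u0 b); last exact: Dd.
    pose DU := u n.+2 - u' n.+2; pose D2 := c n.+2 - c' n.+2.
    (* At order n+2 three terms survive subtraction: the last two, and the one for k = 0, which
       carries [u n.+2]. The entry (a,b) of the first will vanish, because u0 a = u0 b. *)
    have key : cmt D2 (u 0%N) a b + cmt D (u 1%N) a b + cmt (c 0%N) DU a b = 0.
      have := etrans (H2 n.+2) (esym (H2' n.+2)).
      rewrite 2!big_ord_recr big_ord_recl [in RHS]big_ord_recr [in RHS]big_ord_recr [in RHS]big_ord_recl /=.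
      rewrite subnn subn0 subSnn.
      rewrite (eq_bigr (fun k : 'I_n => cmt (c' (bump 0 k)) (u' (n.+2 - bump 0 k)%N))); last first.
        move=> k _; have kn := ltn_ord k; rewrite /bump /= add1n.
        by rewrite IH ?ltnS// uE// subSS; apply: leq_trans (leq_subr _ _) _.
      rewrite /D2 /D /DU !cmtBl cmtBr c0' (uE 1%N)// uu0'.
      move: (\sum_(i < n) _) => S; do 6 move: (cmt _ _) => ?.
      move=> /matrixP /(_ a b); rewrite !mxE => /eqP; rewrite -subr_eq0 => /eqP E.
      by rewrite -[RHS]E; ring.
    (* A matrix vanishing on the blocks, multiplied on either side by one supported on the blocks,
       still vanishes on the blocks. *)
    have blk (M A : mx) : (forall i j, u0 i = u0 j -> M i j = 0) ->
        (forall i j, u0 i != u0 j -> A i j = 0) -> cmt M A a b = 0.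
      move=> HM HA; rewrite /cmt !mxE.
      rewrite [X in X - _]big1 => [|k _]; last first.
        have [uk|uk] := eqVneq (u0 k) (u0 b); last by rewrite HA ?mulr0.
        by rewrite HM ?mul0r// uab.
      rewrite big1 ?subrr// => k _.
      have [uk|uk] := eqVneq (u0 a) (u0 k); last by rewrite HA ?mul0r.
      by rewrite HM ?mulr0// -uk.
    have u1 : u 1%N = c 0%N + cmt mu (c 0%N) by rewrite -(H1 0%N) scale1r.
    have c0mu i j : u0 i = u0 j -> cmt mu (c 0%N) i j = 0.
      by move=> ij; rewrite c0 cmt_diagr mu0// mul0r.
    (* Here mu vanishes on the blocks and [D] off them, so [mu, D] has no entry at (a,b). *)
    have DUE : n.+2%:R * DU a b = D a b.
      have : n.+2%:R *: DU = D + cmt mu D.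
        rewrite /DU scalerBr H1 H1' /D cmtBr.
        by rewrite opprD addrACA.
      move/matrixP => /(_ a b); rewrite [LHS]mxE [RHS]mxE => ->.
      by rewrite (blk mu D mu0 Dd) addr0.
    move: key; rewrite uu0 c0 cmt_diagr uab subrr mulr0 add0r u1.
    have -> : cmt D (c 0%N + cmt mu (c 0%N)) = cmt D (c 0%N) - cmt (cmt mu (c 0%N)) D.
      by rewrite cmtDr; congr (_ + _); exact: cmtN.
    have -> : cmt (diag_mx (\row_i w i)) DU = - cmt DU (diag_mx (\row_i w i)) by exact: cmtN.
    rewrite c0 mxE [(- cmt (cmt _ _) _) a b]mxE [(- cmt DU _) a b]mxE !cmt_diagr -c0.
    rewrite (blk _ D c0mu Dd) subr0 -mulNr -mulrDl => /eqP.
    rewrite mulf_eq0 => /orP[|]; last first.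
      by rewrite subr_eq0 => /eqP/w_inj E; rewrite E eqxx in ab.
    (* The equality of [D a b] and [DU a b] turns [DUE] into (n+2) D = D at (a,b), impossible for a
       nonzero entry. *)
    rewrite subr_eq0 => /eqP E; move: DUE; rewrite -E -[RHS]mul1r => /eqP.
    rewrite -subr_eq0 -mulrBl mulf_eq0 => /orP[|/eqP//].
    by rewrite subr_eq0 -[1]/(1%:R) eqr_nat.
  exact: row_sum_diag0 Dod (rc _).
move=> n; split; [exact: main|by case: n => [|n]; [rewrite uu0'|apply/uS/main]|].
elim/ltn_ind: n => n IH b; apply/eqP; rewrite -subr_eq0; apply/eqP.
apply: row_sum_diag0 (rcb b n) => i j ij.
have := etrans (H3 n b) (esym (H3' n b)); rewrite big_ord_recr [in RHS]big_ord_recr /= subnn.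
rewrite (eq_bigr (fun k : 'I_n => cmt (cb' b k) (c' (n - k)%N))); last first.
  by move=> k _; rewrite IH// main.
move=> /addrI E.
have : cmt (cb b n - cb' b n) (c 0%N) = 0 by rewrite cmtBl E c0' subrr.
rewrite c0 => /matrixP /(_ i j); rewrite cmt_diagr [RHS]mxE => /eqP.
rewrite mulf_eq0 => /orP[/eqP//|]; rewrite subr_eq0 => /eqP/w_inj E2.
by rewrite E2 eqxx in ij.
Qed.

End SeqUnique.

(** * From Taylor coefficients to agreement near the origin *)

Section FlatUnique.
Variable R : realType.
Local Notation C := R[i].
Local Notation cn := (@Normc.normc R).
Variable N : nat.
Local Notation pt := ('rV[C]_N).
Local Notation mx := 'M[C]_N.

Definition mtay (F : C -> mx) (A : nat -> mx) :=
  forall i j, tay (fun s => F s i j) (fun k => A k i j).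

Lemma bigO_near n (f g : C -> C) (d : R) : 0 < d ->
  (forall s, cn s < d -> f s = g s) -> bigO n f -> bigO n g.
Proof.
move=> d0 fg [K [d' [K0 d'0 H]]]; exists K, (Num.min d d'); split=> //.
  by rewrite lt_min d0.
by move=> s; rewrite lt_min => /andP[h1 h2]; rewrite -fg//; exact: H.
Qed.

Lemma tay_zero (f : C -> C) a (d : R) : 0 < d -> (forall s, cn s < d -> f s = 0) ->
  tay f a -> forall k, a k = 0.
Proof.
move=> d0 f0 ta; have t0 : tay f (fun=> 0).
  move=> n; apply: (bigO_near d0 _ (tay0 R n)) => s /f0 ->.
  by [].
by move=> k; exact: tay_unique ta t0 k.
Qed.

Lemma mtayM F G A B : mtay F A -> mtay G B ->
  mtay (fun s => F s *m G s) (fun n => \sum_(k < n.+1) A k *m B (n - k)%N).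
Proof.
move=> tF tG i j.
have := tay_sum (index_enum 'I_N) (fun l => tayM (tF i l) (tG l j)).
rewrite (_ : (fun s => \sum_(l <- _) _) = fun s => (F s *m G s) i j); last first.
  by apply/funext => s; rewrite mxE.
rewrite (_ : (fun n => \sum_(l <- _) _) = fun n => (\sum_(k < n.+1) A k *m B (n - k)%N) i j)//.
apply/funext => n; rewrite summxE exchange_big; apply: eq_bigr => k _.
by rewrite mxE.
Qed.

(** The sum is indexed by the coefficients of the right factor, so that it subtracts termwise from
    [mtayM] in [mtay_cmt]. *)
Lemma mtayMr F G A B : mtay F A -> mtay G B ->
  mtay (fun s => G s *m F s) (fun n => \sum_(k < n.+1) B (n - k)%N *m A k).
Proof.
move=> tF tG i j.
have := tay_sum (index_enum 'I_N) (fun l => tayM (tF l j) (tG i l)).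
rewrite (_ : (fun s => \sum_(l <- _) _) = fun s => (G s *m F s) i j); last first.
  by apply/funext => s; rewrite mxE; apply: eq_bigr => l _; rewrite mulrC.
rewrite (_ : (fun n => \sum_(l <- _) _) = fun n => (\sum_(k < n.+1) B (n - k)%N *m A k) i j)//.
apply/funext => n; rewrite summxE exchange_big; apply: eq_bigr => k _.
by rewrite mxE; apply: eq_bigr => l _; rewrite mulrC.
Qed.

Lemma mtayD F G A B : mtay F A -> mtay G B ->
  mtay (fun s => F s + G s) (fun n => A n + B n).
Proof.
move=> tF tG i j; have := tayD (tF i j) (tG i j).
rewrite (_ : (fun s => _ + _) = fun s => (F s + G s) i j); last by apply/funext => s; rewrite mxE.
by rewrite (_ : (fun s => _ + _) = fun n => (A n + B n) i j)//; apply/funext => s; rewrite mxE.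
Qed.

Lemma mtayZ c F A : mtay F A -> mtay (fun s => c *: F s) (fun n => c *: A n).
Proof.
move=> tF i j; have := tayZ c (tF i j).
rewrite (_ : (fun s => _ * _) = fun s => (c *: F s) i j); last by apply/funext => s; rewrite mxE.
by rewrite (_ : (fun s => _ * _) = fun n => (c *: A n) i j)//; apply/funext => s; rewrite mxE.
Qed.

Lemma mtayB F G A B : mtay F A -> mtay G B ->
  mtay (fun s => F s - G s) (fun n => A n - B n).
Proof.
move=> tF tG; have := mtayD tF (mtayZ (-1) tG).
rewrite (_ : (fun s => _ + _) = fun s => F s - G s); last by apply/funext => s; rewrite scaleN1r.
by rewrite (_ : (fun s => _ + _) = fun n => A n - B n)//; apply/funext => s; rewrite scaleN1r.
Qed.

Lemma mtay_sum (I : Type) (r : seq I) (F : I -> C -> mx) (A : I -> nat -> mx) :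
  (forall i, mtay (F i) (A i)) ->
  mtay (fun s => \sum_(i <- r) F i s) (fun k => \sum_(i <- r) A i k).
Proof.
move=> H i j; have := tay_sum r (fun l => H l i j).
rewrite (_ : (fun s => \sum_(l <- _) _) = fun s => (\sum_(l <- r) F l s) i j); last first.
  by apply/funext => s; rewrite summxE.
by rewrite (_ : (fun s => \sum_(l <- _) _) = fun n => (\sum_(l <- r) A l n) i j)//;
  apply/funext => s; rewrite summxE.
Qed.

Lemma mtay_cmt F G A B : mtay F A -> mtay G B ->
  mtay (fun s => cmt (F s) (G s)) (fun n => \sum_(k < n.+1) cmt (A k) (B (n - k)%N)).
Proof.
move=> tF tG; have := mtayB (mtayM tF tG) (mtayMr tF tG).
by rewrite (_ : (fun n => _ - _) = fun n => \sum_(k < n.+1) cmt (A k) (B (n - k)%N))//;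
  apply/funext => n; rewrite -sumrB.
Qed.

Lemma mtay_linl (M : mx) F A : mtay F A -> mtay (fun s => M *m F s) (fun n => M *m A n).
Proof.
move=> tF i j; have := tay_sum (index_enum 'I_N) (fun l => tayZ (M i l) (tF l j)).
rewrite (_ : (fun s => \sum_(l <- _) _) = fun s => (M *m F s) i j); last first.
  by apply/funext => s; rewrite mxE.
by rewrite (_ : (fun n => \sum_(l <- _) _) = fun n => (M *m A n) i j)//;
  apply/funext => s; rewrite mxE.
Qed.

Lemma mtay_linr (M : mx) F A : mtay F A -> mtay (fun s => F s *m M) (fun n => A n *m M).
Proof.
move=> tF i j; have := tay_sum (index_enum 'I_N) (fun l => tayZ (M l j) (tF i l)).
rewrite (_ : (fun s => \sum_(l <- _) _) = fun s => (F s *m M) i j); last first.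
  by apply/funext => s; rewrite mxE; apply: eq_bigr => l _; rewrite mulrC.
by rewrite (_ : (fun n => \sum_(l <- _) _) = fun n => (A n *m M) i j)//;
  apply/funext => s; rewrite mxE; apply: eq_bigr => l _; rewrite mulrC.
Qed.

Lemma mtay_zero F A (d : R) : 0 < d -> (forall s, cn s < d -> F s = 0) ->
  mtay F A -> forall k, A k = 0.
Proof.
move=> d0 F0 tF k; apply/matrixP => i j; rewrite mxE.
by apply: (tay_zero d0 _ (tF i j)) => s /F0 ->; rewrite mxE.
Qed.

(* [Cb x b] and [U x] are the matrices, on column vectors, of multiplication by the b-th flat
   coordinate field and by the Euler field, in flat coordinates where the unit is (1,...,1). *)
Record flat_structure (r : R) (mu : mx) (Cb : pt -> 'I_N -> mx) (U : pt -> mx) : Prop :=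
 FlatStructure {
  fs_C : forall b i j, hol 0 r (fun x => Cb x b i j);
  fs_U : forall i j, hol 0 r (fun x => U x i j);
  fs_comm : forall x, vn x < r -> forall b c, cmt (Cb x b) (Cb x c) = 0;
  fs_CU : forall x, vn x < r -> forall b, cmt (Cb x b) (U x) = 0;
  fs_dU : forall x, vn x < r -> forall b i j,
    pd (fun x => U x i j) b x = (Cb x b + cmt mu (Cb x b)) i j;
  fs_unit : forall x, vn x < r -> forall b i, \sum_j Cb x b i j = (i == b)%:R }.

Definition Cdir (Cb : pt -> 'I_N -> mx) (w x : pt) : mx := \sum_b w 0 b *: Cb x b.

Lemma cmt_suml (A : mx) (w : pt) (B : 'I_N -> mx) :
  cmt (\sum_b w 0 b *: B b) A = \sum_b w 0 b *: cmt (B b) A.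
Proof.
rewrite /cmt mulmx_suml mulmx_sumr -sumrB; apply: eq_bigr => b _.
by rewrite scalerBr scalemxAl scalemxAr.
Qed.

Lemma cmt_sumr (A : mx) (w : pt) (B : 'I_N -> mx) :
  cmt A (\sum_b w 0 b *: B b) = \sum_b w 0 b *: cmt A (B b).
Proof.
rewrite cmtN cmt_suml -sumrN; apply: eq_bigr => b _.
by rewrite -scalerN -cmtN.
Qed.

Lemma flat_taylor (r : R) mu Cb U (w : pt) : 0 < r -> vn w <= 1 ->
  flat_structure r mu Cb U ->
  exists (c u : nat -> mx) (cb : 'I_N -> nat -> mx),
   [/\ taylor_system mu c u cb,
     forall b, mtay (fun s => Cb (s *: w) b) (cb b),
     mtay (fun s => U (s *: w)) u,
     u 0%N = U 0 /\ (forall b, cb b 0%N = Cb 0 b) &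
     forall k, c k = \sum_b w 0 b *: cb b k].
Proof.
move=> r0 w1 [hC hU hcomm hCU hdU hunit].
have sw s : cn s < r -> vn (s *: w) < r.
  by move=> hs; rewrite vnZ; apply: le_lt_trans hs; rewrite ler_piMr ?cn_ge0.
have /choice [a ha] : forall bij : 'I_N * ('I_N * 'I_N), exists a,
    tay (fun s => Cb (s *: w) bij.1 bij.2.1 bij.2.2) a.
  move=> [b [i j]]; have [t t0 /(_ w w1) [a ta _]] := line_taylor r0 (hC b i j).
  by exists a.
pose cb b k : mx := \matrix_(i, j) a (b, (i, j)) k.
have tC b : mtay (fun s => Cb (s *: w) b) (cb b).
  move=> i j; have := ha (b, (i, j)) => /=.
  by rewrite (_ : a _ = fun k => cb b k i j)//; apply/funext => k; rewrite mxE.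
pose c k := \sum_b w 0 b *: cb b k.
have tc : mtay (fun s => Cdir Cb w (s *: w)) c.
  exact: mtay_sum (fun b => mtayZ (w 0 b) (tC b)).
(* Defining [u] by the recursion makes [ts_der] immediate; [tay_int] shows that these are the
   coefficients of [U]. *)
pose u k : mx := if k is k'.+1 then (k'.+1%:R)^-1 *: (c k' + cmt mu (c k')) else U 0.
have tV : mtay (fun s => Cdir Cb w (s *: w) + cmt mu (Cdir Cb w (s *: w)))
    (fun k => c k + cmt mu (c k)).
  exact: mtayD tc (mtayB (mtay_linl mu tc) (mtay_linr mu tc)).
have tU : mtay (fun s => U (s *: w)) u.
  move=> i j.
  have H := tay_int r0 _ (tV i j).
  have := H (fun s => U (s *: w) i j).
  rewrite (_ : (fun k => if k is k'.+1 then _ else _) = fun k => u k i j); last first.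
    apply/funext => -[|k]; first by rewrite scale0r.
    by rewrite /u [RHS]mxE mulrC.
  apply=> s hs; have hx := sw s hs.
  have hx' : vn (s *: w - 0) < r by rewrite subr0.
  have := @fd_line R N (fun x => U x i j) 0 w s _; rewrite add0r => /(_ _ (holo_fd (hU i j _ hx'))).
  rewrite (_ : (fun t => U (0 + t *: w) i j) = fun s => U (s *: w) i j); last first.
    by apply/funext => t; rewrite add0r.
  rewrite (_ : lin _ _ = (Cdir Cb w (s *: w) + cmt mu (Cdir Cb w (s *: w))) i j)//.
  rewrite /Cdir cmt_sumr -big_split summxE /lin; apply: eq_bigr => b _.
  by rewrite hdU//= -scalerDr [RHS]mxE.
exists c, u, cb; split=> //.
- split.
  + by move=> k; rewrite /u scalerA divff ?scale1r// pnatr_eq0.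
  + apply: (mtay_zero r0 _ (mtay_cmt tc tU)) => s /sw hs.
    by rewrite /Cdir cmt_suml big1// => b _; rewrite hCU// scaler0.
  + move=> m b; move: m; apply: (mtay_zero r0 _ (mtay_cmt (tC b) tc)) => s /sw hs.
    by rewrite /Cdir cmt_sumr big1// => b' _; rewrite hcomm// scaler0.
split=> // b; apply/matrixP => i j.
have := tC b i j 1%N => -[K [d [K0 d0 HK]]].
have := HK 0; rewrite cn0 scale0r big_ord1 expr0 mulr1 expr1 mulr0 => /(_ d0) h.
apply/eqP; rewrite eq_sym -subr_eq0 -cn_eq0 eq_le cn_ge0 andbT; exact: h.
Qed.

Lemma flat_unique_line (r : R) mu (u0 : 'I_N -> C) Cb U Cb' U' : 0 < r ->
  flat_structure r mu Cb U -> flat_structure r mu Cb' U' ->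
  (forall a b, u0 a = u0 b -> mu a b = 0) ->
  (forall b, Cb 0 b = delta_mx b b) -> (forall b, Cb' 0 b = delta_mx b b) ->
  U 0 = diag_mx (\row_i u0 i) -> U' 0 = U 0 ->
  exists2 t : R, 0 < t & forall w, vn w <= 1 -> injective (fun i => w 0 i) ->
    forall s, cn s < t -> (forall b, Cb (s *: w) b = Cb' (s *: w) b) /\ U (s *: w) = U' (s *: w).
Proof.
move=> r0 fs fs' mu0 C0 C0' U0 U0'.
have hD (f g : pt -> C) : hol 0 r f -> hol 0 r g -> hol 0 r (fun x => f x + -1 * g x).
  by move=> hf hg q hq; have [] := fd_holo (fdD (holo_fd (hf q hq)) (fdZ (-1) (holo_fd (hg q hq)))).
(* The radius of each entry is fixed before [w]; the minimum over the finitely many entries is then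
   uniform in the direction. *)
have /choice [t1 ht1] : forall bij : 'I_N * ('I_N * 'I_N), exists t : R, 0 < t /\ forall w, vn w <= 1 ->
    exists2 a, tay (fun s => Cb (s *: w) bij.1 bij.2.1 bij.2.2 + -1 * Cb' (s *: w) bij.1 bij.2.1 bij.2.2) a &
      ((forall k, a k = 0) -> forall s, cn s < t ->
        Cb (s *: w) bij.1 bij.2.1 bij.2.2 + -1 * Cb' (s *: w) bij.1 bij.2.1 bij.2.2 = 0).
  move=> [b [i j]]; have [t t0 H] := line_taylor r0 (hD _ _ (fs_C fs b i j) (fs_C fs' b i j)).
  by exists t.
have /choice [t2 ht2] : forall ij : 'I_N * 'I_N, exists t : R, 0 < t /\ forall w, vn w <= 1 ->
    exists2 a, tay (fun s => U (s *: w) ij.1 ij.2 + -1 * U' (s *: w) ij.1 ij.2) a &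
      ((forall k, a k = 0) -> forall s, cn s < t ->
        U (s *: w) ij.1 ij.2 + -1 * U' (s *: w) ij.1 ij.2 = 0).
  move=> [i j]; have [t t0 H] := line_taylor r0 (hD _ _ (fs_U fs i j) (fs_U fs' i j)).
  by exists t.
have [m1 m10 hm1] : exists2 m : R, 0 < m & forall k, m <= t1 k.
  exists (\big[Num.min/1]_k t1 k); first by rewrite lt_bigmin// => k _; have [] := ht1 k.
  by move=> k; exact: bigmin_le_cond.
have [m2 m20 hm2] : exists2 m : R, 0 < m & forall k, m <= t2 k.
  exists (\big[Num.min/1]_k t2 k); first by rewrite lt_bigmin// => k _; have [] := ht2 k.
  by move=> k; exact: bigmin_le_cond.
exists (Num.min m1 m2); first by rewrite lt_min m10.
move=> w w1 winj s; rewrite lt_min => /andP[sm1 sm2].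
have sw z : cn z < r -> vn (z *: w) < r.
  by move=> hs; rewrite vnZ; apply: le_lt_trans hs; rewrite ler_piMr ?cn_ge0.
have [c [u [cb [ts tC tU [u0E cb0] cE]]]] := flat_taylor r0 w1 fs.
have [c' [u' [cb' [ts' tC' tU' [u0E' cb0'] cE']]]] := flat_taylor r0 w1 fs'.
have rcb e k a : \sum_b (cb e k - cb' e k) a b = 0.
  have := mtayB (tC e) (tC' e) => /(_ a) H.
  apply: (tay_zero r0 _ (tay_sum (index_enum 'I_N) (fun b => H b))) => z /sw hz.
  rewrite (eq_bigr (fun b => Cb (z *: w) e a b - Cb' (z *: w) e a b)); last by move=> b _; rewrite !mxE.
  by rewrite sumrB (fs_unit fs)// (fs_unit fs')// subrr.
have c0E : c 0%N = diag_mx (\row_i (fun i => w 0 i) i).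
  rewrite cE; apply/matrixP => i j; rewrite summxE !mxE (bigD1 i)//= cb0 C0 !mxE eqxx.
  rewrite big1 ?addr0; last by move=> b bi; rewrite cb0 C0 !mxE eq_sym (negPf bi) mulr0.
  by rewrite eq_sym; case: eqP; rewrite ?mulr1 ?mulr0.
have E k : [/\ c k = c' k, u k = u' k & forall b, cb b k = cb' b k].
  move: k; apply: (taylor_system_unique winj mu0 ts ts' c0E).
  - by rewrite cE cE'; apply: eq_bigr => b _; rewrite cb0 cb0' C0 C0'.
  - by rewrite u0E U0.
  - by rewrite u0E' u0E.
  - by move=> b; rewrite cb0 cb0' C0 C0'.
  - move=> k a; rewrite cE cE' -sumrB.
    rewrite (eq_bigr (fun b => \sum_e w 0 e * (cb e k - cb' e k) a b)); last first.
      by move=> b _; rewrite summxE; apply: eq_bigr => e _; rewrite -scalerBr mxE.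
    by rewrite exchange_big big1// => e _; rewrite -mulr_sumr rcb mulr0.
  - exact: rcb.
split=> [b|]; apply/matrixP => i j.
  have [_ /(_ w w1) [a ta Ha]] := ht1 (b, (i, j)); rewrite /= in ta Ha.
  have := Ha _ s (lt_le_trans sm1 (hm1 _)); rewrite mulN1r => /(_ _)/subr0_eq; apply.
  have t0 := tayD (tC b i j) (tayZ (-1) (tC' b i j)).
  move=> k; rewrite (tay_unique ta t0); have [_ _ ->] := E k.
  by rewrite mulN1r subrr.
have [_ /(_ w w1) [a ta Ha]] := ht2 (i, j); rewrite /= in ta Ha.
have := Ha _ s (lt_le_trans sm2 (hm2 _)); rewrite mulN1r => /(_ _)/subr0_eq; apply.
have t0 := tayD (tU i j) (tayZ (-1) (tU' i j)).
move=> k; rewrite (tay_unique ta t0); have [_ -> _] := E k.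
by rewrite mulN1r subrr.
Qed.

(** Along x + s (0, 1, ..., N-1) two given coordinates coincide for at most one s, and one of the
    infinitely many values [ep n] avoids the finite list [B] of exceptions. *)
Lemma generic_near (x : pt) (e : R) : 0 < e ->
  exists2 y : pt, vn (y - x) < e & injective (fun i => y 0 i).
Proof.
move=> e0; pose v : pt := \row_(a < N) (a : nat)%:R.
have V0 : 0 < vn v + 1 by have := vn_ge0 v; clear; lra.
pose ep n : R := e / (vn v + 1) / n.+1%:R.
have ep0 n : 0 < ep n by rewrite !divr_gt0.
(* Pairs with equal entries only add the harmless value 0, since every [ep n] is positive. *)
pose B : seq C := [seq - (x 0 ab.1 - x 0 ab.2) / ((ab.1 : nat)%:R - (ab.2 : nat)%:R) |
   ab <- enum {: 'I_N * 'I_N}].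
have [n nB] : exists n, ((ep n)%:C%C : C) \notin B.
  apply: contrapT => H.
  have sub : {subset [seq ((ep n)%:C%C : C) | n <- iota 0 (size B).+1] <= B}.
    move=> z /mapP [n _ ->]; apply: contrapT => /negP h; apply: H; by exists n.
  have inj : injective (fun n => ((ep n)%:C%C : C)).
    move=> n m /complexI /= h; have : (n.+1%:R : R)^-1 = m.+1%:R^-1.
      by apply: (mulfI _ h); rewrite gt_eqF// divr_gt0.
    by move=> /invr_inj /eqP; rewrite eqr_nat => /eqP [].
  have := uniq_leq_size _ sub; rewrite map_inj_uniq// iota_uniq => /(_ isT).
  by rewrite size_map size_iota ltnn.
exists (x + (ep n)%:C%C *: v).
  rewrite add1K vnZ cnRp; last exact: ltW.
  apply: le_lt_trans (_ : e / (vn v + 1) * vn v < _).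
    apply: ler_wpM2r; first exact: vn_ge0.
    rewrite /ep ler_pdivrMr// ler_peMr ?ler1n//; apply: ltW; exact: divr_gt0.
  by rewrite mulrAC ltr_pdivrMr// ltr_pM2l// ltrDl.
move=> a b; rewrite !mxE => E; apply/eqP/negPn/negP => ab.
have ab' : (a : nat)%:R - (b : nat)%:R != 0 :> C.
  by rewrite subr_eq0 eqr_nat.
move/negP: nB; apply; apply/mapP; exists (a, b); first by rewrite mem_enum.
have E2 : (ep n)%:C%C * ((a : nat)%:R - (b : nat)%:R) = - (x 0 a - x 0 b) :> C.
  apply/eqP; rewrite -subr_eq0 opprK; apply/eqP.
  by move/eqP: E; rewrite -subr_eq0 => /eqP <-; ring.
by rewrite /= -E2 mulfK.
Qed.

Theorem flat_unique (r : R) mu (u0 : 'I_N -> C) Cb U Cb' U' : 0 < r ->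
  flat_structure r mu Cb U -> flat_structure r mu Cb' U' ->
  (forall a b, u0 a = u0 b -> mu a b = 0) ->
  (forall b, Cb 0 b = delta_mx b b) -> (forall b, Cb' 0 b = delta_mx b b) ->
  U 0 = diag_mx (\row_i u0 i) -> U' 0 = U 0 ->
  exists2 t : R, 0 < t & forall x, vn x < t ->
    (forall b, Cb x b = Cb' x b) /\ U x = U' x.
Proof.
move=> r0 fs fs' mu0 C0 C0' U0 U0'.
have [t t0 H] := flat_unique_line r0 fs fs' mu0 C0 C0' U0 U0'.
have gen x : vn x < t -> injective (fun i => x 0 i) ->
    (forall b, Cb x b = Cb' x b) /\ U x = U' x.
  move=> xt xinj; have [x0|xn0] := eqVneq (vn x) 0.
    by rewrite (vn_eq0 x0) U0'; split=> // b; rewrite C0 C0'.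
  have xp : 0 < vn x by rewrite lt_neqAle eq_sym xn0 vn_ge0.
  have s0 : (vn x)%:C%C != 0 :> C by rewrite -cn_gt0 cnRp// ltW.
  (* The point lies at parameter |x| on the line directed by x / |x|. *)
  have [|//||] := H ((vn x)%:C%C^-1 *: x) _ _ (vn x)%:C%C.
  - by rewrite vnZ cnV cnRp ?mulVf// ltW.
  - move=> i j; rewrite !mxE => /(mulfI (invr_neq0 s0)); exact: xinj.
  - by rewrite cnRp// ltW.
  by rewrite scalerA divff// scale1r.
exists (Num.min t r); first by rewrite lt_min t0.
move=> x; rewrite lt_min => /andP[xt xr].
have dens (f g : pt -> C) : hol 0 r f -> hol 0 r g ->
    (forall y, vn y < t -> injective (fun i => y 0 i) -> f y = g y) -> f x = g x.
  move=> hf hg fg; apply/eqP; rewrite -subr_eq0; apply/eqP.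
  apply: (@cn_small_eq0 R _ 2) => e e0.
  have xr' : vn (x - 0) < r by rewrite subr0.
  have [d1 d10 h1] := fd_cont (holo_fd (hf _ xr')) e0.
  have [d2 d20 h2] := fd_cont (holo_fd (hg _ xr')) e0.
  have m0 : 0 < Num.min (t - vn x) (Num.min d1 d2) by rewrite !lt_min subr_gt0 xt d10.
  have [y] := generic_near x m0; rewrite !lt_min => /and3P[yt yd1 yd2] yinj.
  have yt' : vn y < t.
    by have := vnD x (y - x); rewrite addrC subrK; move: yt; clear; lra.
  have -> : f x - g x = (g y - g x) - (f y - f x) by rewrite (fg y yt' yinj); ring.
  apply: le_trans (cnB _ _) _; have := h1 _ yd1; have := h2 _ yd2; clear; lra.
split=> [b|]; apply/matrixP => i j.
  apply: (dens (fun x => Cb x b i j) (fun x => Cb' x b i j)); [exact: (fs_C fs)|exact: (fs_C fs')|].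
  by move=> y yt yi; have [-> _] := gen y yt yi.
apply: (dens (fun x => U x i j) (fun x => U' x i j)); [exact: (fs_U fs)|exact: (fs_U fs')|].
by move=> y yt yi; have [_ ->] := gen y yt yi.
Qed.

End FlatUnique.

(** * Frobenius structures in flat coordinates *)

Section MatrixCalculus.
Variable R : realType.
Local Notation C := R[i].
Variable N : nat.
Local Notation pt := ('rV[C]_N).

Definition mfd m n (F : pt -> 'M[C]_(m, n)) (p : pt) (A : 'I_N -> 'M[C]_(m, n)) :=
  forall i j, fd (fun q => F q i j) p (fun b => A b i j).

Lemma mfdM m n k (F : pt -> 'M[C]_(m, n)) (G : pt -> 'M[C]_(n, k)) p A B :
  mfd F p A -> mfd G p B ->
  mfd (fun q => F q *m G q) p (fun b => A b *m G p + F p *m B b).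
Proof.
move=> hF hG i j.
have := fd_sum (index_enum 'I_n) (fun l => fdM (hF i l) (hG l j)).
rewrite (_ : (fun q => \sum_(l <- _) _) = fun q => (F q *m G q) i j); last first.
  by apply/funext => q; rewrite mxE.
rewrite (_ : (fun b => \sum_(l <- _) _) = fun b => (A b *m G p + F p *m B b) i j)//.
by apply/funext => b; rewrite !mxE -big_split.
Qed.

Lemma mfd_comp m n (F : pt -> 'M[C]_(m, n)) (psi : pt -> pt) p A (b : 'I_N -> 'I_N -> C) :
  mfd F (psi p) A -> (forall k, fd (fun q => psi q 0 k) p (b k)) ->
  mfd (fun q => F (psi q)) p (fun i => \sum_k b k i *: A k).
Proof.
move=> hF hp i j; have := fd_comp (hF i j) hp.
rewrite (_ : (fun i0 => \sum_k b k i0 * A k i j) = fun b0 => (\sum_k b k b0 *: A k) i j)//.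
by apply/funext => b0; rewrite summxE; apply: eq_bigr => k _; rewrite mxE.
Qed.

Lemma mfd_unique m n (F : pt -> 'M[C]_(m, n)) p A B : mfd F p A -> mfd F p B ->
  forall b, A b = B b.
Proof.
move=> hA hB b; apply/matrixP => i j.
exact: (congr1 (fun f => f b) (fd_unique (hA i j) (hB i j))).
Qed.

Lemma mfd_near m n (F G : pt -> 'M[C]_(m, n)) p A (d : R) : 0 < d ->
  (forall q, vn (q - p) < d -> F q = G q) -> mfd F p A -> mfd G p A.
Proof.
by move=> d0 FG hF i j; apply: (fd_near d0 _ (hF i j)) => q /FG ->.
Qed.

Lemma mfd_cst m n (M : 'M[C]_(m, n)) p : mfd (fun=> M) p (fun=> 0).
Proof.
move=> i j; have -> : (fun b : 'I_N => (0 : 'M[C]_(m, n)) i j) = fun=> 0.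
  by apply/funext => b; rewrite mxE.
exact: fd_cst.
Qed.

Definition mhol m n (r : R) (F : pt -> 'M[C]_(m, n)) :=
  forall p, vn p < r -> exists A, mfd F p A.

Lemma mhol_hol m n (r : R) (F : pt -> 'M[C]_(m, n)) i j : mhol r F -> hol 0 r (fun q => F q i j).
Proof.
by move=> H q; rewrite subr0 => /H [A hA]; have [] := fd_holo (hA i j).
Qed.

Lemma hol_mhol m n (r : R) (F : pt -> 'M[C]_(m, n)) :
  (forall i j, hol 0 r (fun q => F q i j)) -> mhol r F.
Proof.
move=> H p hp; exists (fun b => \matrix_(i, j) pd (fun q => F q i j) b p) => i j.
have -> : (fun b => (\matrix_(i, j) pd (fun q => F q i j) b p : 'M[C]_(m, n)) i j) =
    fun b => pd (fun q => F q i j) b p.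
  by apply/funext => b; rewrite mxE.
by apply: holo_fd; apply: H; rewrite subr0.
Qed.

Lemma mhol_mul m n k (r : R) (F : pt -> 'M[C]_(m, n)) (G : pt -> 'M[C]_(n, k)) :
  mhol r F -> mhol r G -> mhol r (fun q => F q *m G q).
Proof.
by move=> hF hG p hp; have [A hA] := hF p hp; have [B hB] := hG p hp; eexists; exact: mfdM hA hB.
Qed.

Lemma mhol_sub m n (r s : R) (F : pt -> 'M[C]_(m, n)) : s <= r -> mhol r F -> mhol s F.
Proof. by move=> sr H p hp; apply: H; exact: lt_le_trans sr. Qed.

Lemma mhol_ext m n (r : R) (F G : pt -> 'M[C]_(m, n)) :
  (forall p, vn p < r -> F p = G p) -> mhol r F -> mhol r G.
Proof.
move=> FG hF p hp; have [A hA] := hF p hp; exists A.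
have d0 : 0 < r - vn p by rewrite subr_gt0.
apply: (mfd_near d0 _ hA).
move=> q hq; apply: FG; have := vnD p (q - p); rewrite (addrC p) subrK.
by move: hq; clear; lra.
Qed.

Lemma mfd_const m n (r : R) (F : pt -> 'M[C]_(m, n)) :
  (forall p, vn p < r -> mfd F p (fun=> 0)) -> forall p, vn p < r -> F p = F 0.
Proof.
move=> H p hp; apply/matrixP => i j; apply/eqP; rewrite -subr_eq0; apply/eqP.
apply: (@cn_small_eq0 R _ 0) => e _; rewrite mul0r.
have := @crderiv_le R (fun t : R => F (0 + t%:C%C *: p) i j) (fun=> 0) 0 0 1 ler01.
rewrite scale1r scale0r !add0r mulr0 mul0r; apply=> t; last by rewrite cn0.
move=> /andP[t0 t1].
have h : vn (0 + t%:C%C *: p) < r.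
  by rewrite add0r vnZ cnRp//; apply: le_lt_trans hp; rewrite ler_piMl ?vn_ge0.
have := fd_curve (H _ h i j).
rewrite (_ : lin _ p = 0)// /lin big1// => k _.
by rewrite mxE mulr0.
Qed.

End MatrixCalculus.

(** * Separation of the powers of z in the flatness equations *)

Section FrobeniusLocal.
Variable R : realType.
Local Notation C := R[i].
Variable N : nat.
Local Notation pt := ('rV[C]_N).
Implicit Types (g : pt -> 'M[C]_N) (c : pt -> 'I_N -> 'I_N -> pt) (e E : pt -> pt) (D : C).

Lemma zder_Ai (a b z : C) : z != 0 -> zder (fun w => a - w^-1 * b) z = z^-2 * b.
Proof.
move=> z0.
have h := cdD (cd_cst a z) (cdZ (- b) (cdV z0 (@cd_id R z))).
have /cdP [_ E] := h.
have F : (fun w => a - w^-1 * b) = (fun w => a + - b * w^-1).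
  by apply/funext => w; rewrite mulNr mulrC.
by rewrite /zder F; apply: etrans E _; field.
Qed.

(** The value 0 is excluded, so the coefficients are recovered from y = 1, -1 and 2. *)
Lemma quad_zero (a b c' : C) : (forall y : C, y != 0 -> a + y * b + y ^+ 2 * c' = 0) ->
  [/\ a = 0, b = 0 & c' = 0].
Proof.
move=> H; have h1 : a + b + c' = 0.
  by have := H 1 (oner_neq0 _); rewrite mul1r expr1n mul1r.
have h2 : a - b + c' = 0.
  have m0 : -1 != 0 :> C by rewrite oppr_eq0 oner_neq0.
  by rewrite -[RHS](H _ m0); ring.
have n2 : 2%:R != 0 :> C by rewrite pnatr_eq0.
have h3 : a + 2%:R * b + 4%:R * c' = 0 by rewrite -[RHS](H _ n2); ring.
have b0 : b = 0.
  apply: (mulfI n2); rewrite mulr0.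
  have -> : 2%:R * b = (a + b + c') - (a - b + c') by ring.
  by rewrite h1 h2 subrr.
have c0 : c' = 0.
  have n3 : 3%:R != 0 :> C by rewrite pnatr_eq0.
  apply: (mulfI n3); rewrite mulr0.
  have -> : 3%:R * c' = (a + 2%:R * b + 4%:R * c') - (a + b + c') - b by ring.
  by rewrite h1 h3 b0 !subrr.
by split=> //; rewrite -h1 b0 c0 !addr0.
Qed.

Lemma cmtZl (F : numFieldType) (a : F) (A B : 'M[F]_N) : cmt (a *: A) B = a *: cmt A B.
Proof. by rewrite /cmt scalerBr scalemxAl scalemxAr. Qed.

Lemma cmtZr (F : numFieldType) (a : F) (A B : 'M[F]_N) : cmt A (a *: B) = a *: cmt A B.
Proof. by rewrite /cmt -scalemxAr -scalemxAl scalerBr. Qed.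

Lemma mxBZ (A B : 'M[C]_N) a k l : (A - a *: B) k l = A k l - a * B k l.
Proof. by rewrite !mxE. Qed.

Lemma mxB3 (A B B' : 'M[C]_N) k l : (A - B - B') k l = A k l - B k l - B' k l.
Proof. by rewrite !mxE. Qed.

Lemma oppmxE (A : 'M[C]_N) k l : (- A) k l = - A k l.
Proof. by rewrite !mxE. Qed.

Lemma mxZBZ (A B : 'M[C]_N) a b k l : (a *: A - b *: B) k l = a * A k l - b * B k l.
Proof. by rewrite !mxE. Qed.

(** The curvature in two directions of M is quadratic in y = 1/z, and its leading coefficient is the
    commutator of the two multiplications. *)
Lemma flat_pair (Gi Gj Ci Cj : 'M[C]_N) (g1 g2 c1 c2 : C) k l :
  (forall z : C, z != 0 -> g1 - z^-1 * c1 - (g2 - z^-1 * c2) +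
     cmt (Gi - z^-1 *: Ci) (Gj - z^-1 *: Cj) k l = 0) -> cmt Ci Cj k l = 0.
Proof.
move=> H.
have S (x1 x2 x3 x4 y : C) : g1 - y * c1 - (g2 - y * c2) + (x1 - y * x2 - y * (x3 - y * x4)) =
  (g1 - g2 + x1) + y * (- (c1 - c2 + (x2 + x3))) + y ^+ 2 * x4 by ring.
have E y : cmt (Gi - y *: Ci) (Gj - y *: Cj) k l =
  cmt Gi Gj k l - y * cmt Gi Cj k l - y * (cmt Ci Gj k l - y * cmt Ci Cj k l).
  have M (A B A' B' : 'M[C]_N) :
      (A - y *: B - (y *: A' - y *: (y *: B'))) k l = A k l - y * B k l - y * (A' k l - y * B' k l).
    by rewrite !mxE mulrBr.
  by rewrite cmtBl !cmtBr !cmtZl !cmtZr; exact: M.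
have [|_ _ //] := @quad_zero (g1 - g2 + cmt Gi Gj k l)
  (- (c1 - c2 + (cmt Gi Cj k l + cmt Ci Gj k l))) (cmt Ci Cj k l).
move=> y y0; have z0 : y^-1 != 0 by rewrite invr_eq0.
have H1 := H _ z0; rewrite invrK E in H1.
exact: etrans (esym (S (cmt Gi Gj k l) (cmt Gi Cj k l) (cmt Ci Gj k l) (cmt Ci Cj k l) y)) H1.
Qed.

(** The mixed curvature is y = 1/z times a quadratic polynomial in y; its coefficients give, in
    order, the covariant constancy of mu, the covariant derivative of multiplication by E, and its
    commutation with the d_i. *)
Lemma flat_pair_z (Gi Ci U h : 'M[C]_N) (u1 h1 : C) k l :
  (forall z : C, z != 0 -> z^-2 * u1 - z^-1 * h1 - z^-2 * Ci k l +
     cmt (Gi - z^-1 *: Ci) (z^-2 *: U - z^-1 *: h) k l = 0) ->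
  [/\ - h1 - cmt Gi h k l = 0,
    u1 - Ci k l + cmt Gi U k l + cmt Ci h k l = 0 & - cmt Ci U k l = 0].
Proof.
move=> H.
have S (x1 x2 x3 x4 y : C) : y ^+ 2 * u1 - y * h1 - y ^+ 2 * Ci k l +
     (y ^+ 2 * x1 - y * x2 - y * (y ^+ 2 * x3 - y * x4)) =
  y * ((- h1 - x2) + y * (u1 - Ci k l + x1 + x4) + y ^+ 2 * (- x3)) by ring.
have E y : cmt (Gi - y *: Ci) (y ^+ 2 *: U - y *: h) k l =
  y ^+ 2 * cmt Gi U k l - y * cmt Gi h k l - y * (y ^+ 2 * cmt Ci U k l - y * cmt Ci h k l).
  have M (A B A' B' : 'M[C]_N) :
      (y ^+ 2 *: A - y *: B - (y *: (y ^+ 2 *: A') - y *: (y *: B'))) k l =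
      y ^+ 2 * A k l - y * B k l - y * (y ^+ 2 * A' k l - y * B' k l).
    by rewrite !mxE mulrBr.
  by rewrite cmtBl !cmtBr !cmtZl !cmtZr; exact: M.
apply: quad_zero => y y0; have z0 : y^-1 != 0 by rewrite invr_eq0.
apply: (mulfI y0); rewrite mulr0.
have H1 := H _ z0; rewrite exprVn !invrK E in H1.
exact: etrans (esym (S (cmt Gi U k l) (cmt Gi h k l) (cmt Ci U k l) (cmt Ci h k l) y)) H1.
Qed.

Lemma flat_at_split g c E D p
  (Gd Cd : 'I_N -> 'I_N -> 'M[C]_N) (Ud hd : 'I_N -> 'M[C]_N) :
  (forall i, mfd (Gam g i) p (Gd i)) -> (forall i, mfd (Cm c i) p (Cd i)) ->
  mfd (Um c E) p Ud -> mfd (hodge g E D) p hd ->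
  (forall z, z != 0 -> flat_at g c E D p z) ->
  [/\ forall i j, cmt (Cm c i p) (Cm c j p) = 0,
      forall i, cmt (Cm c i p) (Um c E p) = 0,
      forall i, Ud i = Cm c i p - cmt (Gam g i p) (Um c E p) - cmt (Cm c i p) (hodge g E D p) &
      forall i, hd i = - cmt (Gam g i p) (hodge g E D p)].
Proof.
move=> hG hC hU hh H.
have pA i j k l z : pd (fun q => Ai g c j q z k l) i p = Gd j i k l - z^-1 * Cd j i k l.
  have h := fdD (hG j k l) (fdZ (- z^-1) (hC j k l)).
  rewrite (_ : (fun q => Ai g c j q z k l) = fun q => Gam g j q k l + - z^-1 * Cm c j q k l).
    by have [_ ->] := fd_holo h; rewrite mulNr.
  by apply/funext => q; rewrite /Ai mxBZ mulNr.
have pZ i k l z : pd (fun q => Az g c E D q z k l) i p = z^-2 * Ud i k l - z^-1 * hd i k l.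
  have h := fdD (fdZ (z^-2) (hU k l)) (fdZ (- z^-1) (hh k l)).
  rewrite (_ : (fun q => Az g c E D q z k l) = fun q => z^-2 * Um c E q k l + - z^-1 * hodge g E D q k l).
    by have [_ ->] := fd_holo h; rewrite mulNr.
  by apply/funext => q; rewrite /Az mxZBZ mulNr.
have zA i k l z : z != 0 -> zder (fun w => Ai g c i p w k l) z = z^-2 * Cm c i p k l.
  move=> z0; apply: etrans _ (zder_Ai (Gam g i p k l) (Cm c i p k l) z0).
  congr (zder _ z).
  by apply/funext => w; rewrite /Ai mxBZ.
have K1 i j k l : cmt (Cm c i p) (Cm c j p) k l = 0.
  apply: (@flat_pair (Gam g i p) (Gam g j p) (Cm c i p) (Cm c j p)
    (Gd j i k l) (Gd i j k l) (Cd j i k l) (Cd i j k l)) => z z0.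
  rewrite -(pA i j k l z) -(pA j i k l z).
  by have [h _] := H z z0; exact: h.
have K2 i k l : [/\ - hd i k l - cmt (Gam g i p) (hodge g E D p) k l = 0,
    Ud i k l - Cm c i p k l + cmt (Gam g i p) (Um c E p) k l + cmt (Cm c i p) (hodge g E D p) k l = 0 &
    - cmt (Cm c i p) (Um c E p) k l = 0].
  apply: flat_pair_z => z z0.
  rewrite -(pZ i k l z) -(zA i k l z z0).
  by have [_ h] := H z z0; exact: h.
split=> i; [move=> j| | |]; apply/matrixP => k l.
- by rewrite K1 mxE.
- by have [_ _ /eqP] := K2 i k l; rewrite oppr_eq0 => /eqP ->; rewrite mxE.
- have S (x y u v : C) : u - v + x + y = 0 -> u = v - x - y.
    by move=> h; apply/eqP; rewrite -subr_eq0 -[X in _ == X]h; apply/eqP; ring.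
  by have [_ h _] := K2 i k l; apply: etrans (S _ _ _ _ h) _; rewrite mxB3.
- have S (x u : C) : - u - x = 0 -> u = - x.
    by move=> h; apply/eqP; rewrite -subr_eq0 -oppr_eq0 -[X in _ == X]h; apply/eqP; ring.
  by have [h _ _] := K2 i k l; apply: etrans (S _ _ h) _; rewrite oppmxE.
Qed.

End FrobeniusLocal.

(** * Flat charts and the flat frame *)

Section Chart.
Variable R : realType.
Local Notation C := R[i].
Local Notation re := (@complex.Re R).
Variable N : nat.
Local Notation pt := ('rV[C]_N).
Local Notation ptN := ('rV[C]_N : normedModType C).
Local Notation mx := 'M[C]_N.
Implicit Types (g : pt -> mx) (c : pt -> 'I_N -> 'I_N -> pt) (e E : pt -> pt) (D : C).

Lemma holD (p : pt) (r : R) (f h : pt -> C) : hol p r f -> hol p r h -> hol p r (fun q => f q + h q).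
Proof. by move=> hf hh q hq; have [] := fd_holo (fdD (holo_fd (hf q hq)) (holo_fd (hh q hq))). Qed.

Lemma holM (p : pt) (r : R) (f h : pt -> C) : hol p r f -> hol p r h -> hol p r (fun q => f q * h q).
Proof. by move=> hf hh q hq; have [] := fd_holo (fdM (holo_fd (hf q hq)) (holo_fd (hh q hq))). Qed.

Lemma hol_cst (p : pt) (r : R) (a : C) : hol p r (fun=> a : C).
Proof. by move=> q _; have [] := fd_holo (fd_cst a q). Qed.

Lemma hol_sum (p : pt) (r : R) (I : Type) (s : seq I) (F : I -> pt -> C) :
  (forall i, hol p r (F i)) -> hol p r (fun q => \sum_(i <- s) F i q).
Proof.
by move=> H q hq; have [] := fd_holo (fd_sum s (fun i => holo_fd (H i q hq))).
Qed.

Lemma hol_le (p : pt) (r s : R) (f : pt -> C) : s <= r -> hol p r f -> hol p s f.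
Proof. by move=> sr H q hq; apply: H; exact: lt_le_trans sr. Qed.

Lemma mhol_comp m n (r s : R) (F : pt -> 'M[C]_(m, n)) (psi : pt -> pt) :
  (forall x, vn x < r -> vn (psi x) < s) -> (forall k, hol 0 r (fun x => psi x 0 k)) ->
  mhol s F -> mhol r (fun x => F (psi x)).
Proof.
move=> hs hp hF x xr; have [A hA] := hF _ (hs x xr).
have xr' : vn (x - 0) < r by rewrite subr0.
by eexists; apply: mfd_comp hA _ => k; exact: holo_fd (hp k _ xr').
Qed.

Lemma mfd_tr m n (F : pt -> 'M[C]_(m, n)) p A : mfd F p A ->
  mfd (fun x => (F x)^T) p (fun b => (A b)^T).
Proof.
move=> hA i j.
have := hA j i; rewrite (_ : (fun q => F q j i) = fun q => (F q)^T i j).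
  by rewrite (_ : (fun b => A b j i) = fun b => (A b)^T i j)//; apply/funext => b; rewrite mxE.
by apply/funext => q; rewrite mxE.
Qed.

Lemma mhol_tr m n (r : R) (F : pt -> 'M[C]_(m, n)) : mhol r F -> mhol r (fun x => (F x)^T).
Proof. by move=> hF x /hF [A hA]; eexists; exact: mfd_tr hA. Qed.

Definition Djac (phi : pt -> pt) (i : 'I_N) (p : pt) : mx :=
  \matrix_(l, a) pd (fun q => jac phi q l a) i p.

Lemma jac_fun (phi : pt -> pt) l a : (fun q => jac phi q l a) = pd (fun q => phi q 0 a) l.
Proof. by apply/funext => q; exact: jacE. Qed.

Lemma DjacE (phi : pt -> pt) i p l a :
  Djac phi i p l a = pd (pd (fun q => phi q 0 a) l) i p.
Proof. by rewrite -(jac_fun phi l a); exact: mxE. Qed.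

Lemma mfd_jac (s : R) (phi : pt -> pt) p : (forall a, hol 0 s (fun q => phi q 0 a)) ->
  vn p < s -> mfd (jac phi) p (fun i => Djac phi i p).
Proof.
move=> hphi ps l a; have ps' : vn (p - 0) < s by rewrite subr0.
rewrite (jac_fun phi l a).
have -> : (fun i => Djac phi i p l a) = fun i => pd (pd (fun q => phi q 0 a) l) i p.
  by apply/funext => i; exact: DjacE phi i p l a.
exact: holo_fd (hol_pd l (hphi a) ps').
Qed.

Lemma Djac_sym (s : R) (phi : pt -> pt) p i l a : (forall a, hol 0 s (fun q => phi q 0 a)) ->
  vn p < s -> Djac phi i p l a = Djac phi l p i a.
Proof.
move=> hphi ps; apply: etrans (DjacE phi i p l a) _; apply: etrans _ (esym (DjacE phi l p i a)).
apply: (@schwarz _ _ (fun q => phi q 0 a) p (s - vn p)).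
  by rewrite subr_gt0.
by apply: hol_sub (hphi a) _; rewrite subr0 addrC subrK.
Qed.

(** Of the six terms in the Christoffel combination four cancel by symmetry of [T] and two coincide,
    absorbing the factor 1/2. *)
Lemma Gam_of_deriv g p i (T : 'I_N -> mx) :
  (forall k m l, pd (fun q => g q m l) k p = T k m l + T k l m) ->
  (forall k l m, T k l m = T l k m) -> Gam g i p = invmx (g p) *m (T i)^T.
Proof.
move=> dg Ts.
have half (w a b d x y z : C) : a = x + y -> b = z + y -> d = x + z ->
    2^-1 * (w * (a + b - d)) = w * y.
  by move=> -> -> ->; field.
apply/matrixP => k l.
have -> : Gam g i p k l = christoffel g p k i l by exact: mxE.
have -> : (invmx (g p) *m (T i)^T) k l = \sum_m invmx (g p) k m * T i l m.
  by rewrite mxE; apply: eq_bigr => m _; congr (_ * _); exact: mxE.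
rewrite /christoffel mulr_sumr; apply: eq_bigr => m _.
have E1 := dg i m l; have E2 := dg l m i; have E3 := dg m i l.
rewrite (Ts l i m) in E2; rewrite (Ts m i l) (Ts m l i) in E3.
exact: (half _ _ _ _ _ _ _ E1 E2 E3).
Qed.

(* In a flat chart the Christoffel matrices are the logarithmic derivatives of J^T. *)
Lemma christoffel_chart (s : R) g (phi : pt -> pt) (G0 : mx) p i :
  (forall a, hol 0 s (fun q => phi q 0 a)) ->
  (forall q, vn q < s -> g q = jac phi q *m G0 *m (jac phi q)^T) ->
  G0^T = G0 -> vn p < s -> g p \in unitmx -> jac phi p \in unitmx ->
  (jac phi p)^T *m Gam g i p = (Djac phi i p)^T.
Proof.
move=> hphi hg G0s ps gu Ju; set J := jac phi p in Ju *.
have alg (A B G : mx) : G^T = G ->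
    (A *m G + B *m 0) *m B^T + B *m G *m A^T = A *m (G *m B^T) + (A *m (G *m B^T))^T.
  by move=> Gs; rewrite mulmx0 addr0 !trmx_mul trmxK Gs -!mulmxA.
(* The product rule applied to J G0 J^T gives [T k] plus its transpose; [T] is symmetric in its
   first two indices because second derivatives commute. *)
pose T k := Djac phi k p *m (G0 *m J^T).
have hgd : mfd g p (fun k => T k + (T k)^T).
  have hJ := mfd_jac hphi ps.
  have := mfdM (mfdM hJ (mfd_cst G0 p)) (mfd_tr hJ).
  have d0 : 0 < s - vn p by rewrite subr_gt0.
  have near q : vn (q - p) < s - vn p -> jac phi q *m G0 *m (jac phi q)^T = g q.
    move=> hq; rewrite hg//; have := vnD p (q - p); rewrite (addrC p) subrK.
    by move: hq; clear; lra.
  move=> /(mfd_near d0 near) H k l.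
  have := H k l; rewrite (_ : (fun b => _) = fun b => (T b + (T b)^T) k l)//.
  apply/funext => b; congr ((_ : mx) k l).
  exact: alg.
have dg k m l : pd (fun q => g q m l) k p = T k m l + T k l m.
  by have [_ ->] := fd_holo (hgd m l); rewrite !mxE.
have Ts k l m : T k l m = T l k m.
  have S (A B W : mx) : (forall a, A l a = B k a) -> (A *m W) l m = (B *m W) k m.
    by move=> AB; rewrite !mxE; apply: eq_bigr => a _; rewrite AB.
  by apply: S => a; exact: (Djac_sym k l a hphi ps).
have GamE := Gam_of_deriv i dg Ts.
clear alg dg Ts hgd.
have gJ : invmx (g p) *m (J *m G0 *m J^T) = 1%:M by rewrite -hg// mulVmx.
have JTu : row_free J^T by rewrite row_free_unit unitmx_tr.
have solve (I J' G A : mx) : G^T = G -> row_free J'^T -> I *m (J' *m G *m J'^T) = 1%:M ->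
    J'^T *m (I *m (A *m (G *m J'^T))^T) = A^T.
  move=> Gs Jf IJ; rewrite !trmx_mul trmxK Gs.
  have K : J'^T *m I *m J' *m G = 1%:M.
    apply: (row_free_inj Jf).
    by rewrite mul1mx -!mulmxA (mulmxA J' G) IJ mulmx1.
  by rewrite !mulmxA K mul1mx.
rewrite GamE; exact: solve.
Qed.

(** Here dS = S G, and conjugation by the frame change [S] turns the covariant derivative dF +
    [G, F] into a plain one. Differentiating the identity (S F T) S = S F avoids differentiating the
    inverse [T]. *)
Lemma gauge_deriv (S T F : pt -> mx) x (d : R) (G DF A : 'I_N -> mx) : 0 < d ->
  (forall y, vn (y - x) < d -> T y *m S y = 1%:M) ->
  mfd S x (fun b => S x *m G b) -> mfd F x DF ->
  mfd (fun y => S y *m F y *m T y) x A ->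
  forall b, A b = S x *m (DF b + cmt (G b) (F x)) *m T x.
Proof.
move=> d0 TS hS hF hA b.
have h1 := mfdM hA hS; have h2 := mfdM hS hF.
have near y : vn (y - x) < d -> S y *m F y *m T y *m S y = S y *m F y.
  by move=> hy; rewrite -mulmxA TS// mulmx1.
have := mfd_unique (mfd_near d0 near h1) h2 b.
have TSx : T x *m S x = 1%:M by apply: TS; rewrite subrr vn0.
have STx : S x *m T x = 1%:M by apply: mulmx1C.
have -> : S x *m F x *m T x *m (S x *m G b) = S x *m (F x *m G b).
  by rewrite !mulmxA -(mulmxA _ (T x)) TSx mulmx1.
move=> H; have rot (V : zmodType) (a b' c' d' : V) : a + b' = c' + d' -> a = d' + (c' - b').
  by move=> h; rewrite addrA (addrC d') -h addrK.
have K : A b *m S x = S x *m (DF b + cmt (G b) (F x)).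
  by apply: etrans (rot _ _ _ _ _ H) _; rewrite /cmt mulmxDr mulmxBr !mulmxA.
by rewrite -K -mulmxA STx mulmx1.
Qed.

Record frob_chart (s : R) g c e E D (phi : pt -> pt) (G0 : mx) : Prop := FrobChart {
  fc_phi : forall a, hol 0 s (fun q => phi q 0 a);
  fc_c : forall i j k, hol 0 s (fun q => c q i j 0 k);
  fc_eh : forall k, hol 0 s (fun q => e q 0 k);
  fc_Eh : forall k, hol 0 s (fun q => E q 0 k);
  fc_G0 : G0^T = G0;
  fc_g : forall p, vn p < s -> g p = jac phi p *m G0 *m (jac phi p)^T;
  fc_gu : forall p, vn p < s -> g p \in unitmx;
  fc_J : forall p, vn p < s -> jac phi p \in unitmx;
  fc_cC : forall p, vn p < s -> forall i j, c p i j = c p j i;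
  fc_unit : forall p, vn p < s -> forall X, prod c p (e p) X = X;
  fc_e : forall p, vn p < s -> forall i k, pd (fun p => e p 0 k) i p
                + \sum_(l < N) christoffel g p k i l * e p 0 l = 0;
  fc_flat : forall p, vn p < s -> forall z : C, z != 0 -> flat_at g c E D p z }.

Lemma frob_chart_exists (r : C) g c e E D phi :
  frobenius r g c e E D -> flat_chart r g phi ->
  exists s G0, [/\ 0 < s, frob_chart s g c e E D phi G0 &
    forall p, vn p < s -> ball (0 : ptN) r p].
Proof.
move=> [r0 F] [phi0 [J0 [rh [G0 [rh0 [sub H]]]]]].
have inr p : vn p < re rh -> ball (0 : ptN) rh p by exact: vn_ball.
have inr' p : vn p < re rh -> ball (0 : ptN) r p by move=> /inr /sub.
have s0 : 0 < re rh by have [_ +] := gt0_complexE rh0.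
have z0 : vn (0 : pt) < re rh by rewrite vn0.
have G0s : G0^T = G0.
  have [_ Hg] := H 0 (inr _ z0).
  have [_ [_ [_ [_ [[gs _] _]]]]] := F 0 (inr' _ z0).
  have canc (J A B : mx) : J \in unitmx -> J *m A *m J^T = J *m B *m J^T -> A = B.
    move=> Ju; have Jt : J^T \in unitmx by rewrite unitmx_tr.
    move=> /(congr1 (fun M => M *m invmx J^T)); rewrite !mulmxK// => /(congr1 (fun M => invmx J *m M)).
    by rewrite !mulKmx.
  apply: (canc (jac phi 0)) => //.
  by rewrite -Hg -[RHS]gs Hg !trmx_mul trmxK mulmxA.
have hb (f : pt -> C) : (forall p, vn p < re rh -> holo_at f p) -> hol 0 (re rh) f.
  by move=> h q; rewrite subr0; exact: h.
exists (re rh), G0; split; [exact: s0| |exact: inr'].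
split.
- by move=> a; apply: hb => p /inr /H [h _]; exact: h.
- by move=> i j k; apply: hb => p /inr' /F [_ [h _]]; exact: h.
- by move=> k; apply: hb => p /inr' /F [_ [_ [h _]]]; exact: h.
- by move=> k; apply: hb => p /inr' /F [_ [_ [_ [h _]]]]; exact: h.
- exact: G0s.
- by move=> p /inr /H [].
- by move=> p /inr' /F [_ [_ [_ [_ [[_ h] _]]]]]; exact: h.
(* A chart is assumed regular at 0 only; elsewhere its Jacobian is invertible as a factor of the
   invertible metric. *)
- move=> p ps; have [_ Hg] := H p (inr _ ps).
  have [_ [_ [_ [_ [[_ +] _]]]]] := F p (inr' _ ps).
  by rewrite Hg !unitmx_mul => /andP[/andP[]].
- by move=> p /inr' /F [_ [_ [_ [_ [_ [h _]]]]]]; exact: h.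
- by move=> p /inr' /F [_ [_ [_ [_ [_ [_ [h _]]]]]]]; exact: h.
- by move=> p /inr' /F [_ [_ [_ [_ [_ [_ [_ [_ [_ [h _]]]]]]]]]]; exact: h.
- by move=> p /inr' /F [_ [_ [_ [_ [_ [_ [_ [_ [_ [_ h]]]]]]]]]]; exact: h.
Qed.

Lemma prod_col c p (X Y : pt) : (prod c p X Y)^T = (\sum_i X 0 i *: Cm c i p) *m Y^T.
Proof.
rewrite /prod mulmx_suml raddf_sum; apply: eq_bigr => i _; rewrite raddf_sum /=.
rewrite -scalemxAl; apply/matrixP => k l; rewrite ord1 !mxE summxE mulr_sumr.
by apply: eq_bigr => j _; rewrite !mxE -mulrA [Y 0 j * _]mulrC.
Qed.

Lemma Um_sum c E p : Um c E p = \sum_i E p 0 i *: Cm c i p.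
Proof.
by apply/matrixP => k l; rewrite summxE [LHS]mxE; apply: eq_bigr => i _; rewrite !mxE.
Qed.

Lemma Um_col c E p (Y : pt) : Um c E p *m Y^T = (prod c p (E p) Y)^T.
Proof. by rewrite prod_col Um_sum. Qed.

Lemma prodC c p (X Y : pt) : (forall i j, c p i j = c p j i) -> prod c p X Y = prod c p Y X.
Proof.
move=> cC; rewrite /prod exchange_big; apply: eq_bigr => i _; apply: eq_bigr => j _.
by rewrite cC mulrC.
Qed.

(** The inverse metric in the Christoffel symbols is bypassed: by [christoffel_chart] they are
    expressed through the inverse Jacobian, whose holomorphy is the premise on
    [invmx (jac phi p)]. *)
Lemma frob_chart_reg (s t : R) g c e E D phi G0 : frob_chart s g c e E D phi G0 ->
  t <= s -> mhol t (fun p => invmx (jac phi p)) ->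
  [/\ forall i, mhol t (Gam g i), forall i, mhol t (Cm c i), mhol t (Um c E) & mhol t (hodge g E D)].
Proof.
move=> F ts hV.
have le (f : pt -> C) : hol 0 s f -> hol 0 t f by exact: hol_le.
have hC i : mhol t (Cm c i).
  apply: hol_mhol => k l; have -> : (fun q => Cm c i q k l) = fun q => c q i l 0 k.
    by apply/funext => q; exact: mxE.
  exact: le (fc_c F i l k).
have hG i : mhol t (Gam g i).
  apply: (@mhol_ext _ _ _ _ _ (fun p => (invmx (jac phi p))^T *m (Djac phi i p)^T)).
    move=> p pt; have ps := lt_le_trans pt ts.
    rewrite -(christoffel_chart i (fc_phi F) (fc_g F) (fc_G0 F) ps (fc_gu F ps) (fc_J F ps)).
    by rewrite trmx_inv mulKmx// unitmx_tr; exact: fc_J F _ ps.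
  apply: mhol_mul (mhol_tr hV) (mhol_tr _); apply: hol_mhol => l a.
  have -> : (fun q => Djac phi i q l a) = pd (pd (fun q => phi q 0 a) l) i.
    by apply/funext => q; exact: DjacE phi i q l a.
  by apply/le/hol_pd/hol_pd; exact: fc_phi F a.
have hE k : hol 0 t (fun q => E q 0 k) by exact: le (fc_Eh F k).
split=> //; apply: hol_mhol => k l.
  have -> : (fun q => Um c E q k l) = fun q => \sum_i E q 0 i * c q i l 0 k.
    by apply/funext => q; exact: mxE.
  by apply: hol_sum => i; apply: holM (hE i) (le _ (fc_c F i l k)).
have -> : (fun q => hodge g E D q k l) = fun q => pd (fun p => E p 0 k) l q +
    \sum_m Gam g l q k m * E q 0 m + - (D / 2%:R) * (k == l)%:R.
  apply/funext => q; rewrite mulNr; apply: etrans (mxE _ _ _ _) _; congr (_ + _ - _).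
  have GamE m : Gam g l q k m = christoffel g q k l m by exact: mxE.
  by apply: eq_bigr => m _; rewrite GamE.
apply: holD; last exact: hol_cst.
apply: holD; first by apply/le/hol_pd; exact: fc_Eh F k.
by apply: hol_sum => m; apply: holM (hE m); exact: mhol_hol (hG l).
Qed.

Lemma ball_pullback (psi : pt -> pt) (b : 'I_N -> 'I_N -> C) (t : R) : 0 < t -> psi 0 = 0 ->
  (forall k, fd (fun q => psi q 0 k) 0 (b k)) ->
  exists2 d : R, 0 < d & forall x, vn x < d -> vn (psi x) < t.
Proof.
move=> t0 p0 hp; have [d d0 [B B0 H]] := vn_incr hp.
have tB : 0 < t / B by rewrite divr_gt0.
exists (Num.min d (t / B)); first by rewrite lt_min d0.
move=> x; rewrite lt_min => /andP[xd xt].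
have := H x xd; rewrite add0r p0 subr0 => /le_lt_trans; apply.
by rewrite mulrC -ltr_pdivlMr.
Qed.

(* Passage of an endomorphism from the standard frame to the flat frame at p. *)
Definition conjf (phi : pt -> pt) (p : pt) (A : mx) : mx :=
  (jac phi p)^T *m A *m (invmx (jac phi p))^T.

Definition Cdir_at c p (w : pt) : mx := \sum_k w 0 k *: Cm c k p.

(** Row b of the inverse Jacobian holds the standard components of the b-th flat coordinate field,
    so this is multiplication by that field in the flat frame. *)
Definition Cfl (phi : pt -> pt) c (p : pt) (b : 'I_N) : mx :=
  conjf phi p (Cdir_at c p (row b (invmx (jac phi p)))).

Lemma row_entry (A : mx) b k : row b A 0 k = A b k.
Proof. exact: mxE. Qed.

Lemma conj_cmt (S T A B : mx) : T *m S = 1%:M ->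
  cmt (S *m A *m T) (S *m B *m T) = S *m cmt A B *m T.
Proof.
move=> TS; have K (A' B' : mx) : S *m A' *m T *m (S *m B' *m T) = S *m (A' *m B') *m T.
  by rewrite !mulmxA -(mulmxA (S *m A') T S) TS mulmx1.
by rewrite /cmt !K mulmxBr mulmxBl.
Qed.

Lemma trV (J : mx) : J \in unitmx -> (invmx J)^T *m J^T = 1%:M.
Proof. by move=> Ju; rewrite -trmx_mul mulmxV// trmx1. Qed.

Lemma conjf_cmt (phi : pt -> pt) p (A B : mx) : jac phi p \in unitmx ->
  cmt (conjf phi p A) (conjf phi p B) = conjf phi p (cmt A B).
Proof. by move=> Ju; exact: conj_cmt (trV Ju). Qed.

Lemma conjf0 (phi : pt -> pt) p : conjf phi p 0 = 0.
Proof. by rewrite /conjf mulmx0 mul0mx. Qed.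

Lemma conjfD (phi : pt -> pt) p A B : conjf phi p (A + B) = conjf phi p A + conjf phi p B.
Proof. by rewrite /conjf mulmxDr mulmxDl. Qed.

Lemma Cdir_cmt c p w (A : mx) : (forall i, cmt (Cm c i p) A = 0) -> cmt (Cdir_at c p w) A = 0.
Proof.
by move=> H; rewrite /Cdir_at cmt_suml big1// => i _; rewrite H scaler0.
Qed.

Lemma Cdir_comm c p v w : (forall i j, cmt (Cm c i p) (Cm c j p) = 0) ->
  cmt (Cdir_at c p v) (Cdir_at c p w) = 0.
Proof.
move=> H; apply: Cdir_cmt => i; rewrite cmtN Cdir_cmt ?oppr0// => j; exact: H.
Qed.

Lemma conjf_col (phi : pt -> pt) p (A : mx) (X : pt) : jac phi p \in unitmx ->
  conjf phi p A *m (X *m jac phi p)^T = (jac phi p)^T *m (A *m X^T).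
Proof.
move=> Ju; rewrite /conjf trmx_mul !mulmxA -(mulmxA _ (invmx _)^T) trV// mulmx1.
by [].
Qed.

(** Supplies the premise dS = S G of [gauge_deriv] for S = J^T, with x the flat coordinates and G
    the Christoffel matrix in the direction of a flat coordinate field. *)
Lemma mfd_frame (s : R) g c e E D phi G0 (psi : pt -> pt) x :
  frob_chart s g c e E D phi G0 -> vn (psi x) < s ->
  (forall k, fd (fun y => psi y 0 k) x (fun i => invmx (jac phi (psi x)) i k)) ->
  mfd (fun y => (jac phi (psi y))^T) x
    (fun b => (jac phi (psi x))^T *m \sum_k row b (invmx (jac phi (psi x))) 0 k *: Gam g k (psi x)).
Proof.
move=> F ps hp.
have H := mfd_comp (mfd_tr (mfd_jac (fc_phi F) ps)) hp.
have -> : (fun b => (jac phi (psi x))^T *m \sum_k row b (invmx (jac phi (psi x))) 0 k *: Gam g k (psi x)) =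
    fun b => \sum_k invmx (jac phi (psi x)) b k *: (Djac phi k (psi x))^T; last exact: H.
apply/funext => b; rewrite mulmx_sumr; apply: eq_bigr => k _.
rewrite -scalemxAr; congr (_ *: _); first exact: mxE.
exact: christoffel_chart (fc_phi F) (fc_g F) (fc_G0 F) ps (fc_gu F ps) (fc_J F ps).
Qed.

(** In the flat frame the partial derivatives in flat coordinates are the covariant derivatives
    along the flat coordinate fields. *)
Lemma mfd_conjf (s d : R) g c e E D phi G0 (psi : pt -> pt) x (F : pt -> mx) Fd A :
  frob_chart s g c e E D phi G0 -> 0 < d ->
  (forall y, vn (y - x) < d -> vn (psi y) < s) ->
  (forall k, fd (fun y => psi y 0 k) x (fun i => invmx (jac phi (psi x)) i k)) ->
  mfd F (psi x) Fd -> mfd (fun y => conjf phi (psi y) (F (psi y))) x A ->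
  forall b, A b = conjf phi (psi x)
    (\sum_k row b (invmx (jac phi (psi x))) 0 k *: (Fd k + cmt (Gam g k (psi x)) (F (psi x)))).
Proof.
move=> fc d0 hd hp hF hA b.
have xs : vn (psi x) < s by apply: hd; rewrite subrr vn0.
have hS := mfd_frame fc xs hp.
have hF' := mfd_comp hF hp.
have TS y : vn (y - x) < d -> (invmx (jac phi (psi y)))^T *m (jac phi (psi y))^T = 1%:M.
  by move=> /hd /(fc_J fc); exact: trV.
rewrite (gauge_deriv d0 TS hS hF' hA b) /conjf cmt_suml -big_split /=.
congr (_ *m _ *m _); apply: eq_bigr => k _.
by rewrite row_entry -scalerDr.
Qed.

Lemma conjf_reg (s t rho : R) g c e E D phi G0 (psi : pt -> pt) (F : pt -> mx) :
  frob_chart s g c e E D phi G0 -> t <= s -> mhol t (fun p => invmx (jac phi p)) ->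
  (forall x, vn x < rho -> vn (psi x) < t) -> (forall k, hol 0 rho (fun x => psi x 0 k)) ->
  mhol t F -> mhol rho (fun x => conjf phi (psi x) (F (psi x))).
Proof.
move=> fc ts hV hpsi hp hF.
have hJ : mhol t (jac phi).
  by apply: mhol_sub ts _ => p ps; eexists; exact: mfd_jac (fc_phi fc) ps.
apply: (mhol_comp hpsi hp (F := fun p => conjf phi p (F p))).
exact: mhol_mul (mhol_mul (mhol_tr hJ) hF) (mhol_tr hV).
Qed.

Lemma frob_split (s t : R) g c e E D phi G0 :
  frob_chart s g c e E D phi G0 -> t <= s -> mhol t (fun p => invmx (jac phi p)) ->
  forall p, vn p < t -> exists Ud hd, [/\ mfd (Um c E) p Ud /\ mfd (hodge g E D) p hd,
    forall i j, cmt (Cm c i p) (Cm c j p) = 0,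
    forall i, cmt (Cm c i p) (Um c E p) = 0,
    forall i, Ud i + cmt (Gam g i p) (Um c E p) = Cm c i p + - cmt (Cm c i p) (hodge g E D p) &
    forall i, hd i + cmt (Gam g i p) (hodge g E D p) = 0].
Proof.
move=> fc ts hV p pt; have ps := lt_le_trans pt ts.
have [hG hC hU hh] := frob_chart_reg fc ts hV.
have /choice [Gd hGd] := fun i => hG i p pt.
have /choice [Cd hCd] := fun i => hC i p pt.
have [Ud hUd] := hU p pt; have [hd hhd] := hh p pt.
have [H1 H2 H3 H4] := flat_at_split hGd hCd hUd hhd (fc_flat fc ps).
have rot (V : zmodType) (a b d : V) : a - b - d + b = a + - d by rewrite addrAC subrK.
exists Ud, hd; split; [by split|exact: H1|exact: H2| |] => i.
  by rewrite H3; exact: rot.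
by rewrite H4; exact: addNr.
Qed.

(** The unit is parallel, hence has constant components in the flat frame: the derivative of the
    frame cancels the Christoffel term of [fc_e]. *)
Lemma mfd_unit (s : R) g c e E D phi G0 (psi : pt -> pt) x :
  frob_chart s g c e E D phi G0 -> vn (psi x) < s ->
  (forall k, fd (fun y => psi y 0 k) x (fun i => invmx (jac phi (psi x)) i k)) ->
  mfd (fun y => (jac phi (psi y))^T *m (e (psi y))^T) x (fun=> 0).
Proof.
move=> fc ps hp.
have he : mfd (fun q => (e q)^T) (psi x) (fun k => - (Gam g k (psi x) *m (e (psi x))^T)).
  move=> a z; rewrite (ord1 z).
  have -> : (fun q => (e q)^T a 0) = fun q => e q 0 a by apply/funext => q; exact: mxE.
  have -> : (fun b => (- (Gam g b (psi x) *m (e (psi x))^T)) a 0) =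
      fun b => pd (fun q => e q 0 a) b (psi x); last first.
    by apply: holo_fd; apply: (fc_eh fc); rewrite subr0.
  apply/funext => b; have /eqP := fc_e fc ps b a; rewrite addr_eq0 => /eqP ->.
  apply: etrans (mxE _ _ _ _) _; congr (- _).
  apply: etrans (mxE _ _ _ _) _; apply: eq_bigr => l _.
  have -> : Gam g b (psi x) a l = christoffel g (psi x) a b l by exact: mxE.
  by have -> : (e (psi x))^T l 0 = e (psi x) 0 l by exact: mxE.
have H := mfdM (mfd_frame fc ps hp) (mfd_comp he hp).
have -> : (fun=> 0) = (fun b => (jac phi (psi x))^T *m
    (\sum_k row b (invmx (jac phi (psi x))) 0 k *: Gam g k (psi x)) *m (e (psi x))^T +
    (jac phi (psi x))^T *m
    \sum_k invmx (jac phi (psi x)) b k *: - (Gam g k (psi x) *m (e (psi x))^T)); last exact: H.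
apply/funext => b; rewrite -mulmxA -mulmxDr mulmx_suml -big_split /= big1 ?mulmx0// => k _.
by rewrite row_entry -scalemxAl -scalerDr subrr scaler0.
Qed.

Lemma conjf_unit (s : R) g c e E D phi G0 p b i :
  frob_chart s g c e E D phi G0 -> vn p < s -> e p *m jac phi p = const_mx 1 ->
  \sum_j Cfl phi c p b i j = (i == b)%:R.
Proof.
move=> fc ps he; have Ju := fc_J fc ps; have cC := fc_cC fc ps.
have K : Cfl phi c p b *m (const_mx 1 : pt)^T = (delta_mx 0 b : pt)^T.
  rewrite -he conjf_col// -prod_col (prodC _ _ cC).
  by rewrite (fc_unit fc ps) -trmx_mul -row_mul mulVmx// row1.
have := congr1 (fun M : 'cV[C]_N => M i 0) K.
have -> : (Cfl phi c p b *m (const_mx 1 : pt)^T) i 0 = \sum_j Cfl phi c p b i j.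
  rewrite [LHS]mxE; apply: eq_bigr => j _.
  have -> : (const_mx 1 : pt)^T j 0 = 1 by rewrite !mxE.
  exact: mulr1.
by move=> ->; rewrite !mxE eqxx.
Qed.

Lemma fd_hol (psi : pt -> pt) (rho : R) (b : pt -> 'I_N -> 'I_N -> C) :
  (forall x, vn x < rho -> forall k, fd (fun y => psi y 0 k) x (b x k)) ->
  forall k, hol 0 rho (fun y => psi y 0 k).
Proof. by move=> H k q; rewrite subr0 => qr; have [] := fd_holo (H q qr k). Qed.

Lemma vn_shrink (d : R) (x y : pt) : vn (y - x) < d - vn x -> vn y < d.
Proof. by move=> h; have := vnD x (y - x); rewrite (addrC x) subrK; move: h; clear; lra. Qed.

(** The inverse chart [psi] carries the operators to flat coordinates, where flatness of the
    connection becomes [flat_structure]. The normalization of the unit at 0 propagates because the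
    unit is parallel. *)
Theorem flat_coords (s : R) g c e E D phi G0 : 0 < s -> frob_chart s g c e E D phi G0 ->
  phi 0 = 0 -> e 0 *m jac phi 0 = const_mx 1 ->
  exists (rho sigma : R) (psi : pt -> pt),
  [/\ 0 < rho /\ 0 < sigma, psi 0 = 0,
    flat_structure rho (conjf phi 0 (hodge g E D 0)) (fun x b => Cfl phi c (psi x) b)
      (fun x => conjf phi (psi x) (Um c E (psi x))),
    forall x, vn x < rho -> [/\ vn (psi x) < s, phi (psi x) = x,
      forall k, fd (fun y => psi y 0 k) x (fun i => invmx (jac phi (psi x)) i k) &
      e (psi x) *m jac phi (psi x) = const_mx 1] &
    forall p, vn p < sigma -> [/\ vn p < s, vn (phi p) < rho & psi (phi p) = p]].
Proof.
move=> s0 fc phi0 he0.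
have [psi [rho1 [sigma1 [rho0 sigma0 psi0 Hpsi Hphi]]]] :=
  holo_inverse s0 phi0 (fc_phi fc) (fc_J fc).
have psihol : forall k, hol 0 rho1 (fun y => psi y 0 k).
  by apply: (fd_hol (b := fun x k i => invmx (jac phi (psi x)) i k)) => x /Hpsi [].
(* On this ball [psi] is a left inverse of [phi], so the inverse Jacobian of [phi] is the Jacobian
   of [psi] composed with [phi], which makes it holomorphic. *)
pose t := Num.min sigma1 s.
have t0 : 0 < t by rewrite lt_min sigma0.
have ts : t <= s by rewrite ge_min lexx orbT.
have tsig p : vn p < t -> vn p < sigma1 by rewrite lt_min => /andP[].
clearbody t.
have hW : mhol rho1 (jac psi).
  apply: hol_mhol => i k; rewrite jac_fun; exact: hol_pd.
have hW' : mhol rho1 (fun x => invmx (jac phi (psi x))).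
  apply: mhol_ext hW => x /Hpsi [_ _ hx]; apply/matrixP => i k.
  by rewrite jacE; have [_ ->] := fd_holo (hx k).
have hV : mhol t (fun p => invmx (jac phi p)).
  have pt' p : vn p < t -> vn (phi p) < rho1 by move=> /tsig /Hphi [].
  have := mhol_comp pt' (fun k => hol_le ts (fc_phi fc k)) hW'.
  by apply: mhol_ext => p /tsig /Hphi [_ _ ->].
have z0 : vn (0 : pt) < rho1 by rewrite vn0.
have [_ _ h0] := Hpsi 0 z0.
have [d d0 Hd] := ball_pullback t0 psi0 h0.
pose rho := Num.min rho1 d.
have rho'0 : 0 < rho by rewrite lt_min rho0.
have rr1 : rho <= rho1 by rewrite ge_min lexx.
have rrd x : vn x < rho -> vn (psi x) < t by rewrite lt_min => /andP[_ /Hd].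
clearbody rho.
have [d' d'0 Hd'] := @ball_pullback phi (fun k i => pd (fun q => phi q 0 k) i 0) rho rho'0 phi0
  (fun k => holo_fd (hol_holo s0 (fc_phi fc k))).
have fdp (x : pt) : vn x < rho -> forall k, fd (fun y => psi y 0 k) x (fun i => invmx (jac phi (psi x)) i k).
  by move=> xr; have [] := Hpsi x (lt_le_trans xr rr1).
have near (x : pt) : vn x < rho -> forall y, vn (y - x) < rho - vn x -> vn (psi y) < s.
  by move=> _ y /vn_shrink /rrd /lt_le_trans; apply.
have gap (x : pt) : vn x < rho -> 0 < rho - vn x by rewrite subr_gt0.
have hpl k : hol 0 rho (fun y => psi y 0 k) by exact: hol_le rr1 (psihol k).
have [hG hC hU hh] := frob_chart_reg fc ts hV.
have reg := conjf_reg fc ts hV rrd hpl.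
(* The operator mu is parallel, so its matrix in the flat frame has zero differential. *)
have muc (x : pt) : vn x < rho ->
    conjf phi (psi x) (hodge g E D (psi x)) = conjf phi 0 (hodge g E D 0).
  rewrite -psi0; move: x; apply: (mfd_const (r := rho) (F := fun x => conjf phi (psi x) (hodge g E D (psi x)))).
  move=> x xr; have [A hA] := reg _ hh x xr.
  have [Ud [hd [[_ hhd] _ _ _ H]]] := frob_split fc ts hV (rrd x xr).
  have A0 := mfd_conjf fc (gap x xr) (near x xr) (fdp x xr) hhd hA.
  suff <- : A = fun=> 0 by exact: hA.
  apply/funext => b; rewrite A0 big1 ?conjf0// => k _.
  by rewrite H scaler0.
have unit x : vn x < rho -> e (psi x) *m jac phi (psi x) = const_mx 1.
  have K := @mfd_const _ _ _ _ rho (fun x => (jac phi (psi x))^T *m (e (psi x))^T).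
  move=> xr; apply: trmx_inj; rewrite trmx_mul K ?psi0 -?trmx_mul ?he0//.
  move=> y yr; apply: mfd_unit fc _ (fdp y yr).
  exact: lt_le_trans (rrd y yr) ts.
have dU x : vn x < rho -> forall b i j,
    pd (fun x => conjf phi (psi x) (Um c E (psi x)) i j) b x =
    (Cfl phi c (psi x) b + cmt (conjf phi 0 (hodge g E D 0)) (Cfl phi c (psi x) b)) i j.
  move=> xr b i j; have [A hA] := reg _ hU x xr.
  have [Ud [hd [[hUd _] _ _ H _]]] := frob_split fc ts hV (rrd x xr).
  have A0 := mfd_conjf fc (gap x xr) (near x xr) (fdp x xr) hUd hA b.
  have [_ ->] := fd_holo (hA i j); rewrite A0 -(muc x xr).
  have Ju : jac phi (psi x) \in unitmx by exact: (fc_J fc (lt_le_trans (rrd x xr) ts)).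
  rewrite conjf_cmt// -conjfD; congr (conjf _ _ _ i j).
  rewrite cmtN cmt_suml -sumrN -big_split; apply: eq_bigr => k _.
  by rewrite H /= scalerDr scalerN.
exists rho, (Num.min t d'), psi; split; [|exact: psi0| | |].
- by rewrite lt_min t0 d'0.
- split.
  + move=> b i j; apply: (@mhol_hol _ _ _ _ rho (fun x => Cfl phi c (psi x) b)).
    apply: (reg (fun p => Cdir_at c p (row b (invmx (jac phi p))))).
    apply: hol_mhol => k l.
    have -> : (fun q => Cdir_at c q (row b (invmx (jac phi q))) k l) =
        fun q => \sum_m invmx (jac phi q) b m * Cm c m q k l.
      apply/funext => q; rewrite /Cdir_at summxE; apply: eq_bigr => m _.
      by rewrite [LHS]mxE row_entry.
    by apply: hol_sum => m; apply: holM; [exact: mhol_hol hV|exact: mhol_hol (hC m)].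
  + by move=> i j; apply: mhol_hol; exact: reg hU.
  + move=> x xr b b'; have [_ [_ [_ H _ _ _]]] := frob_split fc ts hV (rrd x xr).
    rewrite conjf_cmt; last by exact: (fc_J fc (lt_le_trans (rrd x xr) ts)).
    by rewrite Cdir_comm ?conjf0.
  + move=> x xr b; have [_ [_ [_ _ H _ _]]] := frob_split fc ts hV (rrd x xr).
    rewrite conjf_cmt; last by exact: (fc_J fc (lt_le_trans (rrd x xr) ts)).
    by rewrite Cdir_cmt ?conjf0.
  + exact: dU.
  + move=> x xr b i; apply: conjf_unit fc _ (unit x xr).
    exact: lt_le_trans (rrd x xr) ts.
- move=> x xr; have [h1 h2 h3] := Hpsi x (lt_le_trans xr rr1).
  by split; [exact: h1|exact: h2|exact: h3|exact: unit].
- move=> p; rewrite lt_min => /andP[/tsig pt /Hd' pr].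
  by have [h1 _ h3] := Hphi p pt; split; [exact: h1|exact: pr|exact: h3].
Qed.

(** * The idempotent frame at the origin and the transport of tensors *)

Lemma prodZl c p (a : C) (X Y : pt) : prod c p (a *: X) Y = a *: prod c p X Y.
Proof.
rewrite /prod scaler_sumr; apply: eq_bigr => i _; rewrite scaler_sumr; apply: eq_bigr => j _.
by rewrite scalerA; congr (_ *: _); rewrite mxE mulrA.
Qed.

Lemma prodZr c p (a : C) (X Y : pt) : prod c p X (a *: Y) = a *: prod c p X Y.
Proof.
rewrite /prod scaler_sumr; apply: eq_bigr => i _; rewrite scaler_sumr; apply: eq_bigr => j _.
by rewrite scalerA; congr (_ *: _); rewrite mxE mulrCA.
Qed.

Lemma prod_suml c p (a : pt) (P : mx) (Y : pt) :
  prod c p (a *m P) Y = \sum_k a 0 k *: prod c p (row k P) Y.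
Proof.
apply: trmx_inj; rewrite prod_col raddf_sum /= mulmx_suml.
under [RHS]eq_bigr => k _ do rewrite linearZ /= prod_col mulmx_suml scaler_sumr.
rewrite exchange_big; apply: eq_bigr => i _.
rewrite mxE -scalemxAl scaler_suml; apply: eq_bigr => k _.
by rewrite mxE -scalemxAl scalerA.
Qed.

Definition idem_frame c E (Q : mx) (u : 'I_N -> C) :=
  [/\ Q \in unitmx,
      forall i j, prod c 0 (row i Q) (row j Q) = (i == j)%:R *: row j Q &
      forall j, prod c 0 (E 0) (row j Q) = u j *: row j Q].

Lemma rowV (Q : mx) j : Q \in unitmx -> row j Q *m invmx Q = delta_mx 0 j.
Proof. by move=> Qu; rewrite -row_mul mulmxV// row1. Qed.

Lemma delta0E (i j : 'I_N) : (delta_mx 0 i : pt) 0 j = (j == i)%:R.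
Proof. by rewrite mxE eqxx. Qed.

Lemma frame_unit c e E Q u : idem_frame c E Q u -> (forall X, prod c 0 (e 0) X = X) ->
  e 0 *m invmx Q = const_mx 1.
Proof.
move=> [Qu idem _] cU; set a := e 0 *m invmx Q.
apply/matrixP => z j; rewrite (ord1 z).
have := cU (row j Q); have -> : e 0 = a *m Q by rewrite mulmxKV.
rewrite prod_suml (bigD1 j)//= big1 ?addr0; last first.
  by move=> i /negPf ij; rewrite idem ij scale0r scaler0.
rewrite idem eqxx scale1r => /(congr1 (fun v => (v *m invmx Q) 0 j)).
rewrite -scalemxAl rowV// [LHS]mxE delta0E eqxx mulr1 => ->.
by rewrite mxE.
Qed.

(** The rows of [P] are common eigenvectors, so the product of two distinct ones is proportional to
    both and vanishes. Semisimplicity makes their squares nonzero, and dividing each row by its own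
    eigenvalue yields idempotents. *)
Lemma frame_exists g c e E D : (forall i j, c 0 i j = c 0 j i) ->
  (forall X, prod c 0 (e 0) X = X) -> semisimple0 c e -> mu_hyp g c E D ->
  exists Q u, idem_frame c E Q u /\
    forall i j, u i = u j -> (Q *m (hodge g E D 0)^T *m invmx Q) j i = 0.
Proof.
move=> cC cU ss [P [u [Pu diag Eu muz]]].
have orth i j : i != j -> prod c 0 (row i P) (row j P) = 0.
  move=> ij; have [a Ha] := diag (row i P) j; have [b Hb] := diag (row j P) i.
  rewrite Ha; have /(congr1 (fun v => (v *m invmx P) 0 j)) : a *: row j P = b *: row i P.
    by rewrite -Ha -Hb prodC.
  rewrite -!scalemxAl !rowV// [LHS]mxE [RHS]mxE !delta0E eqxx eq_sym (negPf ij) mulr1 mulr0 => ->.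
  by rewrite scale0r.
have /choice [l hl] := fun j => diag (row j P) j.
have l0 j : l j != 0.
  (* A vanishing square would make this row nilpotent: the power of exponent 2 in [apow] is X (X
     e). *)
  apply/eqP => lj; have : row j P = 0.
    apply: (ss _ 1%N) => /=; rewrite [X in prod c 0 _ X]prodC// cU hl lj scale0r.
    by [].
  move=> /(congr1 (fun v => (v *m invmx P) 0 j)); rewrite rowV// delta0E eqxx mul0mx mxE.
  by move=> /eqP; rewrite oner_eq0.
pose d : pt := \row_j (l j)^-1; pose d' : pt := \row_j l j.
have dd : diag_mx d *m diag_mx d' = 1%:M.
  rewrite mulmx_diag -diag_const_mx; congr diag_mx; apply/matrixP => z j.
  by rewrite !mxE mulVf.
have [du _] := mulmx1_unit dd.
have dV : invmx (diag_mx d) = diag_mx d'.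
  by rewrite -[RHS](mulKmx du) dd mulmx1.
have rowQ j : row j (diag_mx d *m P) = (l j)^-1 *: row j P.
  by apply/rowP => k; rewrite mxE mul_diag_mx !mxE.
exists (diag_mx d *m P), u; split.
  split.
  - by rewrite unitmx_mul du.
  - move=> i j; rewrite !rowQ prodZl prodZr; case: eqVneq => [->|ij].
      by rewrite hl scale1r !scalerA -mulrA mulVf// mulr1.
    by rewrite (orth _ _ ij) scale0r !scaler0.
  - by move=> j; rewrite rowQ prodZr Eu !scalerA mulrC.
(* Rescaling the frame conjugates the matrix of mu by a diagonal matrix, which preserves its
   vanishing entries. *)
move=> i j uij; have -> : invmx (diag_mx d *m P) = invmx P *m diag_mx d'.
  have QV : (invmx P *m diag_mx d') *m (diag_mx d *m P) = 1%:M.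
    by rewrite -dV mulmxA mulmxKV// mulVmx.
  have [_ Qu] := mulmx1_unit QV.
  by rewrite -[RHS](mulmxK Qu) QV mul1mx.
rewrite !mulmxA mul_mx_diag mxE -!mulmxA mul_diag_mx mxE mulmxA muz//.
by rewrite mulr0 mul0r.
Qed.

Lemma col_delta (A B : mx) : (forall j, A *m (delta_mx 0 j : pt)^T = B *m (delta_mx 0 j : pt)^T) -> A = B.
Proof.
move=> H; apply: trmx_inj; apply/row_matrixP => j.
by rewrite !rowE; apply: trmx_inj; rewrite !trmx_mul !trmxK.
Qed.

Lemma conjf_frame (phi : pt -> pt) (Q : mx) (A : mx) j : Q \in unitmx -> jac phi 0 = invmx Q ->
  conjf phi 0 A *m (delta_mx 0 j : pt)^T = (jac phi 0)^T *m (A *m (row j Q)^T).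
Proof.
move=> Qu JQ; rewrite -conjf_col; last by rewrite JQ unitmx_inv.
by rewrite JQ rowV.
Qed.

Lemma frame_C c E (phi : pt -> pt) (Q : mx) u b : idem_frame c E Q u -> jac phi 0 = invmx Q ->
  Cfl phi c 0 b = delta_mx b b.
Proof.
move=> [Qu idem _] JQ; apply: col_delta => j; rewrite (conjf_frame _ _ Qu JQ).
rewrite -prod_col JQ invmxK idem -trmx_mul -scalemxAl rowV// trmx_delta mul_delta_mx_cond.
by rewrite linearZ /= trmx_delta; case: eqVneq => [->|]; rewrite ?scale1r ?scale0r.
Qed.

Lemma frame_U c E (phi : pt -> pt) (Q : mx) u : idem_frame c E Q u -> jac phi 0 = invmx Q ->
  conjf phi 0 (Um c E 0) = diag_mx (\row_i u i).
Proof.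
move=> [Qu _ HE] JQ; apply: col_delta => j; rewrite (conjf_frame _ _ Qu JQ).
rewrite Um_col HE JQ -trmx_mul -scalemxAl rowV//.
apply: trmx_inj; rewrite trmx_mul !trmxK tr_diag_mx -rowE.
by rewrite row_diag_mx mxE.
Qed.

Lemma frame_mu (phi : pt -> pt) (Q A : mx) : Q \in unitmx -> jac phi 0 = invmx Q ->
  conjf phi 0 A = (Q *m A^T *m invmx Q)^T.
Proof. by move=> Qu JQ; rewrite /conjf JQ invmxK !trmx_mul trmxK mulmxA. Qed.

Lemma jac_mulmx (phi : pt -> pt) (B : mx) p : (forall a, holo_at (fun q => phi q 0 a) p) ->
  (forall a, holo_at (fun q => (phi q *m B) 0 a) p) /\
  jac (fun q => phi q *m B) p = jac phi p *m B.
Proof.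
move=> h.
have H k := fd_mulmx B k (fun k => holo_fd (h k)).
split; first by move=> a; have [] := fd_holo (H a).
apply/matrixP => i k; rewrite jacE; have [_ ->] := fd_holo (H k).
by rewrite mxE; apply: eq_bigr => m _; rewrite -jacE.
Qed.

Lemma flat_chart_mul (r : C) g (phi : pt -> pt) (B : mx) : B \in unitmx -> flat_chart r g phi ->
  flat_chart r g (fun p => phi p *m B) /\ jac (fun p => phi p *m B) 0 = jac phi 0 *m B.
Proof.
move=> Bu [phi0 [Ju [rho [G0 [rho0 [sub H]]]]]].
have hp0 : ball (0 : ptN) rho 0 by exact: ballxx.
have J p (hp : ball (0 : ptN) rho p) := jac_mulmx B (proj1 (H p hp)).
have [_ J0] := J 0 hp0.
split; last exact: J0.
split; first by rewrite phi0 mul0mx.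
split; first by rewrite J0 unitmx_mul Ju.
exists rho, (invmx B *m G0 *m (invmx B)^T); split; first exact: rho0.
split; first exact: sub.
move=> p hp; have [h1 h2] := J p hp; split; first exact: h1.
have [_ ->] := H p hp; rewrite h2 trmx_mul.
move: (jac phi p) => Jp.
have BV : (invmx B)^T *m B^T = 1%:M by exact: trV.
by rewrite !mulmxA mulmxK// -!mulmxA (mulmxA _ B^T) BV mul1mx.
Qed.

Lemma flat_structure_sub (r s : R) mu (Cb : pt -> 'I_N -> mx) (U : pt -> mx) : s <= r ->
  flat_structure r mu Cb U -> flat_structure s mu Cb U.
Proof.
move=> sr [h1 h2 h3 h4 h5 h6]; split.
- by move=> b i j; exact: hol_le sr (h1 b i j).
- by move=> i j; exact: hol_le sr (h2 i j).
- by move=> x xs; apply: h3; exact: lt_le_trans sr.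
- by move=> x xs; apply: h4; exact: lt_le_trans sr.
- by move=> x xs; apply: h5; exact: lt_le_trans sr.
- by move=> x xs; apply: h6; exact: lt_le_trans sr.
Qed.

Lemma Cdir_mul c p (v : pt) (M : mx) :
  Cdir_at c p (v *m M) = \sum_b v 0 b *: Cdir_at c p (row b M).
Proof.
rewrite /Cdir_at; under [RHS]eq_bigr do rewrite scaler_sumr.
rewrite exchange_big; apply: eq_bigr => k _.
rewrite mxE scaler_suml; apply: eq_bigr => b _.
by rewrite scalerA row_entry.
Qed.

Lemma conjf_Cdir (phi : pt -> pt) c p (X : pt) : jac phi p \in unitmx ->
  conjf phi p (Cdir_at c p X) = \sum_b (X *m jac phi p) 0 b *: Cfl phi c p b.
Proof.
move=> Ju; rewrite -{1}(mulmxK Ju X) Cdir_mul /Cfl /conjf mulmx_sumr mulmx_suml.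
by apply: eq_bigr => b _; rewrite -scalemxAr -scalemxAl.
Qed.

Lemma prod_conjf (phi : pt -> pt) c p (X Y : pt) : jac phi p \in unitmx ->
  (prod c p X Y *m jac phi p)^T = conjf phi p (Cdir_at c p X) *m (Y *m jac phi p)^T.
Proof. by move=> Ju; rewrite (conjf_col _ _ Ju) -(prod_col c p X Y) trmx_mul. Qed.

Lemma bil_mx (A B : mx) : (forall X Y : pt, bil A X Y = bil B X Y) -> A = B.
Proof.
have K (M : mx) i j : bil M (delta_mx 0 i) (delta_mx 0 j) = M i j.
  by rewrite /bil -rowE trmx_delta -colE !mxE.
by move=> H; apply/matrixP => i j; rewrite -!K.
Qed.

Lemma min_radius (a b : R) : 0 < a -> 0 < b ->
  exists2 m, 0 < m & forall x, x < m -> x < a /\ x < b.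
Proof.
move=> a0 b0; exists (Num.min a b); first by rewrite lt_min a0.
by move=> x; rewrite lt_min => /andP[].
Qed.

Lemma mulmx_divK (A B : mx) (v w : pt) : A \in unitmx -> B \in unitmx ->
  v *m (invmx A *m B) = w *m B -> v = w *m A.
Proof.
move=> Au Bu; rewrite mulmxA => /(can_inj (mulmxK Bu)) <-.
by rewrite mulmxKV.
Qed.

Lemma bil_mul (G L : mx) (X Y : pt) : bil G (X *m L) (Y *m L) = bil (L *m G *m L^T) X Y.
Proof. by rewrite /bil trmx_mul !mulmxA. Qed.

Lemma invmxM (X Y : mx) : X \in unitmx -> Y \in unitmx -> invmx (X *m Y) = invmx Y *m invmx X.
Proof.
move=> Xu Yu; have XYu : X *m Y \in unitmx by rewrite unitmx_mul Xu.
have K : (invmx Y *m invmx X) *m (X *m Y) = 1%:M.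
  by rewrite -mulmxA (mulKmx Xu) mulVmx.
by rewrite -[RHS](mulmxK XYu) K mul1mx.
Qed.

Lemma similar_transfer (Q L M M' : mx) : Q \in unitmx -> L \in unitmx ->
  (forall X : pt, X *m M *m L = X *m L *m M') ->
  Q *m L *m M' *m invmx (Q *m L) = Q *m M *m invmx Q.
Proof.
move=> Qu Lu h; have LM : M *m L = L *m M'.
  by apply/row_matrixP => i; rewrite !rowE !mulmxA.
by rewrite (invmxM Qu Lu) -(mulmxA Q L) -LM !mulmxA -(mulmxA _ L) (mulmxV Lu) mulmx1.
Qed.

Lemma metric_transfer (L Q G0 G0' g0 g0' : mx) : L \in unitmx -> Q \in unitmx ->
  g0 = invmx Q *m G0 *m (invmx Q)^T ->
  g0' = invmx (Q *m L) *m G0' *m (invmx (Q *m L))^T -> L *m g0' *m L^T = g0 -> G0 = G0'.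
Proof.
move=> Lu Qu h h' hL.
have K (M A B : mx) : M \in unitmx -> A = invmx M *m B *m (invmx M)^T -> B = M *m A *m M^T.
  move=> Mu ->.
  by rewrite -!mulmxA -trmx_mul (mulmxV Mu) trmx1 mulmx1 (mulKVmx Mu).
have QLu : Q *m L \in unitmx by rewrite unitmx_mul Qu.
by rewrite (K Q g0 G0 Qu h) (K _ g0' G0' QLu h') -hL trmx_mul !mulmxA.
Qed.

(* The isomorphism is the identity in the two flat coordinate systems. *)
Lemma transport_iso (phi1 phi2 : pt -> pt) (G : mx) g c e E g' c' e' E' p q (J : mx) :
  jac phi1 p \in unitmx -> jac phi2 q \in unitmx ->
  J = jac phi1 p *m invmx (jac phi2 q) ->
  g p = jac phi1 p *m G *m (jac phi1 p)^T -> g' q = jac phi2 q *m G *m (jac phi2 q)^T ->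
  e p *m jac phi1 p = e' q *m jac phi2 q ->
  (forall X, prod c p X (e p) = X) -> (forall X, prod c' q X (e' q) = X) ->
  (forall b, Cfl phi1 c p b = Cfl phi2 c' q b) ->
  conjf phi1 p (Um c E p) = conjf phi2 q (Um c' E' q) ->
  [/\ J *m g' q *m J^T = g p,
      forall X Y : pt, prod c p X Y *m J = prod c' q (X *m J) (Y *m J),
      e p *m J = e' q & E p *m J = E' q].
Proof.
move=> J1u J2u JE hg hg' he cU cU' hC hU.
have JJ (X : pt) : X *m J *m jac phi2 q = X *m jac phi1 p.
  by rewrite JE; move: (jac phi1 p) (jac phi2 q) J2u => A B Bu; rewrite mulmxA mulmxKV.
have back (X Y : pt) : X *m jac phi1 p = Y *m jac phi2 q -> X *m J = Y.
  rewrite JE; move: (jac phi1 p) (jac phi2 q) J2u => A B Bu h.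
  by rewrite mulmxA h mulmxK.
have ee := back _ _ he.
split.
- rewrite hg' hg JE; move: (jac phi1 p) (jac phi2 q) J2u => A B Bu.
  have: invmx B *m B = 1%:M by rewrite mulVmx.
  move: (invmx B) => I IB; have BI : B^T *m I^T = 1%:M by rewrite -trmx_mul IB trmx1.
  rewrite trmx_mul -!mulmxA (mulmxA B^T) BI mul1mx (mulmxA I) IB mul1mx.
  by [].
- move=> X Y; apply: back; apply: trmx_inj.
  apply: etrans (prod_conjf c X Y J1u) _.
  apply: etrans _ (esym (prod_conjf c' (X *m J) (Y *m J) J2u)).
  have K : conjf phi1 p (Cdir_at c p X) = conjf phi2 q (Cdir_at c' q (X *m J)).
    apply: etrans (conjf_Cdir c X J1u) _; apply: etrans _ (esym (conjf_Cdir c' (X *m J) J2u)).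
    apply: eq_bigr => b _; exact: (congr2 (fun (v : pt) M => v 0 b *: M) (esym (JJ X)) (hC b)).
  exact: (congr2 (fun (A : mx) (v : pt) => A *m v^T) K (esym (JJ Y))).
- exact: ee.
- apply: back; apply: trmx_inj.
  have K1 := prod_conjf c (E p) (e p) J1u; have K2 := prod_conjf c' (E' q) (e' q) J2u.
  rewrite cU in K1; rewrite cU' in K2.
  apply: etrans K1 _; apply: etrans _ (esym K2).
  have K : conjf phi1 p (Cdir_at c p (E p)) = conjf phi2 q (Cdir_at c' q (E' q)).
    by rewrite /Cdir_at -(Um_sum c E p) -(Um_sum c' E' q).
  exact: (congr2 (fun (A : mx) (v : pt) => A *m v^T) K he).
Qed.

End Chart.

(** * Comparison of the two structures in adapted flat charts *)

Theorem mainTheorem2 (R : realType) (N : nat)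
  (r : R[i]) (g : 'rV[R[i]]_N -> 'M[R[i]]_N)
  (c : 'rV[R[i]]_N -> 'I_N -> 'I_N -> 'rV[R[i]]_N)
  (e E : 'rV[R[i]]_N -> 'rV[R[i]]_N) (D : R[i])
  (r' : R[i]) (g' : 'rV[R[i]]_N -> 'M[R[i]]_N)
  (c' : 'rV[R[i]]_N -> 'I_N -> 'I_N -> 'rV[R[i]]_N)
  (e' E' : 'rV[R[i]]_N -> 'rV[R[i]]_N) (D' : R[i])
  (L : 'M[R[i]]_N) :
  (* the first Frobenius structure and its hypotheses at 0 *)
  frobenius r g c e E D ->
  semisimple0 c e -> euler_root_hyp c e E -> mu_hyp g c E D ->
  (* the second Frobenius structure, same hypotheses at 0 *)
  frobenius r' g' c' e' E' D' ->
  semisimple0 c' e' -> euler_root_hyp c' e' E' -> mu_hyp g' c' E' D' ->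
  (* L : T_0 M -> T_0 M', X |-> X *m L, is a linear isomorphism preserving
     metric, product, unit, Euler vector and intertwining mu, mu' *)
  L \in unitmx ->
  (forall X Y : 'rV[R[i]]_N, bil (g' 0) (X *m L) (Y *m L) = bil (g 0) X Y) ->
  (forall X Y : 'rV[R[i]]_N, prod c 0 X Y *m L = prod c' 0 (X *m L) (Y *m L)) ->
  e 0 *m L = e' 0 ->
  E 0 *m L = E' 0 ->
  (forall X : 'rV[R[i]]_N,
      mu_app g E D 0 X *m L = mu_app g' E' D' 0 (X *m L)) ->
  (* then for any flat coordinate charts phi, phi' centered at 0, the map Phi
     defined by phi' o Phi = A o phi, where A = dphi_0^-1 L dphi'_0 is the
     linear map of flat coordinates induced by L, is an isomorphism of the
     Frobenius structures near 0 *)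
  forall phi phi' : 'rV[R[i]]_N -> 'rV[R[i]]_N,
  flat_chart r g phi -> flat_chart r' g' phi' ->
  exists (rho : R[i]) (Phi : 'rV[R[i]]_N -> 'rV[R[i]]_N),
    0 < rho /\ Phi 0 = 0 /\
    forall p : 'rV[R[i]]_N, ball (0 : 'rV[R[i]]_N : normedModType R[i]) rho p ->
      [/\ ball (0 : 'rV[R[i]]_N : normedModType R[i]) r p
          /\ ball (0 : 'rV[R[i]]_N : normedModType R[i]) r' (Phi p),
          phi' (Phi p) = phi p *m (invmx (jac phi 0) *m L *m jac phi' 0),
          (forall a, holo_at (fun q => Phi q 0 a) p) /\ jac Phi p \in unitmx,
          jac Phi p *m g' (Phi p) *m (jac Phi p)^T = g p
          /\ (forall X Y : 'rV[R[i]]_N,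
                prod c p X Y *m jac Phi p
                = prod c' (Phi p) (X *m jac Phi p) (Y *m jac Phi p)) &
          e p *m jac Phi p = e' (Phi p) /\ E p *m jac Phi p = E' (Phi p)].
Proof.
move=> F ss _ mh F' _ _ _ Lu Lg Lprod Le LE Lmu phi phi' hphi hphi'.
have [r0 F0] := F; have [r'0 F'0] := F'.
have [_ [_ [_ [_ [_ [cC0 [cU0 _]]]]]]] := F0 0 (ballxx _ r0).
have [_ [_ [_ [_ [_ [cC0' [cU0' _]]]]]]] := F'0 0 (ballxx _ r'0).
have [Q [u [fr muz]]] := frame_exists cC0 cU0 ss mh.
have [Qu idem HE] := fr.
(* Transporting the frame by [L], instead of choosing one for the second algebra, gives both the
   same eigenvalues [u] and the same ordering of the idempotents. *)
have fr' : idem_frame c' E' (Q *m L) u.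
  split; first by rewrite unitmx_mul Qu.
  - by move=> i j; rewrite !row_mul -Lprod idem scalemxAl.
  - by move=> j; rewrite !row_mul -LE -Lprod HE scalemxAl.
have [Q'u _ _] := fr'.
have Ju : jac phi 0 \in unitmx by case: hphi => _ [].
have J'u : jac phi' 0 \in unitmx by case: hphi' => _ [].
(* The chart [phi *m B] has Jacobian [invmx Q] at 0, so its coordinate axes there are the
   idempotents. *)
pose B := invmx (jac phi 0) *m invmx Q.
pose A := invmx (jac phi 0) *m L *m jac phi' 0.
have Bu : B \in unitmx by rewrite unitmx_mul !unitmx_inv Ju.
have Au : A \in unitmx.
  rewrite /A; move: (jac phi 0) (jac phi' 0) Ju J'u => a b au bu.
  by rewrite !unitmx_mul unitmx_inv au Lu bu.
have ABu : invmx A *m B \in unitmx by rewrite unitmx_mul unitmx_inv Au.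
have [ch1 J1] := flat_chart_mul Bu hphi.
(* With the factor [invmx A *m B], equality of the adapted coordinates of p and q means phi' q = phi
   p A, and the Jacobian at 0 is the inverse of the transported frame. *)
have [ch2 J2] := flat_chart_mul ABu hphi'.
have J1Q : jac (fun p => phi p *m B) 0 = invmx Q by exact: etrans J1 (mulKVmx Ju _).
have J2Q : jac (fun p => phi' p *m (invmx A *m B)) 0 = invmx (Q *m L).
  rewrite J2 /A /B; move: (jac phi 0) (jac phi' 0) Ju J'u => a b au bu.
  have aLu : invmx a *m L \in unitmx by rewrite unitmx_mul unitmx_inv au.
  have aiu : invmx a \in unitmx by rewrite unitmx_inv.
  rewrite (invmxM aLu bu) (invmxM aiu Lu) (invmxM Qu Lu) invmxK.
  by rewrite -!mulmxA (mulKVmx bu) (mulKVmx au).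
have ABK (v w : 'rV[R[i]]_N) := @mulmx_divK _ _ A B v w Au Bu.
rewrite -/A; clearbody A B.
set phi1 := fun p => phi p *m B in ch1 J1 J1Q.
set phi2 := fun p => phi' p *m (invmx A *m B) in ch2 J2 J2Q.
have phi10 : phi1 0 = 0 by case: ch1.
have phi20 : phi2 0 = 0 by case: ch2.
have hphi12 q p : phi2 q = phi1 p -> phi' q = phi p *m A by exact: ABK.
clearbody phi1 phi2.
have [s1 [G1 [s10 fc1 in1]]] := frob_chart_exists F ch1.
have [s2 [G2 [s20 fc2 in2]]] := frob_chart_exists F' ch2.
have e1 : e 0 *m jac phi1 0 = const_mx 1 by rewrite J1Q; exact: frame_unit fr cU0.
have e2 : e' 0 *m jac phi2 0 = const_mx 1 by rewrite J2Q; exact: frame_unit fr' cU0'.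
have [rho1 [sg1 [psi1 [[rho10 sg10] psi10 fs1 H1 K1]]]] := flat_coords s10 fc1 phi10 e1.
have [rho2 [sg2 [psi2 [[rho20 sg20] psi20 fs2 H2 K2]]]] := flat_coords s20 fc2 phi20 e2.
have muE : conjf phi2 0 (hodge g' E' D' 0) = conjf phi1 0 (hodge g E D 0).
  rewrite (frame_mu _ Q'u J2Q) (frame_mu _ Qu J1Q); congr (_^T).
  exact: similar_transfer Qu Lu Lmu.
(* Both are Gram matrices of the idempotent frames at 0, which [L] identifies isometrically. *)
have GE : G1 = G2.
  have z1 : vn (0 : 'rV[R[i]]_N) < s1 by rewrite vn0.
  have z2 : vn (0 : 'rV[R[i]]_N) < s2 by rewrite vn0.
  have g1 := fc_g fc1 z1; have g2 := fc_g fc2 z2.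
  rewrite J1Q in g1; rewrite J2Q in g2.
  apply: (metric_transfer Lu Qu g1 g2); apply: bil_mx => X Y.
  by rewrite -Lg; apply: esym; exact: bil_mul.
pose rho := Num.min rho1 rho2.
have rho0 : 0 < rho by rewrite lt_min rho10.
have le1 : rho <= rho1 by rewrite ge_min lexx.
have le2 : rho <= rho2 by rewrite ge_min lexx orbT.
clearbody rho.
rewrite muE in fs2.
have [t t0 Ht] : exists2 t : R, 0 < t & forall x, vn x < t ->
    (forall b, Cfl phi1 c (psi1 x) b = Cfl phi2 c' (psi2 x) b) /\
    conjf phi1 (psi1 x) (Um c E (psi1 x)) = conjf phi2 (psi2 x) (Um c' E' (psi2 x)).
  apply: (@flat_unique _ _ rho _ u (fun x b => Cfl phi1 c (psi1 x) b) _ (fun x b => Cfl phi2 c' (psi2 x) b) _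
    rho0 (flat_structure_sub le1 fs1) (flat_structure_sub le2 fs2)).
  - move=> a b uab; rewrite (frame_mu _ Qu J1Q) mxE; exact: muz.
  - by move=> b; rewrite psi10; exact: frame_C fr J1Q.
  - by move=> b; rewrite psi20; exact: frame_C fr' J2Q.
  - by rewrite psi10; exact: frame_U fr J1Q.
  - by rewrite psi10 psi20 (frame_U fr J1Q); exact: frame_U fr' J2Q.
have [m m0 Hm] := min_radius t0 rho0.
have [d d0 Hd] := ball_pullback m0 phi10 (fun k => holo_fd (hol_holo s10 (fc_phi fc1 k))).
have [sg sg0 Hsg] := min_radius d0 sg10.
(* Dividing by [N.+1] puts the sup-norm ball inside the l1 ball of radius [sg]. *)
exists (sg / N.+1%:R)%:C%C, (fun p => psi2 (phi1 p)).
split; first by rewrite ltcR divr_gt0// ltr0n.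
split; first by rewrite phi10 psi20.
move=> p /(ball_vn sg0) ps.
have [pd1 ps1] := Hsg _ ps; have [xt xr] := Hm _ (Hd _ pd1); have [p1 _ pp] := K1 p ps1.
have [q2 qq hq eq2] := H2 _ (lt_le_trans xr le2).
have [_ _ _ ep] := H1 _ (lt_le_trans xr le1); rewrite pp in ep.
have [hC hU] := Ht _ xt; rewrite pp in hC hU.
have J1u := fc_J fc1 p1; have J2u := fc_J fc2 q2.
have hp k : fd (fun q => phi1 q 0 k) p (fun i => jac phi1 p i k).
  have -> : (fun i => jac phi1 p i k) = fun i => pd (fun q => phi1 q 0 k) i p.
    by apply/funext => i; exact: jacE.
  by apply: holo_fd; apply: (fc_phi fc1); rewrite subr0.
have hPhi k := fd_comp (hq k) hp.
have JE : jac (fun p => psi2 (phi1 p)) p = jac phi1 p *m invmx (jac phi2 (psi2 (phi1 p))).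
  apply/matrixP => i k; apply: etrans (jacE _ _ _ _) _.
  have [_ ->] := fd_holo (hPhi k); exact: esym (mxE _ _ _ _).
have gp := fc_g fc1 p1; have gq := fc_g fc2 q2; rewrite -GE in gq.
have ee : e p *m jac phi1 p = e' (psi2 (phi1 p)) *m jac phi2 (psi2 (phi1 p)).
  by rewrite ep eq2.
have cU1 X : prod c p X (e p) = X by rewrite (prodC _ _ (fc_cC fc1 p1)) (fc_unit fc1 p1).
have cU2 X : prod c' (psi2 (phi1 p)) X (e' (psi2 (phi1 p))) = X.
  by rewrite (prodC _ _ (fc_cC fc2 q2)) (fc_unit fc2 q2).
have [T1 T2 T3 T4] := transport_iso J1u J2u JE gp gq ee cU1 cU2 hC hU.
split.
- by split; [exact: in1|exact: in2].
- exact: hphi12 qq.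
- split; first by move=> a; have [] := fd_holo (hPhi a).
  by rewrite JE unitmx_mul J1u unitmx_inv.
- by split; [exact: T1|exact: T2].
- by split; [exact: T3|exact: T4].
Qed.
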